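(* Let $X$ be a complex manifold of complex dimension $n$ and let $\omega$ be a complete Kähler-Einstein metric on $X$ with Ricci curvature $-(n+1)$, i.e. $\mathrm{Ric}_\omega=-(n+1)\omega$. Suppose that there exists a smooth function $\varphi:X\to\mathbb{R}$ with $i\partial\bar\partial\varphi=(n+1)\omega$ such that $$\|\partial\varphi\|_\omega\equiv n+1\quad\text{on } X.$$ Then the vector field $$V=i\,e^{\frac{\varphi}{n+1}}\,\mathrm{grad}(\varphi)$$ is a complete holomorphic vector field on $X$.
   Context: In local holomorphic coordinates $z=(z^1,\dots,z^n)$ write $\omega=i\,g_{\alpha\bar\beta}\,dz^\alpha\wedge dz^{\bar\beta}$ (summation convention), with $(g^{\bar\beta\alpha})$ the inverse matrix of $(g_{\alpha\bar\beta})$. The Ricci form is $\mathrm{Ric}_\omega=-i\partial\bar\partial\log\det(g_{\alpha\bar\beta})$. Put $\varphi_\alpha=\partial\varphi/\partial z^\alpha$ and $\varphi_{\bar\beta}=\partial\varphi/\partial z^{\bar\beta}$; then $\|\partial\varphi\|_\omega^2=\varphi_\alpha\varphi_{\bar\beta}g^{\alpha\bar\beta}$. The $(1,0)$-part of the gradient vector field of $\varphi$ is $\mathrm{grad}(\varphi)=\varphi^\alpha\frac{\partial}{\partial z^\alpha}$ with $\varphi^\alpha=\varphi_{\bar\beta}g^{\bar\beta\alpha}$. A holomorphic vector field $V$ is a holomorphic section of the $(1,0)$-tangent bundle $T^{1,0}X$; it is called complete if the real vector field $\mathrm{Re}\,V=V+\overline V$ is complete, i.e. all its integral curves are defined on the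 whole of $\mathbb{R}$. *)

(* Defs.v *)
From HB Require Import structures.
From mathcomp Require Import all_boot all_order all_algebra.
From mathcomp Require Import all_classical all_reals all_analysis.
From mathcomp Require Import complex.

Set Implicit Arguments.
Unset Strict Implicit.
Unset Printing Implicit Defensive.

Import Order.TTheory GRing.Theory Num.Theory.
Import numFieldNormedType.Exports.

Local Open Scope classical_set_scope.
Local Open Scope ring_scope.
Local Open Scope complex_scope.

(* R[i] as a normed module over itself, for the topology of the modulus. *)
#[warnings="-redundant-canonical-projection"]
HB.instance Definition _ (R : rcfType) := PseudoPointedMetric.copy R[i] R[i]^o.
#[warnings="-redundant-canonical-projection"]
HB.instance Definition _ (R : rcfType) := NormedModule.copy R[i] R[i]^o.

(** ** Calculus on open subsets of C^n, with C^n = 'rV[R[i]]_n *)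

Section Calculus.
Context {R : realType} {n : nat}.
Local Notation V := 'rV[R[i]]_n.

(* The direction of the real coordinate x^a (b = false) or y^a (b = true),
   where z^a = x^a + i y^a. *)
Definition coord_dir (a : 'I_n) (b : bool) : V :=
  (if b then 'i%C else 1) *: delta_mx 0 a.

Definition real_slice (u : V -> R) (z v : V) : R -> R :=
  fun t => u (z + t%:C *: v).

Definition rpartial (a : 'I_n) (b : bool) (u : V -> R) : V -> R :=
  fun z => derive1 (real_slice u z (coord_dir a b)) 0.

Fixpoint Ck (k : nat) (U : set V) (u : V -> R) : Prop :=
  (forall z, U z -> {for z, continuous u}) /\
  (if k is k'.+1 then
     forall a b,
       (forall z, U z -> derivable (real_slice u z (coord_dir a b)) 0 1) /\
       Ck k' U (rpartial a b u)
   else True).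

Definition smooth_on (U : set V) (u : V -> R) : Prop := forall k, Ck k U u.

Definition csmooth_on (U : set V) (f : V -> R[i]) : Prop :=
  smooth_on U (fun z => complex.Re (f z)) /\
  smooth_on U (fun z => complex.Im (f z)).

Definition cpartial (a : 'I_n) (b : bool) (f : V -> R[i]) : V -> R[i] :=
  fun z => rpartial a b (fun w => complex.Re (f w)) z
           +i* rpartial a b (fun w => complex.Im (f w)) z.

(* The Wirtinger operators d/dz^a and d/d(conj z^a). *)
Definition dz (a : 'I_n) (f : V -> R[i]) : V -> R[i] :=
  fun z => 2^-1 * (cpartial a false f z - 'i%C * cpartial a true f z).

Definition dzbar (a : 'I_n) (f : V -> R[i]) : V -> R[i] :=
  fun z => 2^-1 * (cpartial a false f z + 'i%C * cpartial a true f z).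

(* A (1,1)-form i h_{a bbar} dz^a /\ dzbar^b is represented throughout by its
   coefficient matrix h (factor i excluded): this is the matrix of
   i \partial \bar\partial f. *)
Definition i_ddbar (f : V -> R[i]) (z : V) : 'M[R[i]]_n :=
  \matrix_(a, b) dz a (dzbar b f) z.

(* h_{a bbar} v^a conj(v^b) *)
Definition herm (h : 'M[R[i]]_n) (v : V) : R[i] :=
  (v *m h *m (map_mx (fun x => x^*) v)^T) 0 0.

End Calculus.

(** ** Complex manifolds *)

(* The charts form an atlas indexed by an arbitrary type.  [chart_inv i] is only
   meaningful on the image of the chart i.  Differentiability of the transition
   maps is over the field R[i]: they are holomorphic. *)
Record complexManifold (R : realType) (n : nat) := ComplexManifold {
  carrier :> topologicalType;
  chart_index : Type;
  chart_dom : chart_index -> set carrier;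
  chart_map : chart_index -> carrier -> 'rV[R[i]]_n;
  chart_inv : chart_index -> 'rV[R[i]]_n -> carrier;
  chart_at : carrier -> chart_index;
  manifold_hausdorff : hausdorff_space carrier;
  manifold_second_countable : @second_countable carrier;
  chart_atP : forall x, chart_dom (chart_at x) x;
  chart_dom_open : forall i, open (chart_dom i);
  chart_img_open : forall i, open (chart_map i @` chart_dom i);
  chart_mapK : forall i x, chart_dom i x -> chart_inv i (chart_map i x) = x;
  chart_map_continuous : forall i x, chart_dom i x ->
    {for x, continuous (chart_map i)};
  chart_inv_continuous : forall i z, (chart_map i @` chart_dom i) z ->
    {for z, continuous (chart_inv i)};
  transition_holomorphic : forall i j z,
    (chart_map i @` (chart_dom i `&` chart_dom j)) z ->
    differentiable (chart_map j \o chart_inv i) z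
}.

Arguments chart_dom {R n} X i : rename.
Arguments chart_map {R n} X i x : rename.
Arguments chart_inv {R n} X i z : rename.
Arguments chart_at {R n} X x : rename.

Section Manifold.
Context {R : realType} {n : nat} (X : complexManifold R n).
Local Notation V := 'rV[R[i]]_n.

Definition chart_img (i : chart_index X) : set V :=
  chart_map X i @` chart_dom X i.

Definition overlap (i j : chart_index X) : set V :=
  chart_map X i @` (chart_dom X i `&` chart_dom X j).

Definition transition (i j : chart_index X) : V -> V :=
  chart_map X j \o chart_inv X i.

Definition local_rep (phi : X -> R) (i : chart_index X) : V -> R[i] :=
  fun z => (phi (chart_inv X i z))%:C.

Definition smooth_function (phi : X -> R) : Prop :=
  forall i, smooth_on (chart_img i) (phi \o chart_inv X i).

(** ** Kähler metrics *)

(* The form omega = i g_{a bbar} dz^a /\ dzbar^b, given by its coefficients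
   [metric i] in each chart.  Jacobian matrices act on row vectors on the
   right: ['J (transition i j) z a c] is d w^c / d z^a for w = transition i j z,
   and
   [metric_transform] is the invariance of omega under coordinate changes.
   [metric_closed] lists the coefficients of
     d omega = i (d_c g_{a bbar}) dz^c /\ dz^a /\ dzbar^b
             + i (d_cbar g_{a bbar}) dzbar^c /\ dz^a /\ dzbar^b
   after antisymmetrization. *)
Record kahlerMetric := KahlerMetric {
  metric : chart_index X -> V -> 'M[R[i]]_n;
  metric_smooth : forall i a b,
    csmooth_on (chart_img i) (fun z => metric i z a b);
  metric_hermitian : forall i z, chart_img i z ->
    forall a b, metric i z b a = (metric i z a b)^*;
  metric_posdef : forall i z, chart_img i z ->
    forall v, v != 0 -> 0 < herm (metric i z) v;
  metric_transform : forall i j z, overlap i j z ->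
    metric i z = 'J (transition i j) z *m metric j (transition i j z)
                 *m (map_mx (fun x => x^*) ('J (transition i j) z))^T;
  metric_closed : forall i z, chart_img i z -> forall a b c,
    dz c (fun w => metric i w a b) z - dz a (fun w => metric i w c b) z = 0 /\
    dzbar c (fun w => metric i w a b) z - dzbar b (fun w => metric i w a c) z
      = 0
}.

Definition ricci (w : kahlerMetric) (i : chart_index X) (z : V) : 'M[R[i]]_n :=
  - i_ddbar (fun z' => (ln (complex.Re (\det (metric w i z'))))%:C) z.

Definition kahler_einstein (w : kahlerMetric) (c : R) : Prop :=
  forall i z, chart_img i z -> ricci w i z = c%:C *: metric w i z.

(** ** Curves, Riemannian distance and completeness of the metric *)

Definition velocity (i : chart_index X) (gamma : R -> X) (t : R) : V :=
  \row_a (derive1 (fun s => complex.Re (chart_map X i (gamma s) 0 a)) t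
          +i* derive1 (fun s => complex.Im (chart_map X i (gamma s) 0 a)) t).

Definition coord_derivable (i : chart_index X) (gamma : R -> X) (t : R) : Prop :=
  forall a, derivable (fun s => complex.Re (chart_map X i (gamma s) 0 a)) t 1 /\
            derivable (fun s => complex.Im (chart_map X i (gamma s) 0 a)) t 1.

Definition C1_curve_at (gamma : R -> X) (t : R) : Prop :=
  {for t, continuous gamma} /\
  forall i, chart_dom X i (gamma t) ->
    (\forall s \near t, coord_derivable i gamma s) /\
    {for t, continuous (velocity i gamma)}.

(* The Riemannian metric of omega is omega(u, Jv), of squared norm
   2 g_{a bbar} dz^a(u) conj(dz^b(u)); by [metric_transform] the speed does not
   depend on the chart used. *)
Definition speed (w : kahlerMetric) (gamma : R -> X) (t : R) : R :=
  let i := chart_at X (gamma t) in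
  Num.sqrt (2 * complex.Re (herm (metric w i (chart_map X i (gamma t)))
                         (velocity i gamma t))).

(* [piecewise_C1_path w x y L]: some piecewise C^1 path from x to y has
   length L. *)
Inductive piecewise_C1_path (w : kahlerMetric) : X -> X -> \bar R -> Prop :=
| path_segment (gamma : R -> X) (a b : R) :
    a <= b -> (forall t, `[a, b]%classic t -> C1_curve_at gamma t) ->
    piecewise_C1_path w (gamma a) (gamma b)
      (\int[lebesgue_measure]_(t in `[a, b]) (speed w gamma t)%:E)%E
| path_concat (x y z : X) (L1 L2 : \bar R) :
    piecewise_C1_path w x y L1 -> piecewise_C1_path w y z L2 ->
    piecewise_C1_path w x z (L1 + L2)%E.

(* Points in different connected components are at distance +oo. *)
Definition riemannian_dist (w : kahlerMetric) (x y : X) : \bar R :=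
  ereal_inf [set L | piecewise_C1_path w x y L].

Definition complete_metric (w : kahlerMetric) : Prop :=
  forall u : nat -> X,
    (forall e : R, 0 < e -> exists N : nat, forall p q : nat,
       (N <= p)%N -> (N <= q)%N -> (riemannian_dist w (u p) (u q) < e%:E)%E) ->
    exists x : X, riemannian_dist w (u k) x @[k --> \oo] --> 0%E.

(** ** Gradient and vector fields of type (1,0) *)

(* Since g^{bbar a} is the inverse of g_{a bbar}, it is the entry (b, a) of
   [invmx (metric w i z)]. *)
Definition norm_del (w : kahlerMetric) (phi : X -> R) (i : chart_index X)
    (z : V) : R :=
  Num.sqrt (complex.Re (\sum_(a < n) \sum_(b < n)
    dz a (local_rep phi i) z * dzbar b (local_rep phi i) z
    * invmx (metric w i z) b a)).

(* A family of local components V^a, one for each chart. *)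
Definition components : Type := chart_index X -> V -> V.

Definition grad (w : kahlerMetric) (phi : X -> R) : components :=
  fun i z => \row_a \sum_(b < n)
    dzbar b (local_rep phi i) z * invmx (metric w i z) b a.

Definition holomorphic_vector_field (Y : components) : Prop :=
  (forall i j z, overlap i j z ->
     Y j (transition i j z) = Y i z *m 'J (transition i j) z) /\
  (forall i z, chart_img i z -> differentiable (Y i) z).

(* The velocity of an integral curve of Re Y = Y + conj(Y) has
   dz^a-component Y^a. *)
Definition integral_curve_on (Y : components) (J : set R) (gamma : R -> X) :
    Prop :=
  forall t, J t -> {for t, continuous gamma} /\
    forall i, chart_dom X i (gamma t) ->
      coord_derivable i gamma t /\
      velocity i gamma t = Y i (chart_map X i (gamma t)).

(* Through every point there is an integral curve of Re Y defined on R, and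
   every integral curve on an open interval is the restriction of such a one. *)
Definition complete_vector_field (Y : components) : Prop :=
  (forall x : X, exists gamma : R -> X,
     gamma 0 = x /\ integral_curve_on Y setT gamma) /\
  (forall (J : set R) (delta : R -> X),
     open J -> is_interval J -> integral_curve_on Y J delta ->
     exists gamma : R -> X, integral_curve_on Y setT gamma /\
       forall t, J t -> gamma t = delta t).

End Manifold.

(* Main.v *)
Require Import Defs.
From mathcomp Require Import all_boot all_order all_algebra.
From mathcomp Require Import all_classical all_reals all_analysis.
From mathcomp Require Import complex.
From mathcomp Require Import ring lra.
From mathcomp Require Import perm.

(** Write c = n + 1, phi_bbar and phi^a for the components of the differential
    and of the gradient of phi, and W_b^a = d phi^a / d zbar^b for the
    obstruction to the holomorphy of the gradient.

    Holomorphy.  Differentiating |d phi|^2 = c^2 and using d dbar phi = c g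
    gives phi_a W_b^a = - c phi_bbar ([dbar_grad_cograd]).  Lowering an index of
    W gives a symmetric tensor, because omega is closed ([dbar_grad_sym]), so
    that this relation may be transposed and conjugated: the derivative of
    conj (phi^b) in the direction grad phi is - c conj (phi^b)
    ([grad_geodesic]).  Taking the divergence of this relation brings in the
    Ricci form, and the Einstein equation yields |W|^2 = c^2
    ([norm_dbar_grad], a Bochner formula).  Consequently
    the tensor W_b^a + phi_bbar phi^a / c has squared norm
    c^2 - 2 c^2 + c^2 = 0 ([bochner_vanishing]).  Up to the factor
    exp (phi / c) this tensor is the derivative with respect to zbar^b of
    exp (phi / c) phi^a, so V satisfies the Cauchy-Riemann equations
    ([exp_grad_holomorphic], [cauchy_riemann]).

    Completeness.  Re V annihilates phi, because V phi = i exp (phi / c) c^2 is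
    imaginary ([dphi_flow_field]), and |V|^2 = exp (2 phi / c) c^2 is a function
    of phi ([herm_flow_field]); so the integral curves of Re V have constant
    speed.  On a bounded interval such a curve is Lipschitz, and by completeness
    of the metric it has a limit at each end ([constant_speed_limit]).  Near
    this limit the local flow exists for a uniform time ([flows_exists]), so the
    curve extends ([extend_right]); a maximal integral curve is therefore
    defined for all times ([global_solution], [extend_solution]).

    Convergence for the Riemannian distance implies convergence in the manifold
    by [dist_nbhs], where a cutoff function bounds the length of paths from
    below.  The integral curves are produced by Picard iteration in charts
    ([ode_exists], [ode_unique]). *)

Set Implicit Arguments.
Unset Strict Implicit.
Unset Printing Implicit Defensive.
Import Order.TTheory GRing.Theory Num.Theory.
Import numFieldNormedType.Exports.
Local Open Scope classical_set_scope.
Local Open Scope ring_scope.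
Local Open Scope complex_scope.

(** * Real coordinates on C^n and derivatives on the line *)

Lemma near_all (T : topologicalType) (t : T) (P : T -> Prop) :
  (forall s, P s) -> \forall s \near t, P s.
Proof. by move=> h; exact: (@filterE _ (nbhs t)). Qed.

Lemma near_forall (T : topologicalType) (I : finType) (t : T) (P : I -> T -> Prop) :
  (forall i, \forall s \near t, P i s) -> \forall s \near t, forall i, P i s.
Proof. by move=> h; exact: (@filter_forall T I P (nbhs t)). Qed.

Lemma near_opp (R : realType) (t : R) (A : set R) :
  (\forall s \near - t, A s) -> \forall s \near t, A (- s).
Proof. by move=> h; exact: (@opp_continuous R t A h). Qed.

Section Coordinates.
Context {R : realType} {n : nat}.
Local Notation V := 'rV[R[i]]_n.
Implicit Types (v w z : V) (p q : 'I_n * bool).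

(** Real coordinates on C^n: the index (a, false) stands for x^a, the index
    (a, true) for y^a, with z^a = x^a + i y^a. *)
Definition co p v : R :=
  if p.2 then complex.Im (v 0 p.1) else complex.Re (v 0 p.1).

Definition dir p : V := coord_dir p.1 p.2.

(** A real valued norm: the sup norm of row vectors over R[i], to which it is
    equivalent, takes its values in R[i]. *)
Definition cnorm v : R := \sum_p `|co p v|.

Lemma coD p v w : co p (v + w) = co p v + co p w.
Proof.
rewrite /co mxE; case: p.2 => /=; [exact: raddfD|exact: raddfD].
Qed.

Lemma coN p v : co p (- v) = - co p v.
Proof.
rewrite /co mxE; case: p.2 => /=; case: (v 0 p.1) => a b //=.
Qed.

Lemma coB p v w : co p (v - w) = co p v - co p w.
Proof. by rewrite coD coN. Qed.

Lemma co0 p : co p 0 = 0.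
Proof. by rewrite /co mxE; case: p.2. Qed.

Lemma coZ p (t : R) v : co p (t%:C *: v) = t * co p v.
Proof.
rewrite /co mxE; case: p.2 => /=; case: (v 0 p.1) => a b /=; ring.
Qed.

Lemma co_dir p q : co p (dir q) = (p == q)%:R.
Proof.
case: p q => a b [a' b']; rewrite /co /dir /coord_dir !mxE /= -pair_eqE /=.
case: eqVneq => _; case: b; case: b' => /=;
  rewrite ?(mulr1n, mulr0n) /=; ring.
Qed.

Lemma dir_re (b : 'I_n) : dir (b, false) = delta_mx 0 b.
Proof. by rewrite /dir /coord_dir scale1r. Qed.

Lemma dir_im (b : 'I_n) : dir (b, true) = 'i%C *: delta_mx 0 b.
Proof. by []. Qed.

Lemma co_sum p (I : Type) (r : seq I) (P : pred I) (F : I -> V) :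
  co p (\sum_(i <- r | P i) F i) = \sum_(i <- r | P i) co p (F i).
Proof. by elim/big_rec2: _ => [|i y1 y2 _ <-]; rewrite ?co0 ?coD. Qed.

Lemma coP v w : (forall p, co p v = co p w) -> v = w.
Proof.
move=> h; apply/rowP => a.
have := h (a, true); have := h (a, false); rewrite /co /=.
by case: (v 0 a) => ? ?; case: (w 0 a) => ? ? /= -> ->.
Qed.

Lemma vec_dir v : v = \sum_p (co p v)%:C *: dir p.
Proof.
apply: coP => p; rewrite co_sum (bigD1 p) //= coZ co_dir eqxx mulr1 big1 ?addr0//.
by move=> q qp; rewrite coZ co_dir eq_sym (negbTE qp) mulr0.
Qed.

Lemma cnorm_ge0 v : 0 <= cnorm v.
Proof. by apply: sumr_ge0. Qed.

Lemma co_le_cnorm p v : `|co p v| <= cnorm v.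
Proof. by rewrite /cnorm (bigD1 p) //= lerDl sumr_ge0. Qed.

Lemma cnorm0 : cnorm 0 = 0.
Proof. by rewrite /cnorm big1 // => p _; rewrite co0 normr0. Qed.

Lemma cnormD v w : cnorm (v + w) <= cnorm v + cnorm w.
Proof. by rewrite /cnorm -big_split /=; apply: ler_sum => p _; rewrite coD ler_normD. Qed.

Lemma cnormN v : cnorm (- v) = cnorm v.
Proof. by apply: eq_bigr => p _; rewrite coN normrN. Qed.

Lemma cnormC v w : cnorm (v - w) = cnorm (w - v).
Proof. by rewrite -cnormN opprB. Qed.

Lemma cnormB v w z : cnorm (v - z) <= cnorm (v - w) + cnorm (w - z).
Proof. by rewrite -[v - z](subrKA w); exact: cnormD. Qed.

Lemma cnormZ (t : R) v : cnorm (t%:C *: v) = `|t| * cnorm v.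
Proof. by rewrite /cnorm mulr_sumr; apply: eq_bigr => p _; rewrite coZ normrM. Qed.

Lemma cnorm_eq0 v : cnorm v = 0 -> v = 0.
Proof.
move=> v0; apply: coP => p; rewrite co0; apply/eqP; rewrite -normr_eq0.
by rewrite eq_le normr_ge0 -v0 co_le_cnorm.
Qed.

Lemma cnorm_dir p : cnorm (dir p) = 1.
Proof.
rewrite /cnorm (bigD1 p) //= co_dir eqxx normr1 big1 ?addr0//.
by move=> q qp; rewrite co_dir (negbTE qp) normr0.
Qed.

Lemma ltc_real (e : R[i]) : 0 < e -> e = (complex.Re e)%:C /\ 0 < complex.Re e.
Proof. by case: e => x y; rewrite ltcE /= => /andP[/eqP -> ->]. Qed.

(** The two norms are comparable, up to a factor which depends only on n. *)
Lemma nbhs_cnorm z (A : set V) :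
  nbhs z A <-> exists2 r : R, 0 < r & forall w, cnorm (w - z) < r -> A w.
Proof.
split.
- move=> /nbhs_ballP [e /= e0 eA].
  have [ee re0] := ltc_real e0.
  exists (complex.Re e) => // w wz; apply: eA; split => // i a.
  rewrite (ord1 i) -ball_normE /= ee normc_def ltcR.
  apply: le_lt_trans wz; rewrite -cnormN opprB.
  have -> : z 0 a - w 0 a = (z - w) 0 a by rewrite !mxE.
  set u := z - w.
  apply: (@le_trans _ _ (`|co (a, false) u| + `|co (a, true) u|)).
    rewrite /co /=.
    rewrite -[leRHS]ger0_norm ?addr_ge0// -sqrtr_sqr ler_sqrt ?sqr_ge0//.
    rewrite sqrrD -[X in X + _ <= _]real_normK ?num_real// -[X in _ + X <= _]real_normK ?num_real//.
    by rewrite lerD2r lerDl mulrn_wge0// mulr_ge0.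
  have ne : ((a, true) != (a, false) :> 'I_n * bool) by rewrite -pair_eqE /= eqxx.
  rewrite /cnorm (bigD1 (a, false)) //= lerD2l (bigD1 (a, true)) //=.
  by rewrite lerDl sumr_ge0.
- move=> [r r0 rA]; apply/nbhs_ballP.
  pose m : R := #|{: 'I_n * bool}|%:R + 1.
  have m0 : 0 < m by rewrite ltr_wpDl.
  exists (r / m)%:C; first by rewrite /= ltcR divr_gt0.
  move=> w [_ bw]; apply: rA; rewrite cnormC.
  apply: (@le_lt_trans _ _ (\sum_(p : 'I_n * bool) r / m)).
    apply: ler_sum => p _.
    have := bw 0 p.1; rewrite -ball_normE /= => h.
    have : (`|co p (z - w)|)%:C < (r / m)%:C.
      apply: le_lt_trans h; rewrite coB /co.
      have -> : z 0 p.1 - w 0 p.1 = (z - w) 0 p.1 by rewrite !mxE.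
      set u := _ - _.
      have -> : u = if p.2 then complex.Im ((z - w) 0 p.1) else complex.Re ((z - w) 0 p.1).
        by rewrite /u !mxE; case: p.2; case: (z 0 _) => ? ?; case: (w 0 _).
      case: p.2; last exact: normc_ge_Re.
      by rewrite normc_def lecR -sqrtr_sqr ler_sqrt ?addr_ge0 ?sqr_ge0// lerDr sqr_ge0.
    by rewrite ltcR => /ltW.
  rewrite sumr_const -mulr_natr -mulrA gtr_pMr// mulrC ltr_pdivrMr// mul1r.
  by rewrite ltrDl.
Qed.

Lemma near_cnorm z (r : R) : 0 < r -> \forall w \near z, cnorm (w - z) < r.
Proof. by move=> r0; apply/nbhs_cnorm; exists r. Qed.

Lemma continuousR_cnorm (u : V -> R) z :
  {for z, continuous u} <->
  forall e : R, 0 < e -> \forall w \near z, `|u w - u z| < e.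
Proof.
split=> [h e e0|h].
  have /cvgrPdist_lt/(_ e e0) := h.
  by apply: filterS => w; rewrite distrC.
apply: (@cvgrPdist_lt _ _ _ (nbhs z) (nbhs_filter z) u (u z)).2 => e e0.
by have := h e e0; apply: filterS => w; rewrite distrC.
Qed.

Lemma co_continuous p z : {for z, continuous (co p)}.
Proof.
apply/continuousR_cnorm => e e0; apply: filterS (near_cnorm z e0) => w wz.
by rewrite -coB (le_lt_trans (co_le_cnorm _ _)).
Qed.

Lemma continuous_to_V (T : topologicalType) (f : T -> V) (t : T) :
  {for t, continuous f} <-> forall p, {for t, continuous (co p \o f)}.
Proof.
split=> [h p|h].
  by apply: continuous_comp; [exact: h|exact: co_continuous].
move=> A /nbhs_cnorm[r r0 rA].
pose m : R := #|{: 'I_n * bool}|%:R + 1.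
have m0 : 0 < m by rewrite ltr_wpDl.
have : \forall s \near t, forall p, `|co p (f s) - co p (f t)| < r / m.
  have H : forall p, \forall s \near t, `|co p (f s) - co p (f t)| < r / m.
    move=> p; have /cvgrPdist_lt/(_ (r/m)) := h p.
    by rewrite divr_gt0// => /(_ isT); apply: filterS => w; rewrite distrC.
  exact: near_forall.
apply: filterS => s hs; apply: rA.
apply: (@le_lt_trans _ _ (\sum_(p : 'I_n * bool) r / m)).
  by apply: ler_sum => p _; rewrite coB ltW.
rewrite sumr_const -mulr_natr -mulrA gtr_pMr// mulrC ltr_pdivrMr// mul1r.
by rewrite ltrDl.
Qed.

End Coordinates.

Section Derivatives.
Context {R : realType}.
Implicit Types (f g : R -> R) (t s l : R).

(** The division-free form of differentiability: it is stable under comparison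
    of functions and makes sense at the base point. *)
Lemma is_deriveP f t l :
  is_derive t 1 f l <->
  forall e : R, 0 < e -> \forall s \near t, `|f s - f t - (s - t) * l| <= e * `|s - t|.
Proof.
split.
- move=> [df dl] e e0.
  have : (fun h => h^-1 *: (f (h + t) - f t)) @ 0^' --> l.
    have -> : (fun h => h^-1 *: (f (h + t) - f t)) =
        (fun h : R => h^-1 *: ((f \o shift t) (h *: 1) - f t)).
      by apply/funext => h /=; rewrite [h *: 1]mulr1.
    by rewrite -dl; exact: df.
  move=> /cvgrPdist_le/(_ e e0) /=.
  rewrite near_withinE => H.
  have : \forall h \near 0, h != 0 -> `|l - h^-1 *: (f (h + t) - f t)| <= e := H.
  move=> /nbhs_ballP[r /= r0 hr].
  apply/nbhs_ballP; exists r => // s; rewrite /ball /= => st.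
  have [->|nst] := eqVneq s t.
    by rewrite !subrr mul0r subrr !normr0 mulr0.
  have := hr (s - t); rewrite /ball /= sub0r normrN distrC => /(_ st).
  rewrite subr_eq0 => /(_ nst); rewrite subrK => h.
  have d0 : s - t != 0 by rewrite subr_eq0.
  have -> : f s - f t - (s - t) * l = - ((l - (s-t)^-1 *: (f s - f t)) * (s - t)).
    have -> : (s - t)^-1 *: (f s - f t) = (s - t)^-1 * (f s - f t) by [].
    by field.
  by rewrite normrN normrM [`|t - s|]distrC ler_wpM2r.
- move=> H.
  have H1 : (fun h => h^-1 *: ((f \o shift t) (h *: 1) - f t)) @ 0^' --> l.
    apply/cvgrPdist_le => e e0; rewrite near_withinE.
    have /nbhs_ballP[r /= r0 hr] := H e e0.
    apply/nbhs_ballP; exists r => // h; rewrite /ball /= sub0r normrN => hh h0.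
    have := hr (h + t); rewrite /ball /= [h *: 1]mulr1.
    rewrite opprD addrCA subrr addr0 normrN => /(_ hh).
    rewrite addrK => h1.
    rewrite -(@ler_pM2r _ `|h|) ?normr_gt0// -normrM.
    have -> : (l - h^-1 *: (f (h + t) - f t)) * h = - (f (h + t) - f t - h * l).
      have -> : h^-1 *: (f (h + t) - f t) = h^-1 * (f (h + t) - f t) by [].
      by field.
    by rewrite normrN.
  split; first by rewrite /derivable; apply/cvg_ex; exists l.
  exact: cvg_lim.
Qed.

Lemma is_derive_derive1 f t l : is_derive t 1 f l -> derive1 f t = l.
Proof. by move=> [_ <-]; rewrite derive1E. Qed.

Lemma derivable_is_derive f t : derivable f t 1 -> is_derive t 1 f (derive1 f t).
Proof. by move=> h; split => //; rewrite derive1E. Qed.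

Lemma is_derive_near f g t l : (\forall s \near t, f s = g s) ->
  is_derive t 1 f l -> is_derive t 1 g l.
Proof.
move=> fg /is_deriveP h; apply/is_deriveP => e /h he.
have fgt := nbhs_singleton fg.
by apply: filterS2 fg he => s <-; rewrite -fgt.
Qed.

Lemma is_derive_continuous f t l : is_derive t 1 f l -> {for t, continuous f}.
Proof. by move=> [df _]; apply: differentiable_continuous; apply/derivable1_diffP. Qed.

Lemma is_derive_comp_affine f (a b t l : R) : is_derive (a * t + b) 1 f l ->
  is_derive t 1 (fun s => f (a * s + b)) (a * l).
Proof.
move=> h.
have h1 : is_derive t 1 (fun s => a * s + b) a.
  apply/is_deriveP => e e0; apply: near_all => s.
  have -> : a * s + b - (a * t + b) - (s - t) * a = 0 by ring.
  by rewrite normr0 mulr_ge0// ltW.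
by have := @is_derive1_comp _ f (fun s => a * s + b) t l a h h1; rewrite mulrC.
Qed.

Lemma mean_value f (df : R -> R) (a b : R) : a < b ->
  (forall s, a <= s <= b -> is_derive s 1 f (df s)) ->
  exists2 c, a < c < b & f b - f a = df c * (b - a).
Proof.
move=> ab h; have [c|/=|c cab ->] := @MVT R f df a b ab.
- by rewrite in_itv /= => /andP[ac cb]; apply: h; rewrite !ltW.
- apply: derivable_within_continuous => c; rewrite in_itv /= => cab.
  by have [] := h c cab.
by exists c.
Qed.

(** The endpoints come in any order, as the segments used below are traversed
    in both directions. *)
Lemma mean_value_abs f (df : R -> R) (a b : R) :
  (forall s, Num.min a b <= s <= Num.max a b -> is_derive s 1 f (df s)) ->
  exists2 c, Num.min a b <= c <= Num.max a b & f b - f a = df c * (b - a).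
Proof.
have [ab|ba|->] := ltgtP a b => h.
- have [c /andP[ac cb] e] := mean_value ab h.
  by exists c => //; rewrite !ltW.
- have [c /andP[ac cb] e] := mean_value ba h.
  exists c; first by rewrite !ltW.
  by rewrite -(opprB (f a)) e -mulrN opprB.
- by exists b; rewrite ?lexx // !subrr mulr0.
Qed.

Lemma is_derive_bound f (df : R -> R) (a b K : R) :
  (forall s, Num.min a b <= s <= Num.max a b -> is_derive s 1 f (df s)) ->
  (forall s, Num.min a b <= s <= Num.max a b -> `|df s| <= K) ->
  `|f b - f a| <= K * `|b - a|.
Proof.
move=> h hK; have [c cab ->] := mean_value_abs h.
by rewrite normrM ler_wpM2r// hK.
Qed.

End Derivatives.

(** * Partial derivatives and the classes C^k *)

Section RealCalculus.
Context {R : realType} {n : nat}.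
Local Notation V := 'rV[R[i]]_n.
Implicit Types (v w z : V) (p q : 'I_n * bool) (u f g : V -> R) (U : set V).

Definition pd p u : V -> R := rpartial p.1 p.2 u.

Definition is_pd p u z (l : R) := is_derive (0 : R) 1 (real_slice u z (dir p)) l.

Lemma is_pd_eq p u z l : is_pd p u z l -> pd p u z = l.
Proof. exact: is_derive_derive1. Qed.

Definition vderive (c : R -> V) (t : R) v :=
  forall p, is_derive t 1 (co p \o c) (co p v).

Lemma vderive_line z v (t : R) : vderive (fun s : R => z + s%:C *: v) t v.
Proof.
move=> q; apply/is_deriveP => e e0; apply: near_all => s /=.
rewrite !coD !coZ.
have -> : co q z + s * co q v - (co q z + t * co q v) - (s - t) * co q v = 0 by ring.
by rewrite normr0 mulr_ge0// ltW.
Qed.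

Lemma vderive_continuous (c : R -> V) t v : vderive c t v -> {for t, continuous c}.
Proof.
by move=> dc; apply/continuous_to_V => p; exact: is_derive_continuous (dc p).
Qed.

Lemma near_slice U z v : open U -> U z -> \forall t \near (0 : R), U (z + t%:C *: v).
Proof.
move=> oU Uz; have /= := vderive_continuous (vderive_line z v 0).
rewrite /continuous_at => /(_ U); apply.
by rewrite scale0r addr0; exact: open_nbhs_nbhs.
Qed.

Lemma is_pd_near p f g U z l : open U -> U z -> (forall w, U w -> f w = g w) ->
  is_pd p f z l -> is_pd p g z l.
Proof.
move=> oU Uz fg; apply: is_derive_near.
by apply: filterS (near_slice (dir p) oU Uz) => t /fg.
Qed.

Lemma is_pd_slice p u z (t l : R) : is_pd p u (z + t%:C *: dir p) l ->
  is_derive t 1 (fun s : R => u (z + s%:C *: dir p)) l.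
Proof.
rewrite /is_pd => h.
have : is_derive (1 * t - t) 1 (real_slice u (z + t%:C *: dir p) (dir p)) l.
  by rewrite mul1r subrr.
move=> /is_derive_comp_affine; rewrite mul1r.
apply: is_derive_near; apply: near_all => s; rewrite /real_slice mul1r.
by rewrite -addrA -scalerDl -rmorphD /= [t + _]addrC subrK.
Qed.

(** Real differentiability at z, with the differential given by its
    coefficients D in the coordinates x^a, y^a. *)
Definition frechet u z (D : 'I_n * bool -> R) :=
  forall e : R, 0 < e -> \forall w \near z,
  `|u w - u z - \sum_p D p * co p (w - z)| <= e * cnorm (w - z).

(** The error of the first order expansion of u is small with respect to c s -
    c t, which is itself O(s - t). *)
Lemma frechet_chain u (c : R -> V) (t : R) v E : frechet u (c t) E ->
  vderive c t v -> is_derive t 1 (u \o c) (\sum_p E p * co p v).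
Proof.
move=> fu dc; apply/is_deriveP => e e0.
pose m : R := #|{: 'I_n * bool}|%:R.
have m0 : 0 <= m by [].
pose D := \sum_p `|E p|.
have D0 : 0 <= D by apply: sumr_ge0.
(* [cnorm v + m + 1] bounds the difference quotients of c, and [D] controls the
   error of the expansion of c once multiplied by the differential of u. *)
pose e2 := e / 2 / (cnorm v + m + 1).
have K0 : 0 < cnorm v + m + 1 by rewrite ltr_wpDl// addr_ge0// cnorm_ge0.
have e20 : 0 < e2 by rewrite !divr_gt0.
pose e1 := Num.min 1 (e / 2 / (D + 1)).
have e10 : 0 < e1 by rewrite lt_min ltr01 /= !divr_gt0// ltr_wpDl.
have cc : {for t, continuous c}.
  by apply/continuous_to_V => p; apply: is_derive_continuous (dc p).
have H1 : \forall s \near t, `|u (c s) - u (c t) - \sum_p E p * co p (c s - c t)|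
    <= e2 * cnorm (c s - c t) by exact: cc (fu e2 e20).
have H2 : \forall s \near t, forall p,
    `|co p (c s) - co p (c t) - (s - t) * co p v| <= e1 * `|s - t|.
  have H : forall p, \forall s \near t,
    `|co p (c s) - co p (c t) - (s - t) * co p v| <= e1 * `|s - t|.
    by move=> p; have /is_deriveP/(_ e1 e10) := dc p.
  exact: near_forall.
apply: filterS2 H1 H2 => s h1 h2 /=.
have hN : cnorm (c s - c t) <= (cnorm v + m + 1) * `|s - t|.
  apply: (@le_trans _ _ (\sum_p (`|co p v| + e1) * `|s - t|)).
    apply: ler_sum => p _; rewrite coB.
    rewrite -[X in `|X|](subrK ((s - t) * co p v)) (le_trans (ler_normD _ _))//.
    by rewrite [in leRHS]mulrDl [leRHS]addrC lerD ?h2// normrM mulrC.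
  rewrite -mulr_suml ler_wpM2r// big_split /= -addrA lerD2l sumr_const -mulr_natl.
  rewrite -/m (@le_trans _ _ m) ?lerDl//.
  by rewrite ler_piMr// ge_min lexx.
have -> : u (c s) - u (c t) - (s - t) * (\sum_p E p * co p v)
  = (u (c s) - u (c t) - \sum_p E p * co p (c s - c t))
  + \sum_p E p * (co p (c s) - co p (c t) - (s - t) * co p v).
  have -> : \sum_p E p * (co p (c s) - co p (c t) - (s - t) * co p v) =
      \sum_p E p * co p (c s - c t) -
      (s - t) * \sum_p E p * co p v.
    rewrite mulr_sumr -sumrB; apply: eq_bigr => p _; rewrite coB; ring.
  by rewrite addrA subrK.
apply: (le_trans (ler_normD _ _)).
have -> : e = e2 * (cnorm v + m + 1) + e / 2.
  by rewrite /e2 divfK ?gt_eqF// -splitr.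
rewrite mulrDl lerD//.
  by apply: (le_trans h1); rewrite -mulrA ler_wpM2l// ltW.
apply: (le_trans (ler_norm_sum _ _ _)).
apply: (@le_trans _ _ (\sum_p `|E p| * (e1 * `|s - t|))).
  by apply: ler_sum => p _; rewrite normrM ler_wpM2l.
rewrite -mulr_suml mulrA ler_wpM2r// -/D.
apply: (@le_trans _ _ (D * (e / 2 / (D + 1)))).
  by rewrite ler_wpM2l// ge_min lexx orbT.
rewrite mulrCA ler_piMr ?divr_ge0 ?(ltW e0)//.
by rewrite ler_pdivrMr ?ltr_wpDl// mul1r lerDl.
Qed.

Lemma Ck_cont k U u z : Ck k U u -> U z -> {for z, continuous u}.
Proof. by case: k => [|k] [h _]; exact: h. Qed.

Lemma Ck_is_pd k U u z p : Ck k.+1 U u -> U z -> is_pd p u z (pd p u z).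
Proof.
move=> [_ /(_ p.1 p.2) [h _]] Uz; apply: derivable_is_derive.
exact: h.
Qed.

Lemma Ck_pd k U u p : Ck k.+1 U u -> Ck k U (pd p u).
Proof. by move=> [_ /(_ p.1 p.2) []]. Qed.

Lemma CkS k U u : Ck k.+1 U u -> Ck k U u.
Proof.
elim: k u => [|k IH] u h.
  by case: h.
case: (h) => hc hd; split => // a b; have [d c] := hd a b; split => //.
exact: IH.
Qed.

Lemma continuous_on_open U f g z : open U -> U z -> (forall w, U w -> f w = g w) ->
  {for z, continuous f} -> {for z, continuous g}.
Proof.
move=> oU Uz fg /continuousR_cnorm h; apply/continuousR_cnorm => e /h he.
apply: filterS2 (open_nbhs_nbhs (conj oU Uz)) he => w Uw.
by rewrite !fg.
Qed.

Lemma Ck_ext k U f g : open U -> (forall z, U z -> f z = g z) ->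
  Ck k U f -> Ck k U g.
Proof.
move=> oU; elim: k f g => [|k IH] f g fg h.
  by split => // z Uz; apply: (continuous_on_open oU Uz fg); exact: Ck_cont h Uz.
have H p z : U z -> is_pd p g z (pd p f z).
  by move=> Uz; apply: is_pd_near fg (Ck_is_pd p h Uz).
split.
  by move=> z Uz; apply: (continuous_on_open oU Uz fg); exact: Ck_cont h Uz.
move=> a b; split.
  by move=> z Uz; have [] := H (a, b) z Uz.
apply: (IH (pd (a, b) f)); last exact: Ck_pd.
by move=> z Uz; rewrite -[RHS]/(pd (a, b) g z) (is_pd_eq (H _ _ Uz)).
Qed.

(** All closure properties of the classes C^k follow by induction on k from
    this form: it suffices to exhibit the partial derivatives on U, without
    computing [rpartial]. *)
Lemma Ck_intro k U u (D : 'I_n * bool -> V -> R) : open U ->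
  (forall z, U z -> {for z, continuous u}) ->
  (forall p z, U z -> is_pd p u z (D p z)) ->
  (forall p, Ck k U (D p)) -> Ck k.+1 U u.
Proof.
move=> oU uc uD DC; split => // a b; split.
  by move=> z Uz; have [] := uD (a, b) z Uz.
apply: (Ck_ext oU _ (DC (a, b))) => z Uz.
by rewrite -(is_pd_eq (uD (a, b) z Uz)).
Qed.

Lemma is_pd_cst p (a : R) z : is_pd p (fun=> a) z 0.
Proof.
apply/is_deriveP => e e0; apply: near_all => s.
by rewrite /real_slice subrr mulr0 subrr normr0 mulr_ge0// ltW.
Qed.

Lemma is_pdD p f g z l m : is_pd p f z l -> is_pd p g z m ->
  is_pd p (fun w => f w + g w) z (l + m).
Proof. by move=> hf hg; exact: (is_deriveD hf hg). Qed.

Lemma is_pdM p f g z l m : is_pd p f z l -> is_pd p g z m ->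
  is_pd p (fun w => f w * g w) z (l * g z + f z * m).
Proof.
move=> hf hg; apply: (is_derive_eq (is_deriveM hf hg)).
by rewrite /real_slice scale0r addr0 /GRing.scale /=; ring.
Qed.

Lemma is_pd_comp p f (h : R -> R) z l m : is_pd p f z l ->
  is_derive (f z) 1 h m -> is_pd p (h \o f) z (m * l).
Proof.
move=> hf hh.
have hh' : is_derive (real_slice f z (dir p) 0) 1 h m.
  by rewrite /real_slice scale0r addr0.
exact: (is_derive1_comp hh' hf).
Qed.

Lemma is_pdV p f z l : f z != 0 -> is_pd p f z l ->
  is_pd p (fun w => (f w)^-1) z (- ((f z)^-1 * (f z)^-1) * l).
Proof.
move=> fz [df dl].
have fz' : real_slice f z (dir p) 0 != 0 by rewrite /real_slice scale0r addr0.
split; first exact: derivableV.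
have := deriveV fz' df; rewrite dl => ->.
by rewrite /real_slice scale0r addr0 /GRing.scale /= expr2 invfM.
Qed.

Lemma Ck_cst k U (a : R) : open U -> Ck k U (fun=> a).
Proof.
move=> oU; have cc (a' : R) z : {for z, continuous (fun _ : V => a')}.
  by apply/continuousR_cnorm => e e0; apply: near_all => w; rewrite subrr normr0.
elim: k a => [|k IH] a; first by split=> // z _; exact: cc.
apply: (@Ck_intro _ _ _ (fun _ _ => 0)) => //.
by move=> p z Uz; exact: is_pd_cst.
Qed.

Lemma CkD k U f g : open U -> Ck k U f -> Ck k U g ->
  Ck k U (fun z => f z + g z).
Proof.
move=> oU; elim: k f g => [|k IH] f g hf hg.
  by split => // z Uz; apply: (cvgD (Ck_cont hf Uz) (Ck_cont hg Uz)).
apply: (@Ck_intro _ _ _ (fun p z => pd p f z + pd p g z)) => //.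
- by move=> z Uz; apply: (cvgD (Ck_cont hf Uz) (Ck_cont hg Uz)).
- by move=> p z Uz; exact: is_pdD (Ck_is_pd p hf Uz) (Ck_is_pd p hg Uz).
- by move=> p; apply: IH; exact: Ck_pd.
Qed.

Lemma CkM k U f g : open U -> Ck k U f -> Ck k U g ->
  Ck k U (fun z => f z * g z).
Proof.
move=> oU; elim: k f g => [|k IH] f g hf hg.
  by split => // z Uz; apply: (cvgM (Ck_cont hf Uz) (Ck_cont hg Uz)).
apply: (@Ck_intro _ _ _ (fun p z => pd p f z * g z + f z * pd p g z)) => //.
- by move=> z Uz; apply: (cvgM (Ck_cont hf Uz) (Ck_cont hg Uz)).
- by move=> p z Uz; exact: is_pdM (Ck_is_pd p hf Uz) (Ck_is_pd p hg Uz).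
- by move=> p; apply: CkD => //; apply: IH => //; (exact: Ck_pd || exact: CkS).
Qed.

Lemma CkN k U f : open U -> Ck k U f -> Ck k U (fun z => - f z).
Proof.
move=> oU hf; apply: (Ck_ext oU _ (CkM oU (Ck_cst k (-1) oU) hf)) => z _.
by rewrite mulN1r.
Qed.

Lemma CkV k U f : open U -> (forall z, U z -> f z != 0) -> Ck k U f ->
  Ck k U (fun z => (f z)^-1).
Proof.
move=> oU f0; elim: k f f0 => [|k IH] f f0 hf.
  by split => // z Uz; apply: (cvgV (f0 z Uz) (Ck_cont hf Uz)).
apply: (@Ck_intro _ _ _ (fun p z => - ((f z)^-1 * (f z)^-1) * pd p f z)) => //.
- by move=> z Uz; apply: (cvgV (f0 z Uz) (Ck_cont hf Uz)).
- by move=> p z Uz; apply: is_pdV; [exact: f0|exact: Ck_is_pd hf Uz].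
- move=> p; apply: CkM => //; last exact: Ck_pd.
  have hi : Ck k U (fun z => (f z)^-1) by apply: IH => //; exact: CkS.
  by apply: CkN => //; exact: CkM.
Qed.

Lemma Ck_exp k U f : open U -> Ck k U f -> Ck k U (fun z => expR (f z)).
Proof.
move=> oU; elim: k f => [|k IH] f hf.
  split => // z Uz; apply: continuous_comp; first exact: Ck_cont hf Uz.
  exact: continuous_expR.
apply: (@Ck_intro _ _ _ (fun p z => expR (f z) * pd p f z)) => //.
- move=> z Uz; apply: continuous_comp; first exact: Ck_cont hf Uz.
  exact: continuous_expR.
- move=> p z Uz; apply: (is_pd_comp (h := expR)); first exact: Ck_is_pd hf Uz.
- move=> p; apply: CkM => //; last exact: Ck_pd.
  by apply: IH; exact: CkS.
Qed.

End RealCalculus.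

(** * Differentiability of C^1 functions and symmetry of second derivatives *)

(* Comparing two applications of these operators up to conversion unfolds limits
   on both sides; they are made opaque once their characterizations are known. *)
#[local] Opaque dir.

Section SecondOrder.
Context {R : realType} {n : nat}.
Local Notation V := 'rV[R[i]]_n.
Implicit Types (v w z : V) (p q : 'I_n * bool) (u f g : V -> R) (U : set V).

Lemma addABK (Z : zmodType) (z v w : Z) : z + v + w - z = v + w.
Proof. by rewrite addrC !addrA addNr add0r. Qed.

(** Move from z to w along one coordinate axis at a time; on each of the
    segments the mean value theorem and the continuity of the partial
    derivatives bound the error. *)
Lemma Ck1_frechet U u z : open U -> Ck 1 U u -> U z ->
  frechet u z (fun p => pd p u z).
Proof.
move=> oU hu Uz e e0.
have H1 : \forall w \near z, forall p, `|pd p u w - pd p u z| < e.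
  apply: near_forall => p.
  exact: (continuousR_cnorm (pd p u) z).1 (Ck_cont (Ck_pd p hu) Uz) e e0.
have /nbhs_cnorm[r r0 hr] : \forall w \near z, U w /\ forall p, `|pd p u w - pd p u z| < e.
  by apply: filterS2 (open_nbhs_nbhs (conj oU Uz)) H1 => w.
apply/nbhs_cnorm; exists r => // w wz; set h := w - z.
(* [hs s]: the part of h along the axes of s *)
pose hs (s : seq ('I_n * bool)) := \sum_(p <- s) (co p h)%:C *: dir p.
have hsN s : cnorm (hs s) <= \sum_(p <- s) `|co p h|.
  rewrite /hs; elim: s => [|p s IH]; first by rewrite !big_nil cnorm0.
  rewrite !big_cons (le_trans (cnormD _ _))// lerD// cnormZ cnorm_dir.
  by rewrite mulr1.
have key s : \sum_(p <- s) `|co p h| < r ->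
    `|u (z + hs s) - u z - \sum_(p <- s) pd p u z * co p h|
    <= e * \sum_(p <- s) `|co p h|.
  elim: s => [|p s IH]; first by rewrite /hs !big_nil !addr0 !subrr normr0 mulr0.
  rewrite !big_cons => hlt.
  have hlt' : \sum_(p <- s) `|co p h| < r by apply: le_lt_trans hlt; rewrite lerDr.
  pose t := co p h.
  pose g (x : R) := u (z + hs s + x%:C *: dir p).
  have bd x : Num.min 0 t <= x <= Num.max 0 t ->
      cnorm (z + hs s + x%:C *: dir p - z) < r.
    move=> hx; rewrite addABK (le_lt_trans (cnormD _ _))//.
    rewrite cnormZ cnorm_dir mulr1 addrC; apply: le_lt_trans hlt; apply: lerD => //.
    rewrite -/t; have [t0|t0] := leP 0 t; move: hx.
      by rewrite min_l// max_r// => /andP[? ?]; rewrite !ger0_norm.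
    rewrite min_r ?max_l ?(ltW t0)// => /andP[tx x0].
    by rewrite (ler0_norm x0) (ler0_norm (ltW t0)) lerN2.
  have dg x : Num.min 0 t <= x <= Num.max 0 t ->
      is_derive x 1 g (pd p u (z + hs s + x%:C *: dir p)).
    move=> hx; apply: is_pd_slice; apply: (Ck_is_pd p hu).
    by have [] := hr _ (bd x hx).
  have [x hx gx] := mean_value_abs dg.
  have := hr _ (bd x hx) => -[_ /(_ p) hpx].
  have -> : z + hs (p :: s) = z + hs s + t%:C *: dir p.
    by rewrite /hs big_cons addrA addrAC.
  rewrite -/(g t).
  have -> : g t - u z - (pd p u z * co p h + \sum_(j <- s) pd j u z * co j h) =
      (g t - g 0 - pd p u z * t) +
      (u (z + hs s) - u z - \sum_(j <- s) pd j u z * co j h).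
    rewrite /g scale0r addr0 -/t; ring.
  rewrite (le_trans (ler_normD _ _))// mulrDr lerD ?IH//.
  rewrite gx subr0 -mulrBl normrM ler_wpM2r// ltW//.
have hw : z + hs (index_enum _) = w.
  by rewrite /hs -vec_dir /h addrC subrK.
by have := key (index_enum _); rewrite hw; apply.
Qed.

(** The second difference of F on a square of side h, computed by applying the
    mean value theorem in one variable after the other. *)
Lemma second_difference (F P Q : R -> R -> R) (h : R) : 0 < h ->
  (forall s t, 0 <= s <= h -> 0 <= t <= h -> is_derive s 1 (F^~ t) (P s t)) ->
  (forall s t, 0 <= s <= h -> 0 <= t <= h -> is_derive t 1 (P s) (Q s t)) ->
  exists s t, [/\ 0 <= s <= h, 0 <= t <= h &
    F h h - F h 0 - F 0 h + F 0 0 = h ^+ 2 * Q s t].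
Proof.
move=> h0 dF dP.
have h00 : 0 <= h <= h by rewrite lexx ltW.
have hh0 : (0 : R) <= 0 <= h by rewrite lexx ltW.
have dD s : 0 <= s <= h -> is_derive s 1 (fun x => F x h - F x 0) (P s h - P s 0).
  by move=> sh; apply: is_deriveB; exact: dF.
have [s /andP[s0 sh] Fs] := mean_value h0 dD.
have sh' : 0 <= s <= h by rewrite !ltW.
have [t /andP[t0 th] Pt] := mean_value h0 (fun t => dP s t sh').
exists s, t; split; rewrite ?ltW//.
have -> : F h h - F h 0 - F 0 h + F 0 0 = F h h - F h 0 - (F 0 h - F 0 0) by ring.
by rewrite Fs Pt; ring.
Qed.

(** Both mixed derivatives are limits of the same second difference quotient.
    *)
Lemma schwarz U u z p q : open U -> Ck 2 U u -> U z ->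
  pd p (pd q u) z = pd q (pd p u) z.
Proof.
move=> oU hu Uz; apply/eqP; rewrite -subr_eq0 -normr_eq0 eq_le normr_ge0 andbT.
apply/ler_addgt0Pr => e e0; rewrite add0r.
have e20 : 0 < e / 2 by rewrite divr_gt0.
have cA := (continuousR_cnorm _ _).1 (Ck_cont (Ck_pd p (Ck_pd q hu)) Uz) _ e20.
have cB := (continuousR_cnorm _ _).1 (Ck_cont (Ck_pd q (Ck_pd p hu)) Uz) _ e20.
have /nbhs_cnorm[r r0 hr] : \forall w \near z,
    U w /\ `|pd p (pd q u) w - pd p (pd q u) z| < e / 2 /\
    `|pd q (pd p u) w - pd q (pd p u) z| < e / 2.
  by apply: filterS3 (open_nbhs_nbhs (conj oU Uz)) cA cB => w.
(* the square of side h at z lies in the ball of radius r, as 2 h < r *)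
pose h := r / 3.
have h0 : 0 < h by rewrite divr_gt0.
have [pt ptE] : exists pt : R -> R -> V,
    forall s t, pt s t = z + s%:C *: dir p + t%:C *: dir q by eexists.
have ptE' s t : pt s t = z + t%:C *: dir q + s%:C *: dir p.
  by rewrite ptE; exact: addrAC.
have bd s t : 0 <= s <= h -> 0 <= t <= h -> cnorm (pt s t - z) < r.
  move=> /andP[s0 sh] /andP[t0 th].
  rewrite ptE addABK (le_lt_trans (cnormD _ _))// !cnormZ !cnorm_dir.
  rewrite !mulr1 !ger0_norm// (le_lt_trans (lerD sh th))//.
  by rewrite /h; lra.
have hU s t (hs : 0 <= s <= h) (ht : 0 <= t <= h) := (hr _ (bd s t hs ht)).1.
have dp f s t : is_pd p f (pt s t) (pd p f (pt s t)) ->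
    is_derive s 1 (fun x => f (pt x t)) (pd p f (pt s t)).
  rewrite ptE' => /is_pd_slice; apply: is_derive_near; apply: near_all => x.
  by rewrite ptE'.
have dq f s t : is_pd q f (pt s t) (pd q f (pt s t)) ->
    is_derive t 1 (fun y => f (pt s y)) (pd q f (pt s t)).
  rewrite ptE => /is_pd_slice; apply: is_derive_near; apply: near_all => x.
  by rewrite ptE.
have [s [t [hs ht e1]]] := @second_difference (fun s t => u (pt s t))
  (fun s t => pd p u (pt s t)) (fun s t => pd q (pd p u) (pt s t)) h h0
  (fun s t hs ht => dp _ _ _ (Ck_is_pd p hu (hU s t hs ht)))
  (fun s t hs ht => dq _ _ _ (Ck_is_pd q (Ck_pd p hu) (hU s t hs ht))).
have [t' [s' [ht' hs' e2]]] := @second_difference (fun t s => u (pt s t))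
  (fun t s => pd q u (pt s t)) (fun t s => pd p (pd q u) (pt s t)) h h0
  (fun t s ht hs => dq _ _ _ (Ck_is_pd q hu (hU s t hs ht)))
  (fun t s ht hs => dp _ _ _ (Ck_is_pd p (Ck_pd q hu) (hU s t hs ht))).
have [_ [_ hB]] := hr _ (bd s t hs ht).
have [_ [hA _]] := hr _ (bd s' t' hs' ht').
have E : pd q (pd p u) (pt s t) = pd p (pd q u) (pt s' t').
  have h2 : h ^+ 2 != 0 by rewrite expf_neq0 ?gt_eqF.
  have aux (k x y a b c d : R) : k != 0 ->
      a - b - c + d = k * x -> a - c - b + d = k * y -> x = y.
    by move=> k0 e1' e2'; apply: (mulfI k0); rewrite -e1' -e2'; ring.
  exact: aux h2 e1 e2.
move: hA hB; rewrite -E.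
move: (pd q (pd p u) (pt s t)) (pd p (pd q u) z) (pd q (pd p u) z) => X Y Z hA hB.
have -> : Y - Z = - (X - Y) + (X - Z) by ring.
apply: le_trans (ler_normD _ _) _; rewrite normrN [leRHS]splitr.
exact: lerD (ltW hA) (ltW hB).
Qed.

End SecondOrder.

(** * Wirtinger calculus *)

Section WirtingerAlgebra.
Variable (F : comNzRingType).
Implicit Types c e x y f g k : F.

(** The common shape of both Wirtinger operators: c = 1/2, e = i or -i,
    applied to the two real partial derivatives x and y. The identities that
    follow are pure ring algebra. *)
Definition wirt c e x y : F := c * (x + e * y).

Lemma wirtD c e x y x' y' : wirt c e (x + x') (y + y') = wirt c e x y + wirt c e x' y'.
Proof. by rewrite /wirt; ring. Qed.

Lemma wirtM c e x y x' y' f g : wirt c e (x * g + f * x') (y * g + f * y') =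
  wirt c e x y * g + f * wirt c e x' y'.
Proof. by rewrite /wirt; ring. Qed.

Lemma wirtZ c e x y k : wirt c e (k * x) (k * y) = k * wirt c e x y.
Proof. by rewrite /wirt; ring. Qed.

Lemma wirt_der0 c e x y x' y' f :
  0 * (x + e * y) + c * (x' + (0 * f + e * y')) = wirt c e x' y'.
Proof. by rewrite /wirt; ring. Qed.

Lemma wirt_comm c e e' x y z t : wirt c e (wirt c e' x y) (wirt c e' z t) =
  wirt c e' (wirt c e x z) (wirt c e y t).
Proof. by rewrite /wirt; ring. Qed.

Lemma wirt_conj (conj : {rmorphism F -> F}) c e e' x y :
  conj c = c -> conj e' = e -> wirt c e (conj x) (conj y) = conj (wirt c e' x y).
Proof. by move=> cc ce; rewrite /wirt rmorphM rmorphD rmorphM cc ce. Qed.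

End WirtingerAlgebra.

Section Wirtinger.
Context {R : realType} {n : nat}.
Local Notation V := 'rV[R[i]]_n.
Local Notation C := R[i].
Implicit Types (z w : V) (p : 'I_n * bool) (u : V -> R) (f g : V -> C).

Definition re f : V -> R := fun z => complex.Re (f z).
Definition im f : V -> R := fun z => complex.Im (f z).

Definition is_cpd p f z (l : C) :=
  is_pd p (re f) z (complex.Re l) /\ is_pd p (im f) z (complex.Im l).

Definition cpd p f z : C := cpartial p.1 p.2 f z.

Lemma cpdE p f z : cpd p f z = pd p (re f) z +i* pd p (im f) z.
Proof. by []. Qed.

Lemma is_cpd_eq p f z l : is_cpd p f z l -> cpd p f z = l.
Proof.
move=> [h1 h2]; rewrite /cpd /cpartial.
have -> : rpartial p.1 p.2 (fun w => complex.Re (f w)) z = complex.Re l by exact: is_pd_eq h1.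
have -> : rpartial p.1 p.2 (fun w => complex.Im (f w)) z = complex.Im l by exact: is_pd_eq h2.
by case: l {h1 h2}.
Qed.

Lemma is_cpdD p f g z l m : is_cpd p f z l -> is_cpd p g z m ->
  is_cpd p (fun w => f w + g w) z (l + m).
Proof.
move=> [f1 f2] [g1 g2]; split.
- have -> : re (fun w => f w + g w) = (fun w => re f w + re g w).
    by apply/funext => w; rewrite /re raddfD.
  by rewrite raddfD; exact: is_pdD.
- have -> : im (fun w => f w + g w) = (fun w => im f w + im g w).
    by apply/funext => w; rewrite /im raddfD.
  by rewrite raddfD; exact: is_pdD.
Qed.

Lemma is_cpd_cst p (a : C) z : is_cpd p (fun=> a) z 0.
Proof. by split; exact: is_pd_cst. Qed.

Lemma ReD (x y : C) : complex.Re (x + y) = complex.Re x + complex.Re y.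
Proof. by case: x y => ? ? []. Qed.

Lemma ImD (x y : C) : complex.Im (x + y) = complex.Im x + complex.Im y.
Proof. by case: x y => ? ? []. Qed.

Lemma ReM (x y : C) : complex.Re (x * y) =
  complex.Re x * complex.Re y - complex.Im x * complex.Im y.
Proof. by case: x y => ? ? []. Qed.

Lemma ImM (x y : C) : complex.Im (x * y) =
  complex.Re x * complex.Im y + complex.Im x * complex.Re y.
Proof. by case: x y => ? ? []. Qed.

Lemma is_pdB p (u v : V -> R) z l m : is_pd p u z l -> is_pd p v z m ->
  is_pd p (fun w => u w - v w) z (l - m).
Proof. by move=> hf hg; exact: (is_deriveB hf hg). Qed.

Lemma is_cpdM p f g z l m : is_cpd p f z l -> is_cpd p g z m ->
  is_cpd p (fun w => f w * g w) z (l * g z + f z * m).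
Proof.
move=> [f1 f2] [g1 g2]; split.
- have -> : re (fun w => f w * g w) = (fun w => re f w * re g w - im f w * im g w).
    by apply/funext => w; rewrite /re ReM.
  have := is_pdB (is_pdM f1 g1) (is_pdM f2 g2).
  by congr is_pd; rewrite /re /im ReD !ReM; ring.
- have -> : im (fun w => f w * g w) = (fun w => re f w * im g w + im f w * re g w).
    by apply/funext => w; rewrite /im ImM.
  have := is_pdD (is_pdM f1 g2) (is_pdM f2 g1).
  by congr is_pd; rewrite /re /im ImD !ImM; ring.
Qed.

Lemma is_cpd_conj p f z l : is_cpd p f z l ->
  is_cpd p (fun w => (f w)^*) z l^*.
Proof.
move=> [f1 f2]; split.
- have -> : re (fun w => (f w)^*) = re f.
    by apply/funext => w; rewrite /re; case: (f w).
  by case: l f1 {f2}.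
- have -> : im (fun w => (f w)^*) = (fun w => - im f w).
    by apply/funext => w; rewrite /im; case: (f w).
  have -> : complex.Im l^* = - complex.Im l by case: l {f1 f2}.
  exact: (is_deriveN f2).
Qed.

Lemma is_cpd_real p u z l : is_pd p u z l -> is_cpd p (fun w => (u w)%:C) z l%:C.
Proof. by move=> h; split => //=; exact: is_pd_cst. Qed.

(** The two families of Wirtinger operators are handled together: [wd false]
    is d/dz and [wd true] is d/d(conj z). *)
Definition wdc (s : bool) (D : 'I_n * bool -> C) (a : 'I_n) : C :=
  2^-1 * (D (a, false) + (if s then 'i%C else - 'i%C) * D (a, true)).

Definition wd s a f : V -> C := fun z => wdc s (fun p => cpd p f z) a.

Lemma wdE s a f z : wd s a f z = wdc s (fun p => cpd p f z) a.
Proof. by []. Qed.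

Lemma dzE a f : dz a f = wd false a f.
Proof. by apply/funext => z; rewrite /dz /wd /wdc mulNr. Qed.

Lemma is_wd s a f z D : (forall p, is_cpd p f z (D p)) -> wd s a f z = wdc s D a.
Proof. by move=> h; rewrite /wd /wdc !(is_cpd_eq (h _)). Qed.

Variables (U : set V) (oU : open U).

Lemma smooth_cst (a : R) : smooth_on U (fun=> a).
Proof. by move=> k; exact: Ck_cst. Qed.

Lemma smoothD (u v : V -> R) : smooth_on U u -> smooth_on U v ->
  smooth_on U (fun w => u w + v w).
Proof. by move=> hu hv k; exact: CkD. Qed.

Lemma smoothM (u v : V -> R) : smooth_on U u -> smooth_on U v ->
  smooth_on U (fun w => u w * v w).
Proof. by move=> hu hv k; exact: CkM. Qed.

Lemma smoothN (u : V -> R) : smooth_on U u -> smooth_on U (fun w => - u w).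
Proof. by move=> hu k; exact: CkN. Qed.

Lemma smoothV (u : V -> R) : (forall z, U z -> u z != 0) -> smooth_on U u ->
  smooth_on U (fun w => (u w)^-1).
Proof. by move=> u0 hu k; exact: CkV. Qed.

Lemma smooth_pd p u : smooth_on U u -> smooth_on U (pd p u).
Proof. by move=> hu k; exact: Ck_pd. Qed.

Lemma smooth_ext (u v : V -> R) : (forall z, U z -> u z = v z) ->
  smooth_on U u -> smooth_on U v.
Proof. by move=> uv hu k; exact: Ck_ext uv (hu k). Qed.

Local Notation csm := (csmooth_on U).

Lemma csm_is_cpd f z p : csm f -> U z -> is_cpd p f z (cpd p f z).
Proof.
by move=> [h1 h2] Uz; split; [exact: (Ck_is_pd p (h1 1%N))|exact: (Ck_is_pd p (h2 1%N))].
Qed.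

Lemma csm_ext f g : (forall z, U z -> f z = g z) -> csm f -> csm g.
Proof.
move=> fg [h1 h2]; split.
  by apply: smooth_ext h1 => z /fg ->.
by apply: smooth_ext h2 => z /fg ->.
Qed.

Lemma csm_cst (a : C) : csm (fun=> a).
Proof. by split; exact: smooth_cst. Qed.

Lemma csm_real u : smooth_on U u -> csm (fun w => (u w)%:C).
Proof. by move=> h; split => //; exact: smooth_cst. Qed.

Lemma csmD f g : csm f -> csm g -> csm (fun w => f w + g w).
Proof.
move=> [f1 f2] [g1 g2]; split.
  by apply: smooth_ext (smoothD f1 g1) => z _; rewrite raddfD.
by apply: smooth_ext (smoothD f2 g2) => z _; rewrite raddfD.
Qed.

Lemma csmM f g : csm f -> csm g -> csm (fun w => f w * g w).
Proof.
move=> [f1 f2] [g1 g2]; split.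
  apply: smooth_ext (smoothD (smoothM f1 g1) (smoothN (smoothM f2 g2))) => z _.
  by rewrite ReM.
apply: smooth_ext (smoothD (smoothM f1 g2) (smoothM f2 g1)) => z _.
by rewrite ImM.
Qed.

Lemma csmN f : csm f -> csm (fun w => - f w).
Proof.
by move=> h; apply: csm_ext (csmM (csm_cst (-1)) h) => z _; rewrite mulN1r.
Qed.

Lemma csm_conj f : csm f -> csm (fun w => (f w)^*).
Proof.
move=> [h1 h2]; split.
  by apply: smooth_ext h1 => z _; case: (f z).
by apply: smooth_ext (smoothN h2) => z _; case: (f z).
Qed.

Lemma csmV f : (forall z, U z -> f z != 0) -> csm f -> csm (fun w => (f w)^-1).
Proof.
move=> f0 h.
have [h1 h2] := h.
have hq := smoothD (smoothM h1 h1) (smoothM h2 h2).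
have q0 z : U z -> complex.Re (f z) * complex.Re (f z) + complex.Im (f z) * complex.Im (f z) != 0.
  move=> /f0; apply: contra_neq => /eqP; rewrite -!expr2 paddr_eq0 ?sqr_ge0//.
  by rewrite !sqrf_eq0 => E; apply/eqP; rewrite eq_complex /=.
apply: csm_ext (csmM (csm_conj h) (csm_real (smoothV q0 hq))) => z Uz.
have := q0 z Uz; case: (f z) => a b /= q; apply/eqP; rewrite eq_complex /=.
by rewrite !expr2; apply/andP; split; apply/eqP; ring.
Qed.

Lemma csm_sum (I : Type) (r : seq I) (P : pred I) (F : I -> V -> C) :
  (forall i, csm (F i)) -> csm (fun w => \sum_(i <- r | P i) F i w).
Proof.
move=> h; elim: r => [|i r IH].
  by apply: csm_ext (csm_cst 0) => z _; rewrite big_nil.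
have [Pi|Pi] := boolP (P i).
  by apply: csm_ext (csmD (h i) IH) => z _; rewrite big_cons Pi.
by apply: csm_ext IH => z _; rewrite big_cons (negbTE Pi).
Qed.

Lemma csm_prod (I : Type) (r : seq I) (P : pred I) (F : I -> V -> C) :
  (forall i, csm (F i)) -> csm (fun w => \prod_(i <- r | P i) F i w).
Proof.
move=> h; elim: r => [|i r IH].
  by apply: csm_ext (csm_cst 1) => z _; rewrite big_nil.
have [Pi|Pi] := boolP (P i).
  by apply: csm_ext (csmM (h i) IH) => z _; rewrite big_cons Pi.
by apply: csm_ext IH => z _; rewrite big_cons (negbTE Pi).
Qed.

Lemma csm_cpd p f : csm f -> csm (cpd p f).
Proof. by move=> [h1 h2]; split; [exact: (smooth_pd p h1)|exact: (smooth_pd p h2)]. Qed.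

Lemma csm_wd s a f : csm f -> csm (wd s a f).
Proof.
move=> h; apply: csmM; first exact: csm_cst.
by apply: csmD; [exact: csm_cpd|apply: csmM; [exact: csm_cst|exact: csm_cpd]].
Qed.

Section Rules.
Variables (z : V) (Uz : U z).

Lemma wd_ext s a f g : (forall w, U w -> f w = g w) -> csm f ->
  wd s a f z = wd s a g z.
Proof.
move=> fg hf; apply/esym/is_wd => p.
have [h1 h2] := csm_is_cpd p hf Uz.
split; [apply: (is_pd_near oU Uz _ h1)|apply: (is_pd_near oU Uz _ h2)] => w Uw;
  by rewrite /re /im fg.
Qed.

Lemma wd_cst s a (c : C) : wd s a (fun=> c) z = 0.
Proof.
rewrite (is_wd _ _ (D := fun=> 0)); last by move=> p; exact: is_cpd_cst.
by rewrite /wdc mulr0 addr0 mulr0.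
Qed.

Lemma wdD s a f g : csm f -> csm g ->
  wd s a (fun w => f w + g w) z = wd s a f z + wd s a g z.
Proof.
move=> hf hg; rewrite (is_wd _ _ (D := fun p => cpd p f z + cpd p g z)); last first.
  by move=> p; apply: is_cpdD; exact: csm_is_cpd.
exact: wirtD.
Qed.

Lemma wdM s a f g : csm f -> csm g ->
  wd s a (fun w => f w * g w) z = wd s a f z * g z + f z * wd s a g z.
Proof.
move=> hf hg.
rewrite (is_wd _ _ (D := fun p => cpd p f z * g z + f z * cpd p g z)); last first.
  by move=> p; apply: is_cpdM; exact: csm_is_cpd.
exact: wirtM.
Qed.

Lemma wdZ s a c f : csm f -> wd s a (fun w => c * f w) z = c * wd s a f z.
Proof. by move=> hf; rewrite wdM ?wd_cst ?mul0r ?add0r//; exact: csm_cst. Qed.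

Lemma wdN s a f : csm f -> wd s a (fun w => - f w) z = - wd s a f z.
Proof.
move=> hf; rewrite -mulN1r -wdZ//; apply: wd_ext; last exact: csmN.
by move=> w _; rewrite mulN1r.
Qed.

Lemma wd_conj s a f : csm f -> wd s a (fun w => (f w)^*) z = (wd (~~ s) a f z)^*.
Proof.
move=> hf; rewrite (is_wd _ _ (D := fun p => (cpd p f z)^*)); last first.
  by move=> p; apply: is_cpd_conj; exact: csm_is_cpd.
have c2 : (2^-1 : C)^* = 2^-1 by rewrite conjc_inv conjc_nat.
have ci : (if ~~ s then 'i%C else - 'i%C : C)^* = if s then 'i%C else - 'i%C.
  by case: s; apply/eqP; rewrite eq_complex /= ?opprK ?oppr0 !eqxx.
exact: (wirt_conj (conj := @conjc R) _ _ c2 ci).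
Qed.

Lemma wd_sum s a (I : Type) (r : seq I) (P : pred I) (F : I -> V -> C) :
  (forall i, csm (F i)) ->
  wd s a (fun w => \sum_(i <- r | P i) F i w) z = \sum_(i <- r | P i) wd s a (F i) z.
Proof.
move=> h; elim: r => [|i r IH].
  rewrite big_nil -[RHS](wd_cst s a 0); apply: wd_ext => [w _|]; first by rewrite big_nil.
  exact: csm_sum.
rewrite big_cons -IH; have [Pi|Pi] := boolP (P i).
  rewrite -wdD//; last exact: csm_sum.
  by apply: wd_ext => [w _|]; [rewrite big_cons Pi|exact: csm_sum].
by apply: wd_ext => [w _|]; [rewrite big_cons (negbTE Pi)|exact: csm_sum].
Qed.

Lemma wd_prod s a (I : eqType) (r : seq I) (F : I -> V -> C) : uniq r ->
  (forall i, csm (F i)) ->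
  wd s a (fun w => \prod_(i <- r) F i w) z =
  \sum_(i <- r) \prod_(j <- r) (if j == i then wd s a (F j) z else F j z).
Proof.
move=> ur h; elim: r ur => [_|i r IH /= /andP[ir ur]].
  rewrite big_nil -[RHS](wd_cst s a 1); apply: wd_ext => [w _|]; first by rewrite big_nil.
  exact: csm_prod.
transitivity (wd s a (fun w => F i w * \prod_(j <- r) F j w) z).
  by apply: wd_ext => [w _|]; [rewrite big_cons|exact: csm_prod].
rewrite wdM//; last exact: csm_prod.
rewrite big_cons big_cons eqxx IH//; congr (_ * _ + _).
  rewrite big_seq [RHS]big_seq; apply: eq_bigr => j jr.
  by case: eqVneq => // ji; move: ir; rewrite -ji jr.
rewrite mulr_sumr [LHS]big_seq [RHS]big_seq; apply: eq_bigr => j jr.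
rewrite big_cons; case: eqVneq => // ij; by move: ir; rewrite ij jr.
Qed.

Lemma wd_real_comp s a u (h : R -> R) l : smooth_on U u -> is_derive (u z) 1 h l ->
  wd s a (fun w => (h (u w))%:C) z = l%:C * wd s a (fun w => (u w)%:C) z.
Proof.
move=> hu hh.
rewrite (is_wd _ _ (D := fun p => l%:C * (pd p u z)%:C)); last first.
  move=> p; have -> : l%:C * (pd p u z)%:C = (l * pd p u z)%:C.
    by rewrite [RHS]rmorphM.
  apply: is_cpd_real; apply: (is_pd_comp (h := h)) hh.
  exact: (Ck_is_pd p (hu 1%N)).
rewrite [in RHS](is_wd _ _ (D := fun p => (pd p u z)%:C)); last first.
  by move=> p; apply: is_cpd_real; exact: (Ck_is_pd p (hu 1%N)).
exact: wirtZ.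
Qed.

Lemma cpd_comm p q f : csm f -> cpd p (cpd q f) z = cpd q (cpd p f) z.
Proof.
move=> [h1 h2]; apply: is_cpd_eq.
have e1 := Ck_is_pd p (Ck_pd q (h1 2)) Uz.
have e2 := Ck_is_pd p (Ck_pd q (h2 2)) Uz.
rewrite (schwarz p q oU (h1 2) Uz) in e1.
rewrite (schwarz p q oU (h2 2) Uz) in e2.
by split; [exact: e1|exact: e2].
Qed.

#[local] Opaque cpd.

Lemma wd_cpd s a p f : csm f ->
  cpd p (wd s a f) z = wdc s (fun q => cpd p (cpd q f) z) a.
Proof.
move=> hf; apply: is_cpd_eq.
have h q : is_cpd p (cpd q f) z (cpd p (cpd q f) z).
  by apply: csm_is_cpd => //; exact: csm_cpd.
have h1 := is_cpdM (is_cpd_cst p (if s then 'i%C else - 'i%C) z) (h (a, true)).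
have conv l l' : l = l' -> is_cpd p (wd s a f) z l -> is_cpd p (wd s a f) z l'.
  by move=> ->.
apply: conv (is_cpdM (is_cpd_cst p 2^-1 z) (is_cpdD (h (a, false)) h1)).
exact: wirt_der0.
Qed.

(** All the operators are combinations with constant coefficients of real
    partial derivatives, and these commute. *)
Lemma wd_comm s a t b f : csm f -> wd s a (wd t b f) z = wd t b (wd s a f) z.
Proof.
move=> hf.
have L s' a' t' b' : wd s' a' (wd t' b' f) z =
    wdc s' (fun p => wdc t' (fun q => cpd p (cpd q f) z) b') a'.
  apply: (congr1 (fun D => wdc s' D a')); apply/funext => p.
  exact: wd_cpd.
rewrite (L s a t b) (L t b s a).
have E : (fun p => wdc s (fun q => cpd p (cpd q f) z) a) =
    (fun p => wdc s (fun q => cpd q (cpd p f) z) a).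
  apply/funext => p; apply: (congr1 (fun D => wdc s D a)); apply/funext => q.
  exact: cpd_comm.
apply: etrans _ (congr1 (fun G => wdc t G b) (esym E)).
exact: wirt_comm.
Qed.

End Rules.

End Wirtinger.

(** * Positive definite hermitian matrices and the Bochner argument *)

Section PosDef.
Variables (C : numClosedFieldType) (n : nat).
Local Notation "A ^cj" := (map_mx Num.conj A) (at level 2, format "A ^cj").

Lemma trmx_cj m p (A : 'M[C]_(m, p)) : (A^T)^cj = (A^cj)^T.
Proof. by rewrite map_trmx. Qed.

Lemma cjM m p q (A : 'M[C]_(m, p)) (B : 'M[C]_(p, q)) : (A *m B)^cj = A^cj *m B^cj.
Proof. exact: map_mxM. Qed.

Lemma cjK m p (A : 'M[C]_(m, p)) : (A^cj)^cj = A.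
Proof. by apply/matrixP => i j; rewrite !mxE conjCK. Qed.

Definition pdef (A : 'M[C]_n) := A^cj = A^T /\
  forall v : 'rV[C]_n, v != 0 -> 0 < (v *m A *m (v^cj)^T) 0 0.

(** Diagonalize A in a unitary basis and take the square roots of its
    (positive) eigenvalues. *)
Lemma pdef_factor (A : 'M[C]_n) : pdef A ->
  exists2 L : 'M[C]_n, A = L *m (L^cj)^T & 0 < \det A.
Proof.
move=> [Ah Ap].
have hs : A \is hermsymmx.
  apply/is_hermitianmxP; rewrite expr0 scale1r.
  by rewrite trmx_cj Ah trmxK.
have /orthomx_spectralP Ae := hermitian_normalmx hs.
set P := spectralmx A in Ae; set d := spectral_diag A in Ae.
have PU : P \is unitarymx := spectral_unitarymx A.
have PUP : P *m (P^cj)^T = 1%:M by have /unitarymxP := PU; rewrite map_trmx.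
rewrite (invmx_unitary PU) trmx_cj in Ae.
have PUP' : (P^cj)^T *m P = 1%:M by exact: mulmx1C.
have dpos i : 0 < d 0 i.
  have vi : row i P != 0.
    apply/eqP => r0; have : row i (P *m (P^cj)^T) = 0 by rewrite row_mul r0 mul0mx.
    rewrite PUP => /rowP/(_ i); rewrite !mxE eqxx => /eqP; by rewrite oner_eq0.
  have := Ap _ vi.
  have -> : row i P *m A *m ((row i P)^cj)^T = (\row_j (P *m A *m (P^cj)^T) i i : 'rV_1).
    apply/matrixP => j k; rewrite !ord1 mxE -row_mul mxE [RHS]mxE.
    by apply: eq_bigr => l _; rewrite !mxE.
  by rewrite mxE Ae !mulmxA PUP mul1mx -mulmxA PUP mulmx1 mxE eqxx mulr1n.
exists ((P^cj)^T *m diag_mx (map_mx sqrtC d)).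
  rewrite cjM trmx_mul trmx_cj cjK trmxK map_diag_mx tr_diag_mx.
  rewrite {1}Ae -!mulmxA; congr (_ *m _); rewrite !mulmxA; congr (_ *m _).
  rewrite mul_diag_mx; apply/matrixP => i j; rewrite !mxE.
  case: eqVneq => [->|]; last by rewrite !mulr0n mulr0.
  rewrite !mulr1n.
  have s0 : 0 <= sqrtC (d 0 j) by rewrite sqrtC_ge0 ltW.
  have /= -> := conj_Creal (ger0_real s0).
  by rewrite -expr2 sqrtCK.
rewrite Ae !det_mulmx det_diag mulrAC -det_mulmx PUP' det1 mul1r.
by apply: prodr_gt0.
Qed.

Lemma pdef_unit (A : 'M[C]_n) : pdef A -> A \in unitmx.
Proof. by move=> /pdef_factor[L _ d]; rewrite unitmxE unitfE gt_eqF. Qed.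

Lemma tr_norm0 (K : 'M[C]_n) : \tr (K *m (K^cj)^T) = 0 -> K = 0.
Proof.
move=> /eqP; rewrite /mxtrace psumr_eq0 => [/allP h|i _].
  apply/matrixP => i j; rewrite mxE.
  have := h i (mem_index_enum _); rewrite /= mxE psumr_eq0 => [/allP/(_ j (mem_index_enum _))|k _].
    by rewrite /= !mxE mul_conjC_eq0 => /eqP.
  by rewrite !mxE mul_conjC_ge0.
by rewrite mxE sumr_ge0// => k _; rewrite !mxE mul_conjC_ge0.
Qed.

(** The trace of B *m B^cj is the squared norm, for the hermitian metric A, of
    the tensor obtained from B by lowering an index, as soon as this tensor is
    symmetric: with A = L L^* and K = conj (L^-1) (B A) conj (L^-1)^T, it is
    the sum of the squared moduli of the entries of K. *)
Lemma sym_tr0 (A B : 'M[C]_n) : pdef A -> (B *m A)^T = B *m A ->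
  \tr (B *m B^cj) = 0 -> B = 0.
Proof.
move=> pA; have [L AL _] := pdef_factor pA; have [Ah _] := pA.
have Au := pdef_unit pA.
have Lu : L \in unitmx by have := Au; rewrite AL unitmx_mul => /andP[].
move TE: (B *m A) => T Ts.
pose M := invmx L.
have ML : M *m L = 1%:M by exact: mulVmx.
have LM : L *m M = 1%:M by exact: mulmxV.
have MLc : M^cj *m L^cj = 1%:M by rewrite -cjM ML map_mx1.
have LMc : L^cj *m M^cj = 1%:M by rewrite -cjM LM map_mx1.
have BT : B = T *m (M^cj)^T *m M.
  rewrite -TE AL -!mulmxA [(L^cj)^T *m _]mulmxA -trmx_mul MLc trmx1 mul1mx.
  by rewrite LM mulmx1.
have Tc : T^cj = (T^cj)^T by rewrite -trmx_cj Ts.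
move=> trB; pose K := M^cj *m T *m (M^cj)^T.
suff K0 : K = 0.
  have : L^cj *m K *m (L^cj)^T = 0 by rewrite K0 mulmx0 mul0mx.
  rewrite /K !mulmxA LMc mul1mx -mulmxA -trmx_mul LMc trmx1 mulmx1 => T0.
  by rewrite BT T0 !mul0mx.
apply: tr_norm0; rewrite -trB.
rewrite /K !cjM !trmx_mul -Tc cjK trmx_cj cjK trmxK.
rewrite [in RHS]BT !cjM trmx_cj cjK.
by rewrite -!mulmxA mxtrace_mulC !mulmxA.
Qed.

End PosDef.

Section BochnerAlgebra.
Variables (C : numClosedFieldType) (n : nat).
Local Notation "A ^cj" := (map_mx Num.conj A) (at level 2, format "A ^cj").
Variables (A W : 'M[C]_n) (h v : 'rV[C]_n) (k : C).
Hypotheses (pA : pdef A) (vA : v *m A = h) (sW : (W *m A)^T = W *m A).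
Hypotheses (kr : Num.conj k = k) (k0 : k != 0).

(** Below, A is the metric, v the row of the phi^a, h the row of the phi_bbar
    and W the matrix of the derivatives d phi^a / d zbar^b. The hypothesis is
    the derivative of the equation |d phi|^2 = k^2. Lowering an index with A
    turns W into a symmetric matrix, so that the contraction of W on one side
    gives, after conjugation, its contraction on the other side: the
    derivative of conj (grad phi) in the direction grad phi is a multiple of
    itself. *)
Lemma gradient_geodesic : W *m (h^cj)^T = - k *: h^T -> v *m W^cj = - k *: v^cj.
Proof.
have [Ah _] := pA; have Au := pdef_unit pA.
move=> E0.
have Acu : A^cj \in unitmx by rewrite Ah unitmx_tr.
apply: (can_inj (mulmxK Acu)); rewrite -mulmxA -cjM -scalemxAl -cjM vA.
have E1 : W *m A *m (v^cj)^T = - k *: h^T.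
  rewrite -E0 -vA cjM Ah trmx_mul trmxK mulmxA; congr (_ *m _).
have E2 : v^cj *m (W *m A) = - k *: h.
  by have := congr1 trmx E1; rewrite trmx_mul sW trmxK linearZ /= trmxK.
rewrite -[v]cjK -cjM E2.
by apply/matrixP => i j; rewrite !mxE rmorphM rmorphN /= kr.
Qed.

(** Expand the squared norm of B = W + k^-1 h^T v: the square of W contributes
    k^2, each of the two cross terms - k^2, and the square of k^-1 h^T v
    contributes k^2. The sum is zero. *)
Lemma bochner_vanishing : v *m (h^cj)^T = (k ^+ 2)%:M ->
  W *m (h^cj)^T = - k *: h^T -> \tr (W *m W^cj) = k ^+ 2 ->
  W + k^-1 *: (h^T *m v) = 0.
Proof.
move=> nrm E0 trW; have E2 := gradient_geodesic E0.
have kvr : Num.conj k^-1 = k^-1 by rewrite fmorphV /= kr.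
have nrmc : v^cj *m h^T = (k ^+ 2)%:M.
  have := congr1 (fun M => M^cj) nrm; rewrite cjM trmx_cj cjK map_scalar_mx /=.
  by rewrite rmorphXn /= kr.
have nrm' : h^cj *m v^T = (k ^+ 2)%:M.
  by rewrite -[LHS]trmxK trmx_mul trmxK nrm tr_scalar_mx.
have nrmc' : h *m (v^cj)^T = (k ^+ 2)%:M.
  by rewrite -[LHS]trmxK trmx_mul trmxK nrmc tr_scalar_mx.
set Q := h^T *m v.
have Qc : Q^cj = (h^cj)^T *m v^cj by rewrite cjM trmx_cj.
have t1 : \tr (Q *m W^cj) = - k ^+ 3.
  rewrite -mulmxA E2 -scalemxAr mxtraceZ mxtrace_mulC nrmc mxtrace_scalar.
  by rewrite mulr1n exprS mulNr.
have t2 : \tr (W *m Q^cj) = - k ^+ 3.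
  rewrite Qc mulmxA E0 -scalemxAl mxtraceZ mxtrace_mulC nrmc mxtrace_scalar.
  by rewrite mulr1n exprS mulNr.
have t3 : \tr (Q *m Q^cj) = k ^+ 4.
  rewrite Qc mulmxA -(mulmxA _ v) nrm scalar_mxC -mulmxA mul_scalar_mx mxtraceZ.
  by rewrite mxtrace_mulC nrmc mxtrace_scalar mulr1n -exprD.
apply: (sym_tr0 pA).
  rewrite mulmxDl linearD /= sW -scalemxAl linearZ /=; congr (_ + _ *: _).
  by rewrite -mulmxA vA trmx_mul trmxK.
have -> : (W + k^-1 *: Q)^cj = W^cj + k^-1 *: Q^cj.
  by apply/matrixP => i j; rewrite !mxE rmorphD rmorphM /= kvr.
rewrite mulmxDl !mulmxDr -!scalemxAl -!scalemxAr !mxtraceD !mxtraceZ trW t1 t2 t3.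
by field.
Qed.

End BochnerAlgebra.

(** * Determinants and inverses of smooth matrices *)

#[local] Opaque cpd wd.

Section MatrixCalculus.
Context {R : realType} {n : nat}.
Local Notation V := 'rV[R[i]]_n.
Local Notation C := R[i].
Variables (U : set V) (oU : open U).
Local Notation csm := (csmooth_on U).

Lemma csm_det m (M : V -> 'M[C]_m) : (forall i j, csm (fun w => M w i j)) ->
  csm (fun w => \det (M w)).
Proof.
move=> h; apply: csm_sum => // s; apply: csmM => //; first exact: csm_cst.
by apply: csm_prod.
Qed.

Lemma csm_invmx m (M : V -> 'M[C]_m) i j : (forall i j, csm (fun w => M w i j)) ->
  (forall w, U w -> M w \in unitmx) -> csm (fun w => invmx (M w) i j).
Proof.
move=> h hu.
have hc : csm (fun w => cofactor (M w) j i).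
  apply: csmM => //; first exact: csm_cst.
  apply: csm_det => k l.
  by apply: (csm_ext oU _ (h (lift j k) (lift i l))) => w _; rewrite !mxE.
have hi : csm (fun w => (\det (M w))^-1).
  by apply: csmV => //; exact: csm_det.
apply: (csm_ext oU _ (csmM oU hi hc)) => w Uw.
by rewrite /invmx hu// !mxE.
Qed.

(** Jacobi's formula: by the Leibniz expansion, the derivative of the
    determinant is the sum over i of the determinants N i in which the row i
    is differentiated; these are expanded along the row i. *)
Lemma wd_det m (M : V -> 'M[C]_m) s a z : U z -> (forall i j, csm (fun w => M w i j)) ->
  wd s a (fun w => \det (M w)) z =
  \sum_i \sum_j wd s a (fun w => M w i j) z * cofactor (M z) i j.
Proof.
move=> Uz h.
pose dM : 'M[C]_m := \matrix_(i, j) wd s a (fun w => M w i j) z.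
pose N (i : 'I_m) : 'M[C]_m := \matrix_(j, k) (if j == i then dM j k else M z j k).
have cp (sg : 'S_m) : csm (fun w => \prod_i M w i (sg i)).
  by apply: csm_prod.
transitivity (\sum_(sg : 'S_m) (-1) ^+ sg *
    \sum_i \prod_j (if j == i then dM j (sg j) else M z j (sg j))).
  transitivity (wd s a (fun w => \sum_(sg : 'S_m) (-1) ^+ sg * \prod_i M w i (sg i)) z).
    by apply: (wd_ext oU Uz); [move=> w _|exact: csm_det].
  rewrite (wd_sum oU Uz) //; last by move=> sg; apply: csmM => //; exact: csm_cst.
  apply: eq_bigr => sg _; rewrite (wdZ oU Uz) //; congr (_ * _).
  rewrite (wd_prod oU Uz) ?index_enum_uniq//; apply: eq_bigr => i _.
  by apply: eq_bigr => j _; rewrite mxE.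
transitivity (\sum_i \det (N i)).
  under eq_bigr do rewrite mulr_sumr.
  rewrite exchange_big /=; apply: eq_bigr => i _.
  by apply: eq_bigr => sg _; congr (_ * _); apply: eq_bigr => j _; rewrite [RHS]mxE.
apply: eq_bigr => i _; rewrite (expand_det_row _ i); apply: eq_bigr => j _.
rewrite mxE eqxx mxE; congr (_ * _); rewrite /cofactor; congr (_ * \det _).
by apply/matrixP => k l; rewrite !mxE eq_sym (negbTE (neq_lift _ _)).
Qed.

End MatrixCalculus.

(** * The gradient of a potential of constant gradient norm, in a chart *)

Section Bochner.
Context {R : realType} {n : nat}.
Local Notation V := 'rV[R[i]]_n.
Local Notation C := R[i].
Variables (U : set V) (oU : open U) (g : V -> 'M[C]_n) (u : V -> R).
Local Notation csm := (csmooth_on U).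
Local Notation c := (n.+1%:R : C).
Local Notation uC := (fun w => (u w)%:C).

Hypothesis g_smooth : forall a b, csm (fun w => g w a b).
Hypothesis g_herm : forall w, U w -> forall a b, g w b a = (g w a b)^*.
Hypothesis g_pos : forall w, U w -> forall v, v != 0 -> 0 < herm (g w) v.
Hypothesis g_closed : forall w, U w -> forall a b e,
  wd true e (fun w => g w a b) w = wd true b (fun w => g w a e) w.
Hypothesis u_smooth : smooth_on U u.
Hypothesis u_pot : forall w, U w -> forall a b,
  wd false a (wd true b uC) w = c * g w a b.
Hypothesis g_einstein : forall w, U w -> forall a b,
  wd false a (wd true b (fun w => (ln (complex.Re (\det (g w))))%:C)) w = c * g w a b.
Hypothesis u_norm : forall w, U w ->
  Num.sqrt (complex.Re (\sum_(a < n) \sum_(b < n)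
    wd false a uC w * wd true b uC w * invmx (g w) b a)) = n.+1%:R.

Definition cograd b : V -> C := wd true b uC.
Definition grad_comp a : V -> C := fun w => \sum_b cograd b w * invmx (g w) b a.

Local Notation ub := cograd.
Local Notation up := grad_comp.
Local Notation ua := (fun a => wd false a uC).

Let csm_uC : csm uC. Proof. exact: csm_real. Qed.

Let csm_ub b : csm (ub b). Proof. exact: csm_wd. Qed.

Lemma hermitian_pdef w : U w -> pdef (g w).
Proof.
move=> Uw; split; first by apply/matrixP => a b; rewrite !mxE; exact/esym/g_herm.
by move=> v v0; exact: g_pos.
Qed.

Let g_unit w : U w -> g w \in unitmx. Proof. by move=> /hermitian_pdef/pdef_unit. Qed.

Let csm_gi a b : csm (fun w => invmx (g w) a b).
Proof. exact: csm_invmx. Qed.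

Lemma csm_grad a : csm (up a).
Proof. by apply: csm_sum => // b; apply: csmM. Qed.

Lemma grad_row w : (\row_a up a w) = (\row_b ub b w) *m invmx (g w).
Proof. by apply/rowP => a; rewrite !mxE; apply: eq_bigr => b _; rewrite mxE. Qed.

Lemma grad_lower w : U w -> (\row_a up a w) *m g w = \row_b ub b w.
Proof. by move=> Uw; rewrite grad_row mulmxKV// g_unit. Qed.

Lemma grad_lowerE w b : U w -> \sum_a up a w * g w a b = ub b w.
Proof.
move=> /grad_lower/rowP/(_ b); rewrite !mxE => <-.
by apply: eq_bigr => a _; rewrite mxE.
Qed.

Lemma cograd_conj w b : U w -> (ub b w)^* = wd false b uC w.
Proof.
move=> Uw; rewrite -[LHS](wd_conj Uw false b csm_uC).
by apply: (wd_ext oU Uw) => [x _|]; [exact: conjc_real|exact: csm_conj].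
Qed.

(** The sum is real and nonnegative because it is the value of the hermitian
    metric on the gradient; hence it is the square of the norm of the
    differential. *)
Lemma grad_norm w : U w -> \sum_a wd false a uC w * up a w = c ^+ 2.
Proof.
move=> Uw; set s := \sum_a _.
have sE : herm (g w) (\row_a up a w) = s^*.
  rewrite /herm grad_lower// mxE /s [RHS]rmorph_sum; apply: eq_bigr => a _.
  by rewrite !mxE -cograd_conj// [RHS]rmorphM /= conjcK.
have s0 : 0 <= s.
  rewrite -conj_ge0 -sE; have [->|v0] := eqVneq (\row_a up a w) 0.
    by rewrite /herm !mul0mx mxE.
  exact/ltW/g_pos.
have sIm := ger0_Im s0.
have sN : Num.sqrt (complex.Re s) = n.+1%:R.
  rewrite -(u_norm Uw) /s; congr (Num.sqrt (complex.Re _)).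
  apply: eq_bigr => a _; rewrite mulr_sumr; apply: eq_bigr => b _.
  by rewrite mulrA.
have sRe : complex.Re s = n.+1%:R ^+ 2.
  rewrite -sN sqr_sqrtr//.
  by move: s0; rewrite lecE /= => /andP[].
have rn : (n.+1%:R ^+ 2 : R)%:C = c ^+ 2.
  by rewrite [LHS]rmorphXn; congr (_ ^+ 2); exact: rmorph_nat.
by rewrite [LHS]complexE sIm sRe rn mulr0 addr0.
Qed.

Let W (b a : 'I_n) w := wd true b (up a) w.

Let csm_W b a : csm (W b a). Proof. by apply: csm_wd => //; exact: csm_grad. Qed.

Let csm_upc a : csm (fun w => (up a w)^*). Proof. exact/csm_conj/csm_grad. Qed.

Lemma potential_ddbar_comm w a b : U w -> wd true b (wd false a uC) w = c * g w a b.
Proof. by move=> Uw; rewrite (wd_comm oU Uw)//; exact: u_pot. Qed.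

(** Apply d/d(conj z^b) to the equation [grad_norm]; the second derivatives of
    the potential are c times the metric. *)
Lemma dbar_grad_cograd w b : U w -> \sum_a wd false a uC w * W b a w = - c * ub b w.
Proof.
move=> Uw; have h : wd true b (fun w => \sum_a wd false a uC w * up a w) w = 0.
  rewrite -[RHS](wd_cst w true b (c ^+ 2)); apply: (wd_ext oU Uw) => [x Ux|].
    exact: grad_norm.
  by apply: csm_sum => // a; apply: csmM => //; [exact: csm_wd|exact: csm_grad].
move: h; rewrite (wd_sum oU Uw) => [|a]; last first.
  by apply: csmM => //; [exact: csm_wd|exact: csm_grad].
under eq_bigr => a _.
  rewrite (wdM Uw) //; [|exact: csm_wd|exact: csm_grad].
  rewrite (potential_ddbar_comm _ _ Uw) -mulrA [g w a b * _]mulrC.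
  over.
rewrite big_split /= -mulr_sumr grad_lowerE// => /eqP.
by rewrite addrC addr_eq0 mulNr => /eqP.
Qed.

(** Lowering the index of d phi^a / d zbar^b gives the second covariant
    derivative of phi in the directions b and e: the second derivative is
    symmetric by Schwarz and the Christoffel symbol because omega is closed.
    *)
Lemma dbar_grad_sym w b e : U w -> \sum_a W b a w * g w a e = \sum_a W e a w * g w a b.
Proof.
move=> Uw.
have h b' e' : \sum_a W b' a w * g w a e' =
    wd true b' (ub e') w - \sum_a up a w * wd true b' (fun w => g w a e') w.
  have -> : wd true b' (ub e') w = wd true b' (fun w => \sum_a up a w * g w a e') w.
    apply: (wd_ext oU Uw) => // x Ux; by rewrite grad_lowerE.
  rewrite (wd_sum oU Uw) => [|a]; last by apply: csmM => //; exact: csm_grad.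
  rewrite -sumrB; apply: eq_bigr => a _.
  by rewrite (wdM Uw) ?addrK //; exact: csm_grad.
apply: etrans (h b e) (etrans _ (esym (h e b))).
apply: (congr2 (fun x y : C => x - y)); first exact: (wd_comm oU Uw).
by apply: eq_bigr => a _; congr (_ * _); exact: g_closed.
Qed.

Let Wm w : 'M[C]_n := \matrix_(b, a) W b a w.

Lemma dbar_grad_mx_sym w : U w -> (Wm w *m g w)^T = Wm w *m g w.
Proof.
move=> Uw; apply/matrixP => b e; rewrite mxE !mxE.
transitivity (\sum_a W e a w * g w a b); first by apply: eq_bigr => a _; rewrite mxE.
by rewrite dbar_grad_sym//; apply: eq_bigr => a _; rewrite mxE.
Qed.

Let c_conj : Num.conj c = c. Proof. exact: rmorph_nat. Qed.

Let c_neq0 : c != 0. Proof. by rewrite pnatr_eq0. Qed.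

Lemma dbar_grad_mx_cograd w : U w ->
  Wm w *m (map_mx Num.conj (\row_b ub b w))^T = - c *: (\row_b ub b w)^T.
Proof.
move=> Uw; apply/colP => b; rewrite !mxE -dbar_grad_cograd//; apply: eq_bigr => a _.
by rewrite !mxE mulrC -cograd_conj.
Qed.

Lemma grad_geodesic w b : U w ->
  \sum_a up a w * wd false a (fun w => (up b w)^*) w = - c * (up b w)^*.
Proof.
move=> Uw.
have := gradient_geodesic (hermitian_pdef Uw) (grad_lower Uw) (dbar_grad_mx_sym Uw) c_conj (dbar_grad_mx_cograd Uw).
move=> /rowP/(_ b); rewrite !mxE => <-; apply: eq_bigr => a _; rewrite !mxE.
by congr (_ * _); exact: (wd_conj Uw false a (csm_grad b)).
Qed.

Local Notation Lc := (fun w => (ln (complex.Re (\det (g w))))%:C).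
Let ell b := wd true b Lc.

(** Jacobi's formula for log det g. *)
Lemma wd_ln_det w b : U w ->
  ell b w = \sum_m \sum_e invmx (g w) m e * wd true b (fun w => g w e m) w.
Proof.
move=> Uw.
have dE x : U x -> \det (g x) = (complex.Re (\det (g x)))%:C /\ 0 < complex.Re (\det (g x)).
  by move=> Ux; apply: ltc_real; have [] := pdef_factor (hermitian_pdef Ux).
have [dw dw0] := dE w Uw.
have csd : csm (fun w => \det (g w)) by exact: csm_det.
have -> : ell b w = ((complex.Re (\det (g w)))^-1)%:C * wd true b (fun w => \det (g w)) w.
  have dl := is_derive1_ln dw0.
  rewrite /ell (wd_real_comp Uw true b csd.1 dl).
  congr (_ * _); apply: (wd_ext oU Uw) => [x Ux|]; first by have [<-] := dE x Ux.
  exact/csm_real/csd.1.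
have -> : ((complex.Re (\det (g w)))^-1)%:C = (\det (g w))^-1.
  by rewrite [in RHS]dw; exact: fmorphV.
rewrite (wd_det oU true b Uw)// [RHS]exchange_big mulr_sumr /=.
apply: eq_bigr => i _; rewrite mulr_sumr; apply: eq_bigr => j _.
have -> : invmx (g w) j i = (\det (g w))^-1 * cofactor (g w) i j.
  by rewrite /invmx g_unit// !mxE.
by rewrite mulrCA mulrC.
Qed.

Let X m a w := wd true m (fun w => (up a w)^*) w.

(** The derivatives of conj (phi^a) are read off from c g = d dbar phi; the
    terms with a derivative of the metric add up, by closedness, to the
    derivative of log det g in the direction conj (grad phi). *)
Lemma divergence w : U w ->
  \sum_m X m m w = c * n%:R - \sum_a (up a w)^* * ell a w.
Proof.
move=> Uw.
pose Xm : 'M[C]_n := \matrix_(m, a) X m a w.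
pose Y : 'M[C]_n := \matrix_(m, b) \sum_a (up a w)^* * wd true m (fun w => g w b a) w.
have E : Xm *m (g w)^T + Y = c *: (g w)^T.
  apply/matrixP => m b; rewrite mxE [RHS]mxE [X in _ = _ * X]mxE -potential_ddbar_comm//.
  have -> : wd true m (wd false b uC) w =
      wd true m (fun w => \sum_a (up a w)^* * g w b a) w.
    apply: (wd_ext oU Uw); last exact: csm_wd.
    move=> x Ux; rewrite -cograd_conj// -grad_lowerE// rmorph_sum.
    by apply: eq_bigr => a _; rewrite [LHS]rmorphM /= -g_herm.
  rewrite (wd_sum oU Uw) => [|a]; last first.
    by apply: (csmM oU); [exact: csm_upc|exact: g_smooth].
  rewrite !mxE -big_split /=; apply: eq_bigr => a _.
  by rewrite (wdM Uw _ _ (csm_upc a) (g_smooth b a)) !mxE.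
(* tracing with the inverse metric turns E into the assertion *)
have := congr1 (fun M => \tr (invmx (g w) *m M^T)) E => /=.
rewrite !linearD /= !linearZ /= !trmx_mul !trmxK mulmxA mulVmx ?g_unit// mul1mx.
rewrite mxtrace_tr mxtrace1 => E1.
have trX : \tr Xm = \sum_m X m m w by apply: eq_bigr => m _; rewrite mxE.
have trY : \tr (invmx (g w) *m Y^T) = \sum_a (up a w)^* * ell a w.
  transitivity (\sum_m \sum_b invmx (g w) m b *
      \sum_a (up a w)^* * wd true m (fun w => g w b a) w).
    by apply: eq_bigr => m _; rewrite mxE; apply: eq_bigr => b _; rewrite !mxE.
  transitivity (\sum_m \sum_b \sum_a (up a w)^* *
      (invmx (g w) m b * wd true a (fun w => g w b m) w)).
    apply: eq_bigr => m _; apply: eq_bigr => b _; rewrite mulr_sumr.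
    apply: eq_bigr => a _; rewrite mulrCA; congr (_ * (_ * _)).
    exact: g_closed.
  transitivity (\sum_a \sum_m \sum_b (up a w)^* *
      (invmx (g w) m b * wd true a (fun w => g w b m) w)).
    rewrite [RHS]exchange_big /=; apply: eq_bigr => m _; exact: exchange_big.
  apply: eq_bigr => a _; rewrite wd_ln_det// mulr_sumr; apply: eq_bigr => m _.
  by rewrite mulr_sumr.
move: E1; rewrite trX trY => <-.
by rewrite addrK.
Qed.

Let csm_ell a : csm (ell a).
Proof.
pose F w := \sum_m \sum_e invmx (g w) m e * wd true a (fun w => g w e m) w.
have FE z : U z -> F z = ell a z by move=> Uz; rewrite wd_ln_det.
apply: (csm_ext oU FE); apply: (csm_sum oU) => m; apply: (csm_sum oU) => e.
by apply: (csmM oU); [exact: csm_gi|exact: csm_wd].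
Qed.

Let csm_X m a : csm (X m a).
Proof. by apply: (csm_wd oU); exact: csm_upc. Qed.

Let csm_ucell a : csm (fun w => (up a w)^* * ell a w).
Proof. by apply: (csmM oU); [exact: csm_upc|exact: csm_ell]. Qed.

Let Wc a b w := wd false a (fun w => (up b w)^*) w.

Let csm_Wc a b : csm (Wc a b).
Proof. by apply: (csm_wd oU); exact: csm_upc. Qed.

Lemma wd_divergence w a : U w -> wd false a (fun w => \sum_m X m m w) w =
  - \sum_b (Wc a b w * ell b w + (up b w)^* * (c * g w a b)).
Proof.
move=> Uw.
have -> : wd false a (fun w => \sum_m X m m w) w =
    wd false a (fun w => c * n%:R + - \sum_b (up b w)^* * ell b w) w.
  apply: (wd_ext oU Uw); first by move=> x Ux; rewrite divergence.
  by apply: (csm_sum oU) => m; exact: csm_X.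
have cs : csm (fun w => \sum_b (up b w)^* * ell b w).
  by apply: (csm_sum oU) => b; exact: csm_ucell.
rewrite (wdD Uw _ _ (csm_cst oU _) (csmN oU cs)) (wd_cst w) add0r.
rewrite (wdN oU Uw _ _ cs) (wd_sum oU Uw _ _ _ _ csm_ucell); congr (- _).
apply: eq_bigr => b _.
rewrite (wdM Uw _ _ (csm_upc b) (csm_ell b)); congr (_ + _ * _).
exact: g_einstein.
Qed.

Let pairing_aux (F : comNzRingType) (x t k m : F) :
  x + (k * t - k * k ^+ 2) = - k * (k * m - t) -> x = k ^+ 3 - k ^+ 2 * m.
Proof.
by move=> h; rewrite -[LHS](addrK (k * t - k * k ^+ 2)) h; ring.
Qed.

(** The Bochner identity, in traced form: take the divergence of
    [grad_geodesic]. The third derivatives of phi that appear are obtained by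
    differentiating [divergence], and the second derivatives of log det g by
    the Einstein equation. The result is c^3 - c^2 n, that is c^2 as c = n +
    1. *)
Lemma norm_dbar_grad w : U w -> \sum_b \sum_a W b a w * Wc a b w = c ^+ 2.
Proof.
move=> Uw.
pose T := \sum_e (up e w)^* * ell e w.
have nc : \sum_e ub e w * (up e w)^* = c ^+ 2.
  have c2 : (c ^+ 2)^* = c ^+ 2 by rewrite rmorphXn /= rmorph_nat.
  rewrite -c2 -(grad_norm Uw) rmorph_sum; apply: eq_bigr => e _.
  by rewrite [RHS]rmorphM /= -cograd_conj// conjcK.
have E b : \sum_a (W b a w * Wc a b w + up a w * wd false a (X b b) w) = - c * X b b w.
  have h : wd true b (fun w => \sum_a up a w * Wc a b w) w =
      wd true b (fun w => - c * (up b w)^*) w.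
    apply: (wd_ext oU Uw); first by move=> x Ux; exact: grad_geodesic.
    apply: (csm_sum oU) => a; apply: (csmM oU); [exact: csm_grad|exact: csm_Wc].
  rewrite (wdZ oU Uw _ _ _ (csm_upc b)) in h; rewrite -h.
  rewrite (wd_sum oU Uw) => [|a]; last first.
    by apply: (csmM oU); [exact: csm_grad|exact: csm_Wc].
  apply: eq_bigr => a _; rewrite (wdM Uw _ _ (csm_grad a) (csm_Wc a b)).
  exact: (congr1 (fun t => W b a w * Wc a b w + up a w * t)
    (esym (wd_comm oU Uw true b false a (csm_upc b)))).
have : \sum_b (\sum_a W b a w * Wc a b w) + (c * T - c * c ^+ 2) =
    - c * (c * n%:R - T).
  rewrite -divergence// [RHS]mulr_sumr.
  rewrite -[RHS](eq_bigr _ (fun b _ => E b)).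
  under [RHS]eq_bigr do rewrite big_split /=.
  rewrite big_split /=; congr (_ + _).
  rewrite [RHS]exchange_big /=.
  transitivity (\sum_a up a w * - \sum_b (Wc a b w * ell b w + (up b w)^* * (c * g w a b))).
    rewrite (eq_bigr (fun a => - (\sum_b up a w * Wc a b w * ell b w +
        \sum_b c * ((up a w * g w a b) * (up b w)^*)))); last first.
      move=> a _; rewrite mulrN mulr_sumr -big_split /=; congr (- _).
      by apply: eq_bigr => b _; rewrite mulrDr mulrA; congr (_ + _); ring.
    rewrite sumrN big_split /= opprD; congr (_ + _).
      rewrite exchange_big /= mulr_sumr -sumrN; apply: eq_bigr => e _.
      by rewrite -mulr_suml grad_geodesic// !mulNr opprK mulrA.
    congr (- _); rewrite exchange_big /= -nc mulr_sumr; apply: eq_bigr => e _.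
    by rewrite -mulr_sumr -mulr_suml grad_lowerE// mulrCA.
  apply: eq_bigr => a _; rewrite -mulr_sumr; congr (_ * _).
  rewrite -(wd_divergence a Uw); apply: (wd_sum oU Uw) => b; exact: csm_X.
move=> /pairing_aux ->; have -> : c = n%:R + 1 by rewrite -natr1.
ring.
Qed.

(** The squared norm of this tensor vanishes. *)
Lemma dbar_grad_rank_one w a b : U w ->
  wd true b (up a) w + c^-1 * (ub b w * up a w) = 0.
Proof.
move=> Uw.
have trW : \tr (Wm w *m map_mx Num.conj (Wm w)) = c ^+ 2.
  rewrite -(norm_dbar_grad Uw); apply: eq_bigr => i _; rewrite mxE; apply: eq_bigr => j _.
  by rewrite !mxE; congr (_ * _); rewrite /Wc (wd_conj Uw _ _ (csm_grad i)).
have nrm : (\row_a up a w) *m (map_mx Num.conj (\row_b ub b w))^T = (c ^+ 2)%:M.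
  apply/matrixP => i j; rewrite !ord1 !mxE eqxx mulr1n -(grad_norm Uw).
  by apply: eq_bigr => e _; rewrite !mxE -cograd_conj// mulrC.
have := bochner_vanishing (hermitian_pdef Uw) (grad_lower Uw) (dbar_grad_mx_sym Uw) c_conj c_neq0 nrm
  (dbar_grad_mx_cograd Uw) trW.
move=> /matrixP/(_ b a); rewrite !mxE => <-; congr (_ + _ * _).
by rewrite big_ord1 !mxE.
Qed.

(** With the factor exp (phi / c), the tensor of [dbar_grad_rank_one] becomes
    the derivative in the direction of conj z^b. *)
Lemma exp_grad_holomorphic w a b : U w ->
  wd true b (fun x => (expR (u x / n.+1%:R))%:C * up a x) w = 0.
Proof.
move=> Uw.
have us : smooth_on U (fun x => u x / n.+1%:R).
  by apply: (smoothM oU) => //; exact: smooth_cst.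
have es : csm (fun x => (expR (u x / n.+1%:R))%:C).
  by apply: (csm_real oU) => k; apply: (Ck_exp oU); exact: us.
rewrite (wdM Uw _ _ es (csm_grad a)).
rewrite (wd_real_comp Uw true b us (is_derive_expR _)).
have -> : wd true b (fun x => (u x / n.+1%:R)%:C) w = c^-1 * ub b w.
  rewrite -(wdZ oU Uw _ _ _ csm_uC); apply: (wd_ext oU Uw) => [x _|]; last exact: csm_real.
  rewrite mulrC rmorphM; congr (_ * _).
  rewrite [LHS]fmorphV; congr (_^-1); exact: rmorph_nat.
have aux (e k x y d : C) : d + k * (x * y) = 0 -> e * (k * x) * y + e * d = 0.
  by move=> h; rewrite -!mulrA -mulrDr [X in e * X]addrC h mulr0.
exact: aux (dbar_grad_rank_one a b Uw).
Qed.

Lemma csm_exp_grad a : csm (fun x => (expR (u x / n.+1%:R))%:C * up a x).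
Proof.
apply: (csmM oU); last exact: csm_grad.
apply: (csm_real oU) => k; apply: (Ck_exp oU).
by apply: (CkM oU); [exact: u_smooth|exact: Ck_cst].
Qed.

End Bochner.

(** * Complex differentiability *)

Section DifferentialEpsilon.
Variables (K : numFieldType) (V W : normedModType K).

(** Differentiability is defined by Landau notations; this lemma and the next
    one express it with epsilons. *)
Lemma differentiable_of_linear (f : V -> W) (df : {linear V -> W}) x :
  continuous df -> (forall e : K, 0 < e ->
    \forall h \near 0, `|f (h + x) - f x - df h| <= e * `|h|) ->
  differentiable f x /\ 'd f x = df :> (V -> W).
Proof.
move=> cdf H.
have E : f \o shift x = cst (f x) + df +o_ 0 id.
  apply/eqaddoP => e /H; apply: filterS => h /=.
  by rewrite !fctE /= opprD addrA.
have D := diff_unique cdf E.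
by split => //; apply/diff_locallyP; rewrite D.
Qed.

Lemma differentiable_near (f : V -> W) x : differentiable f x ->
  forall e : K, 0 < e ->
    \forall h \near 0, `|f (h + x) - f x - 'd f x h| <= e * `|h|.
Proof.
move=> /diff_locally/eqaddoP H e /H; apply: filterS => h /=.
by rewrite !fctE /= opprD addrA.
Qed.

End DifferentialEpsilon.

Section ComplexDifferentiability.
Context {R : realType} {n : nat}.
Local Notation V := 'rV[R[i]]_n.
Local Notation C := R[i].
Implicit Types (v w z h : V) (p q : 'I_n * bool).

Lemma sum_re_im (Z : nmodType) (F : 'I_n * bool -> Z) :
  \sum_p F p = \sum_a (F (a, false) + F (a, true)).
Proof.
transitivity (\sum_a \sum_b F (a, b)).
  by rewrite pair_bigA; apply: eq_bigr => -[a b].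
by apply: eq_bigr => a _; rewrite big_bool addrC.
Qed.

Lemma normc_le_re_im (x : C) : `|x| <= (`|complex.Re x| + `|complex.Im x|)%:C.
Proof.
rewrite [X in `|X| <= _]complexE (le_trans (ler_normD _ _))// normrM.
have -> : `|'i%C| = 1 :> C by rewrite normc_def /= expr0n expr1n /= add0r sqrtr1.
by rewrite mul1r !normc_def /= expr0n /= !addr0 !sqrtr_sqr -rmorphD lecR.
Qed.

Lemma entry_le_cnorm v a : `|v 0 a| <= (cnorm v)%:C.
Proof.
apply: (le_trans (normc_le_re_im _)); rewrite lecR /cnorm sum_re_im (bigD1 a) //=.
by rewrite lerDl; apply: sumr_ge0 => b _; exact: addr_ge0.
Qed.

Lemma mx_norm_le_cnorm v : `|v| <= (cnorm v)%:C.
Proof.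
have [->|v0] := eqVneq `|v| 0; first by rewrite lecR cnorm_ge0.
have [[i a] E] := mx_norm_neq0 v0.
by rewrite -[`|v|]/(mx_norm v) E (ord1 i) /=; exact: entry_le_cnorm.
Qed.

Lemma cnorm_le_mx_norm v : (cnorm v)%:C <= #|{: 'I_n * bool}|%:R * `|v|.
Proof.
rewrite /cnorm rmorph_sum /=.
apply: (@le_trans _ _ (\sum_(p : 'I_n * bool) `|v|)); last first.
  by rewrite sumr_const mulr_natl.
apply: ler_sum => p _.
have h : `|v 0 p.1| <= `|v|.
  rewrite -[`|v|]/(mx_norm v) mx_normE.
  have -> : `|v 0 p.1| = (`|v 0 p.1|%:nng)%:num by [].
  rewrite num_le; exact: (le_bigmax _ (fun ij : 'I_1 * 'I_n => `|v ij.1 ij.2|%:nng) (0, p.1)).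
apply: le_trans h; rewrite /co; case: p.2; last exact: normc_ge_Re.
by rewrite normc_def lecR -sqrtr_sqr ler_sqrt ?addr_ge0 ?sqr_ge0// lerDr sqr_ge0.
Qed.

Lemma mulmx_dir v (A : 'M[C]_n) : v *m A = \sum_q (co q v)%:C *: (dir q *m A).
Proof.
rewrite {1}[v]vec_dir mulmx_suml; apply: eq_bigr => q _.
by rewrite scalemxAl.
Qed.

Lemma co_mulmx p v (A : 'M[C]_n) :
  co p (v *m A) = \sum_q co q v * co p (dir q *m A).
Proof. by rewrite mulmx_dir co_sum; apply: eq_bigr => q _; rewrite coZ. Qed.

Definition mxbound (A : 'M[C]_n) : R := \sum_q cnorm (dir q *m A) + 1.

Lemma mxbound_gt0 A : 0 < mxbound A.
Proof. by rewrite ltr_wpDl// sumr_ge0// => q _; exact: cnorm_ge0. Qed.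

Lemma cnorm_mulmx v (A : 'M[C]_n) : cnorm (v *m A) <= mxbound A * cnorm v.
Proof.
rewrite mulmx_dir mulrDl mul1r.
apply: (@le_trans _ _ (\sum_q cnorm (dir q *m A) * cnorm v)); last first.
  by rewrite -mulr_suml lerDl cnorm_ge0.
elim/big_rec2: _ => [|q y w _ h]; first by rewrite cnorm0.
rewrite (le_trans (cnormD _ _))// lerD// cnormZ mulrC ler_wpM2l ?cnorm_ge0//.
exact: co_le_cnorm.
Qed.

Lemma mulmxr_continuous (A : 'M[C]_n) : continuous (mulmxr A : V -> V).
Proof.
move=> z B /nbhs_cnorm[r r0 rB]; apply/nbhs_cnorm.
exists (r / mxbound A); first by rewrite divr_gt0// mxbound_gt0.
move=> w wz; apply: rB; rewrite /= -mulmxBl (le_lt_trans (cnorm_mulmx _ _))//.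
by rewrite mulrC -ltr_pdivlMr// mxbound_gt0.
Qed.

(** The same characterization for maps of C^n, with the real norm [cnorm] and
    with the differential read as a matrix acting on rows. *)
Lemma differentiable_cnorm (f : V -> V) z (A : 'M[C]_n) :
  (forall e : R, 0 < e -> \forall w \near z,
    cnorm (f w - f z - (w - z) *m A) <= e * cnorm (w - z)) ->
  differentiable f z /\ 'J f z = A.
Proof.
move=> H.
have [] := @differentiable_of_linear C V V f (mulmxr A) z (@mulmxr_continuous A).
  move=> e e0.
  have [ee re0] := ltc_real e0.
  pose m : R := #|{: 'I_n * bool}|%:R + 1.
  have m0 : 0 < m by rewrite ltr_wpDl.
  have /nbhs_cnorm[r r0 hr] := H _ (divr_gt0 re0 m0).
  apply/nbhs_cnorm; exists r => // w; rewrite subr0 => wr.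
  have := hr (w + z); rewrite addrK => /(_ wr) h /=.
  apply: le_trans (mx_norm_le_cnorm _) _.
  apply: (@le_trans _ _ ((complex.Re e / m) * cnorm w)%:C); first by rewrite lecR.
  rewrite rmorphM /=.
  apply: (@le_trans _ _ ((complex.Re e / m)%:C * (#|{: 'I_n * bool}|%:R * `|w|))).
    by rewrite ler_wpM2l ?cnorm_le_mx_norm// ler0c divr_ge0 ?ltW.
  rewrite mulrA ler_wpM2r// ee /=.
  have -> : #|{: 'I_n * bool}|%:R = (#|{: 'I_n * bool}|%:R : R)%:C :> C.
    by rewrite rmorph_nat.
  rewrite -rmorphM lecR mulrAC ler_pdivrMr// ler_wpM2l ?(ltW re0)//.
  by rewrite lerDl.
move=> df D; split => //.
apply/row_matrixP => i; rewrite /jacobian rowE mul_rV_lin1.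
by rewrite [LHS](congr1 (fun G => G (delta_mx 0 i)) D) /= -rowE.
Qed.

Lemma differentiable_jacobian (f : V -> V) z : differentiable f z ->
  forall e : R, 0 < e -> \forall w \near z,
    cnorm (f w - f z - (w - z) *m 'J f z) <= e * cnorm (w - z).
Proof.
move=> /differentiable_near H e e0.
pose m : R := #|{: 'I_n * bool}|%:R + 1.
have m0 : 0 < m by rewrite ltr_wpDl.
have e'0 : 0 < (e / m)%:C by rewrite ltcR divr_gt0.
have /nbhs_cnorm[r r0 hr] := H _ e'0.
apply/nbhs_cnorm; exists r => // w wr.
have := hr (w - z); rewrite subr0 => /(_ wr) /= h.
rewrite subrK -[X in _ - _ - X]mul_rV_lin1 -/('J f z) in h.
rewrite -lecR (le_trans (cnorm_le_mx_norm _))//.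
apply: (@le_trans _ _ (#|{: 'I_n * bool}|%:R * ((e / m)%:C * `|w - z|))).
  by rewrite ler_wpM2l.
apply: (@le_trans _ _ (#|{: 'I_n * bool}|%:R * ((e / m)%:C * (cnorm (w - z))%:C))).
  by rewrite !ler_wpM2l ?mx_norm_le_cnorm// ltW.
have -> : #|{: 'I_n * bool}|%:R = (#|{: 'I_n * bool}|%:R : R)%:C :> C.
  by rewrite rmorph_nat.
rewrite -!rmorphM lecR mulrA ler_wpM2r ?cnorm_ge0// mulrA ler_pdivrMr//.
by rewrite mulrC ler_wpM2l ?(ltW e0)// lerDl.
Qed.

Lemma differentiable_frechet (f : V -> V) z p : differentiable f z ->
  frechet (co p \o f) z (fun q => co p (dir q *m 'J f z)).
Proof.
move=> /differentiable_jacobian H e /H; apply: filterS => w h /=.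
have -> : \sum_q co p (dir q *m 'J f z) * co q (w - z) = co p ((w - z) *m 'J f z).
  by rewrite co_mulmx; apply: eq_bigr => q _; rewrite mulrC.
by rewrite -!coB (le_trans (co_le_cnorm _ _)).
Qed.

Lemma vderive_comp (f : V -> V) (c : R -> V) t v : differentiable f (c t) ->
  vderive c t v -> vderive (f \o c) t (v *m 'J f (c t)).
Proof.
move=> df dc p; apply: (is_derive_eq (frechet_chain (differentiable_frechet p df) dc)).
rewrite co_mulmx; apply: eq_bigr => q _.
by rewrite mulrC.
Qed.

Lemma vderive_near (c c' : R -> V) t v : (\forall s \near t, c s = c' s) ->
  vderive c t v -> vderive c' t v.
Proof.
move=> h dc p; apply: is_derive_near (dc p).
by apply: filterS h => s /= ->.
Qed.

Lemma vderive_unique (c : R -> V) t v v' : vderive c t v -> vderive c t v' -> v = v'.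
Proof.
by move=> h h'; apply: coP => p; rewrite -(is_derive_derive1 (h p)) (is_derive_derive1 (h' p)).
Qed.

End ComplexDifferentiability.

(** * Cauchy-Riemann equations and the holomorphic chain rule *)

#[local] Opaque pd.

Section ChartCalculus.
Context {R : realType} {n : nat}.
Local Notation V := 'rV[R[i]]_n.
Local Notation C := R[i].
Implicit Types (v w z h : V) (p q : 'I_n * bool) (U : set V).

Lemma wd_realE U (u : V -> R) s a z : smooth_on U u -> U z ->
  wd s a (fun w => (u w)%:C) z = wdc s (fun p => (pd p u z)%:C) a.
Proof.
move=> hu Uz; apply: is_wd => p; apply: is_cpd_real.
exact: (Ck_is_pd p (hu 1%N)).
Qed.

Lemma half_inv : (2^-1 : C) = (2^-1 : R)%:C.
Proof.
by rewrite [RHS]fmorphV; congr (_^-1); rewrite [RHS]rmorph_nat.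
Qed.

(** d u (v) = du/dz^a v^a + conj (du/dz^a v^a), for real u. *)
Lemma real_differential U (u : V -> R) z v : smooth_on U u -> U z ->
  \sum_q pd q u z * co q v =
  2 * complex.Re (\sum_a wd false a (fun w => (u w)%:C) z * v 0 a).
Proof.
move=> hu Uz; rewrite sum_re_im raddf_sum mulr_sumr; apply: eq_bigr => a _.
rewrite (wd_realE _ _ hu Uz) /wdc half_inv /co.
move: (pd (a, false) u z) (pd (a, true) u z) => d1 d2.
by case: (v 0 a) => x y /=; field.
Qed.

(** A C^1 function is real differentiable; the Cauchy-Riemann equations say
    that its real differential is the complex linear map with matrix d f^a / d
    z^b. *)
Lemma cauchy_riemann (U : set V) (f : V -> V) z : open U ->
  (forall a, csmooth_on U (fun w => f w 0 a)) ->
  (forall a b, wd true b (fun w => f w 0 a) z = 0) -> U z -> differentiable f z.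
Proof.
move=> oU hf CR Uz.
pose A : 'M[C]_n := \matrix_(b, a) cpd (b, false) (fun w => f w 0 a) z.
have CR' a b : cpd (b, true) (fun w => f w 0 a) z = 'i%C * A b a.
  have := CR a b; rewrite wdE /wdc => /eqP; rewrite mulf_eq0 invr_eq0 pnatr_eq0 /=.
  rewrite mxE => /eqP E.
  apply: (mulfI (neq0Ci C)); rewrite -complexiE mulrA -expr2 sqr_i mulN1r.
  by apply/eqP; rewrite -addr_eq0 addrC E.
suff [] : differentiable f z /\ 'J f z = A by [].
apply: differentiable_cnorm => e e0.
have fr p : frechet (co p \o f) z (fun q => pd q (co p \o f) z).
  have [h1 h2] := hf p.1.
  apply: (Ck1_frechet oU _ Uz); rewrite /comp /co.
  by case: p.2; [exact: h2|exact: h1].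
pose m : R := #|{: 'I_n * bool}|%:R + 1.
have m0 : 0 < m by rewrite ltr_wpDl.
have e'0 : 0 < e / m by rewrite divr_gt0.
have E p h : co p (h *m A) = \sum_q pd q (co p \o f) z * co q h.
  case: p => a s.
  have -> : co (a, s) (h *m A) = \sum_b (if s then complex.Im (h 0 b * A b a)
      else complex.Re (h 0 b * A b a)).
    by rewrite /co /= mxE; case: s; exact: raddf_sum.
  rewrite sum_re_im; apply: eq_bigr => b _.
  have := CR' a b; have : A b a = cpd (b, false) (fun w => f w 0 a) z by rewrite mxE.
  rewrite !cpdE => ->; rewrite /co /= => -[].
  case: s => /=.
    rewrite -[(fun v => complex.Im (v 0 a)) \o f]/(im (fun w => f w 0 a)).
    by move=> _ ->; case: (h 0 b) => x y /=; ring.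
  rewrite -[(fun v => complex.Re (v 0 a)) \o f]/(re (fun w => f w 0 a)).
  by move=> -> _; case: (h 0 b) => x y /=; ring.
have H : \forall w \near z, forall p, `|co p (f w) - co p (f z) -
    \sum_q pd q (co p \o f) z * co q (w - z)| <= e / m * cnorm (w - z).
  by apply: near_forall => p; exact: fr p _ e'0.
apply: filterS H => w hw.
apply: (@le_trans _ _ (\sum_(p : 'I_n * bool) e / m * cnorm (w - z))).
  by apply: ler_sum => p _; rewrite !coB E.
rewrite sumr_const -mulr_natl mulrA ler_wpM2r ?cnorm_ge0//.
by rewrite mulrCA ler_piMr ?(ltW e0)// ler_pdivrMr// mul1r lerDl.
Qed.

(** The chain rule for Wirtinger derivatives, at the level of coefficients:
    precomposing a real linear form with the complex linear map J acts by J on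
    the coefficients of type (1,0), and by conj J on those of type (0,1). *)
Lemma wdc_chain (s : bool) (D : 'I_n * bool -> R) (J : 'M[C]_n) b :
  wdc s (fun p => (\sum_q D q * co q (dir p *m J))%:C) b =
  \sum_a (if s then (J b a)^* else J b a) * wdc s (fun p => (D p)%:C) a.
Proof.
have E1 : dir (b, false) *m J = row b J by rewrite dir_re rowE.
have E2 : dir (b, true) *m J = 'i%C *: row b J by rewrite dir_im -scalemxAl rowE.
rewrite /wdc E1 E2 !sum_re_im !rmorph_sum /= mulr_sumr -big_split mulr_sumr /=.
apply: eq_bigr => a _; rewrite half_inv /co !mxE.
by case: (J b a) => x y; case: s; apply/eqP; rewrite eq_complex /=;
  apply/andP; split; apply/eqP; field.
Qed.

(** As the map is holomorphic, the chain rule does not mix the types. *)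
Lemma wd_chain (U U' : set V) (f : V -> V) (u : V -> R) s b z : open U' ->
  smooth_on U' u -> U' (f z) -> differentiable f z ->
  smooth_on U (u \o f) -> U z ->
  wd s b (fun w => (u (f w))%:C) z =
  \sum_a (if s then ('J f z b a)^* else 'J f z b a) *
    wd s a (fun w => (u w)%:C) (f z).
Proof.
move=> oU' hu Ufz df huf Uz.
have h p : pd p (u \o f) z = \sum_q pd q u (f z) * co q (dir p *m 'J f z).
  apply: is_pd_eq.
  have fr := Ck1_frechet oU' (hu 1%N) Ufz.
  have z0 : z + (0 : R)%:C *: dir p = z by rewrite scale0r addr0.
  have dc : vderive (f \o (fun t : R => z + t%:C *: dir p)) 0 (dir p *m 'J f z).
    by rewrite -[in 'J f z]z0; apply: vderive_comp; rewrite ?z0//; exact: vderive_line.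
  apply: (frechet_chain (c := f \o (fun t : R => z + t%:C *: dir p))) dc.
  by rewrite /= z0.
rewrite (wd_realE _ _ huf Uz).
under [RHS]eq_bigr do rewrite (wd_realE _ _ hu Ufz).
rewrite -wdc_chain; congr wdc; apply/funext => p; congr (_%:C); exact: h.
Qed.

(** On a small ball the partial derivatives are bounded; the mean value
    theorem along the segment gives the Lipschitz constant. *)
Lemma local_lipschitz (U : set V) (F : V -> V) z : open U ->
  (forall a, csmooth_on U (fun w => F w 0 a)) -> U z ->
  exists r L M : R, [/\ 0 < r, 0 < L, 0 < M,
    forall w, cnorm (w - z) < r -> U w /\ cnorm (F w) <= M &
    forall w w', cnorm (w - z) < r -> cnorm (w' - z) < r ->
      cnorm (F w - F w') <= L * cnorm (w - w')].
Proof.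
move=> oU hF Uz.
have hu p k : Ck k U (co p \o F).
  have [h1 h2] := hF p.1; rewrite /comp /co.
  by case: p.2; [exact: h2|exact: h1].
have H1 : \forall w \near z, forall q, forall p, `|pd p (co q \o F) w - pd p (co q \o F) z| < 1.
  apply: near_forall => q; apply: near_forall => p.
  exact: (continuousR_cnorm _ _).1 (Ck_cont (Ck_pd p (hu q 1%N)) Uz) 1 ltr01.
have H2 : \forall w \near z, forall q, `|co q (F w) - co q (F z)| < 1.
  apply: near_forall => q.
  exact: (continuousR_cnorm (co q \o F) z).1 (Ck_cont (hu q 0%N) Uz) 1 ltr01.
have /nbhs_cnorm[r r0 hr] : \forall w \near z, [/\ U w,
    forall q, forall p, `|pd p (co q \o F) w - pd p (co q \o F) z| < 1 &
    forall q, `|co q (F w) - co q (F z)| < 1].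
  by apply: filterS3 (open_nbhs_nbhs (conj oU Uz)) H1 H2 => w; split.
pose B : R := \sum_q \sum_p (`|pd p (co q \o F) z| + 1) + 1.
have B0 : 0 < B.
  by rewrite ltr_wpDl// sumr_ge0// => q _; rewrite sumr_ge0// => p _; rewrite addr_ge0.
pose m : R := #|{: 'I_n * bool}|%:R + 1.
have m0 : 0 < m by rewrite ltr_wpDl.
have dB q p w : cnorm (w - z) < r -> `|pd p (co q \o F) w| <= B.
  move=> /hr[_ /(_ q p) h _].
  apply: (@le_trans _ _ (`|pd p (co q \o F) z| + 1)).
    rewrite -[X in `|X| <= _](subrK (pd p (co q \o F) z)) (le_trans (ler_normD _ _))//.
    by rewrite addrC lerD2l ltW.
  have nn q' : 0 <= \sum_p (`|pd p (co q' \o F) z| + 1).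
    by rewrite sumr_ge0// => p' _; rewrite addr_ge0.
  apply: (@le_trans _ _ (\sum_p (`|pd p (co q \o F) z| + 1))).
    rewrite [leRHS](bigD1 p) //= lerDl.
    by apply: sumr_ge0 => p' _; exact: addr_ge0.
  rewrite /B [X in _ <= X + 1](bigD1 q) //= -[leRHS]addrA lerDl addr_ge0//.
  by apply: sumr_ge0 => q' _; exact: nn.
exists r, (m * B), (cnorm (F z) + m); split => //.
- by rewrite mulr_gt0.
- by rewrite ltr_wpDl// cnorm_ge0.
- move=> w /hr[Uw _ h]; split => //.
  rewrite -[F w](subrK (F z)) (le_trans (cnormD _ _))// addrC lerD2l.
  apply: (@le_trans _ _ (\sum_(p : 'I_n * bool) 1)).
    by apply: ler_sum => p _; rewrite coB ltW.
  by rewrite sumr_const lerDl.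
move=> w w' wr wr'.
have seg (t : R) : 0 <= t <= 1 -> cnorm (w' + t%:C *: (w - w') - z) < r.
  move=> /andP[t0 t1].
  have -> : w' + t%:C *: (w - w') - z = (1 - t)%:C *: (w' - z) + t%:C *: (w - z).
    apply: coP => p; rewrite !(coD, coN, coZ); ring.
  rewrite (le_lt_trans (cnormD _ _))// !cnormZ !ger0_norm ?subr_ge0//.
  have [t0'|t0'] := eqVneq t 0; first by rewrite t0' mul0r addr0 subr0 mul1r.
  have tp : 0 < t by rewrite lt_neqAle eq_sym t0'.
  have -> : r = (1 - t) * r + t * r by ring.
  by rewrite ler_ltD ?ler_wpM2l ?subr_ge0 ?(ltW wr')// ltr_pM2l.
have comp p : `|co p (F w) - co p (F w')| <= B * cnorm (w - w').
  pose g (t : R) := co p (F (w' + t%:C *: (w - w'))).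
  have dg (t : R) : Num.min 0 1 <= t <= Num.max 0 1 ->
     is_derive t 1 g (\sum_q pd q (co p \o F) (w' + t%:C *: (w - w')) * co q (w - w')).
    rewrite min_l ?max_r// => ht; have /hr[Ux _ _] := seg t ht.
    apply: (frechet_chain (u := co p \o F) (c := fun t : R => w' + t%:C *: (w - w'))).
      exact: (Ck1_frechet oU (hu p 1%N) Ux).
    exact: vderive_line.
  have := is_derive_bound dg (K := B * cnorm (w - w')).
  rewrite subr0 normr1 mulr1 /g scale0r addr0 scale1r [w' + _]addrC subrK.
  apply=> t; rewrite min_l ?max_r// => ht.
  apply: (le_trans (ler_norm_sum _ _ _)); rewrite /cnorm mulr_sumr.
  by apply: ler_sum => q _; rewrite normrM ler_wpM2r// dB// seg.
apply: (@le_trans _ _ (\sum_(p : 'I_n * bool) B * cnorm (w - w'))).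
  by apply: ler_sum => p _; rewrite coB.
rewrite sumr_const -mulr_natl mulrA ler_wpM2r ?cnorm_ge0// ler_wpM2r ?(ltW B0)//.
by rewrite lerDl.
Qed.

End ChartCalculus.

(** * The vector field on the manifold *)

Section ChartGeometry.
Context {R : realType} {n : nat} (X : complexManifold R n).
Local Notation V := 'rV[R[i]]_n.
Local Notation C := R[i].
Implicit Types (i j : chart_index X) (x : X) (z : V).

Lemma chart_img_openP i : open (chart_img i).
Proof. exact: chart_img_open. Qed.

Lemma chart_imgP i x : chart_dom X i x -> chart_img i (chart_map X i x).
Proof. by move=> xi; exists x. Qed.

Lemma chart_invK i z : chart_img i z -> chart_map X i (chart_inv X i z) = z.
Proof. by move=> [x xi <-]; rewrite chart_mapK. Qed.

Lemma chart_inv_dom i z : chart_img i z -> chart_dom X i (chart_inv X i z).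
Proof. by move=> [x xi <-]; rewrite chart_mapK. Qed.

Lemma overlap_img i j z : overlap i j z -> chart_img i z.
Proof. by move=> [x [xi xj] <-]; exists x. Qed.

Lemma overlap_transition i j z : overlap i j z -> chart_img j (transition i j z).
Proof.
by move=> [x [xi xj] <-]; rewrite /transition /= chart_mapK//; exact: chart_imgP.
Qed.

Lemma overlapP i j z : overlap i j z <-> chart_img i z /\ chart_dom X j (chart_inv X i z).
Proof.
split=> [[x [xi xj] <-]|[zi zj]]; first by rewrite chart_mapK//; split => //; exists x.
by exists (chart_inv X i z); [split => //; exact: chart_inv_dom|exact: chart_invK].
Qed.

Lemma overlap_map i j x : chart_dom X i x -> chart_dom X j x ->
  overlap i j (chart_map X i x).
Proof. by move=> xi xj; exists x. Qed.

Lemma overlap_open i j : open (overlap i j).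
Proof.
rewrite openE => z /overlapP[zi zj].
have n1 : nbhs z (chart_img i).
  by apply: open_nbhs_nbhs; split => //; exact: chart_img_openP.
have n2 : nbhs z (fun y => chart_dom X j (chart_inv X i y)).
  apply: (chart_inv_continuous zi).
  by apply: open_nbhs_nbhs; split => //; exact: chart_dom_open.
by apply: filterS2 n1 n2 => y yi yj; apply/overlapP.
Qed.

Lemma transition_inv i j z : overlap i j z ->
  chart_inv X j (transition i j z) = chart_inv X i z.
Proof. by move=> [x [xi xj] <-]; rewrite /transition /= !chart_mapK. Qed.

Lemma smooth_sub (U U' : set V) (u : V -> R) : (forall z, U z -> U' z) ->
  smooth_on U' u -> smooth_on U u.
Proof.
move=> UU' h k; move: u {h}(h k); elim: k => [|k IH] u [hc hd].
  by split => // z /UU'/hc.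
split => [z /UU'/hc//|a b]; have [h1 h2] := hd a b.
by split => [z /UU'/h1//|]; exact: IH.
Qed.

End ChartGeometry.

Arguments chart_img_openP {R n X} i.
Arguments overlap_open {R n X} i j.

Section PotentialGeometry.
Variables (R : realType) (n : nat) (X : complexManifold R n) (w : kahlerMetric X).
Local Notation V := 'rV[R[i]]_n.
Local Notation C := R[i].
Hypothesis w_einstein : kahler_einstein w (- (n.+1)%:R).
Variables (phi : X -> R) (phi_smooth : smooth_function phi).
Hypothesis phi_potential : forall i z, chart_img i z ->
  i_ddbar (local_rep phi i) z = (n.+1)%:R *: metric w i z.
Hypothesis phi_norm : forall i z, chart_img i z -> norm_del w phi i z = (n.+1)%:R.
Implicit Types (i j : chart_index X) (x : X) (z : V).

Local Notation u i := (phi \o chart_inv X i).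
Local Notation U i := (chart_img i).
Local Notation g i := (metric w i).
Local Notation c := (n.+1%:R : C).

Lemma pot_ddbar i z : U i z -> forall a b,
  wd false a (wd true b (fun z => (u i z)%:C)) z = c * g i z a b.
Proof.
move=> Uz a b; have := congr1 (fun M : 'M[C]_n => M a b) (phi_potential Uz).
by rewrite !mxE dzE => <-.
Qed.

Lemma einstein_ddbar i z : U i z -> forall a b,
  wd false a (wd true b (fun z => (ln (complex.Re (\det (g i z))))%:C)) z =
  c * g i z a b.
Proof.
move=> Uz a b; have := congr1 (fun M : 'M[C]_n => M a b) (w_einstein Uz).
rewrite !mxE dzE => h; apply: oppr_inj; rewrite -[RHS]mulNr.
apply: etrans h _; congr (_ * _).
by rewrite [LHS]rmorphN; congr (- _); exact: rmorph_nat.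
Qed.

Lemma norm_del_wd i z : U i z ->
  Num.sqrt (complex.Re (\sum_(a < n) \sum_(b < n)
    wd false a (fun z => (u i z)%:C) z * wd true b (fun z => (u i z)%:C) z
    * invmx (g i z) b a)) = n.+1%:R.
Proof.
move=> Uz; rewrite -(phi_norm Uz) /norm_del; congr (Num.sqrt (complex.Re _)).
by apply: eq_bigr => a _; apply: eq_bigr => b _; rewrite dzE.
Qed.

Lemma metric_closed_wd i z : U i z -> forall a b e,
  wd true e (fun z => g i z a b) z = wd true b (fun z => g i z a e) z.
Proof.
by move=> Uz a b e; have [_ /eqP] := metric_closed w Uz a b e; rewrite subr_eq0 => /eqP.
Qed.

Definition flow_field : components X := fun i z =>
  ('i%C * (expR (phi (chart_inv X i z) / (n.+1)%:R))%:C) *: grad w phi i z.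

Lemma gradE i z : grad w phi i z = \row_a grad_comp (g i) (u i) a z.
Proof. by apply/rowP => a; rewrite !mxE. Qed.

Lemma flow_fieldE i z a : flow_field i z 0 a =
  'i%C * ((expR (u i z / n.+1%:R))%:C * grad_comp (g i) (u i) a z).
Proof. by rewrite /flow_field gradE !mxE mulrA. Qed.

Lemma flow_field_smooth i a : csmooth_on (U i) (fun z => flow_field i z 0 a).
Proof.
have oU := chart_img_openP i.
have h := csm_exp_grad oU (@metric_smooth _ _ _ w i) (@metric_hermitian _ _ _ w i)
  (@metric_posdef _ _ _ w i) (phi_smooth i) a.
apply: (csm_ext oU _ (csmM oU (csm_cst oU 'i%C) h)) => z _.
by rewrite flow_fieldE.
Qed.

Lemma flow_field_CR i z a b : U i z -> wd true b (fun z => flow_field i z 0 a) z = 0.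
Proof.
move=> Uz; have oU := chart_img_openP i.
have hs := csm_exp_grad oU (@metric_smooth _ _ _ w i) (@metric_hermitian _ _ _ w i)
  (@metric_posdef _ _ _ w i) (phi_smooth i) a.
have h := exp_grad_holomorphic oU (@metric_smooth _ _ _ w i)
  (@metric_hermitian _ _ _ w i) (@metric_posdef _ _ _ w i) (@metric_closed_wd i)
  (phi_smooth i) (@pot_ddbar i) (@einstein_ddbar i) (@norm_del_wd i) a b Uz.
have E : (fun z => flow_field i z 0 a) = (fun z => 'i%C *
  ((expR (u i z / n.+1%:R))%:C * grad_comp (g i) (u i) a z)).
  by apply/funext => y; rewrite flow_fieldE.
rewrite E (wdZ oU Uz true b 'i%C hs).
by apply: etrans (congr1 (fun t => 'i%C * t) h) (mulr0 _).
Qed.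

Lemma flow_field_differentiable i z : U i z -> differentiable (flow_field i) z.
Proof.
move=> Uz; apply: (cauchy_riemann (chart_img_openP i) _ _ Uz).
  exact: flow_field_smooth.
by move=> a b; exact: flow_field_CR.
Qed.

Lemma grad_lower_chart i z : U i z ->
  grad w phi i z *m g i z = \row_b cograd (u i) b z.
Proof.
move=> Uz; rewrite gradE; apply: (grad_lower _ _ _ Uz).
  exact: metric_hermitian.
exact: metric_posdef.
Qed.

Lemma metric_pdef i z : U i z -> pdef (g i z).
Proof.
by apply: hermitian_pdef; [exact: metric_hermitian|exact: metric_posdef].
Qed.

(** The differential of phi is the same in both charts; its part of type (0,1)
    transforms by the conjugate Jacobian matrix. *)
Lemma cograd_transition i j z : overlap i j z ->
  (\row_b cograd (u i) b z) = (\row_b cograd (u j) b (transition i j z)) *m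
    (map_mx (fun t => t^*) ('J (transition i j) z))^T.
Proof.
move=> zo; have df := transition_holomorphic zo.
have oo := overlap_open i j.
apply/rowP => b; rewrite !mxE.
have su : smooth_on (overlap i j) (u i).
  by apply: smooth_sub (phi_smooth i) => y; exact: overlap_img.
have E y : overlap i j y -> (u i y)%:C = (u j (transition i j y))%:C.
  by move=> yo; rewrite /= transition_inv.
have sc : smooth_on (overlap i j) (u j \o transition i j).
  by apply: (smooth_ext oo _ su) => y yo; rewrite /= transition_inv.
transitivity (wd true b (fun y => (u j (transition i j y))%:C) z).
  by apply: (wd_ext oo zo true b E); exact: (csm_real oo).
rewrite (wd_chain true b (chart_img_openP j) (phi_smooth j)
  (overlap_transition zo) df sc zo).
by apply: eq_bigr => a _; rewrite !mxE mulrC.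
Qed.

(** Compare, after lowering the index with the metric and using its
    invariance: the assertion becomes the transformation law of the part of
    type (0,1) of the differential. *)
Lemma grad_transition i j z : overlap i j z ->
  grad w phi j (transition i j z) = grad w phi i z *m 'J (transition i j) z.
Proof.
move=> zo; set J := 'J _ _; set Jc := (map_mx (fun t => t^*) J)^T.
have mt := metric_transform w zo; rewrite -/J -/Jc in mt.
have Ui := overlap_img zo; have Uj := overlap_transition zo.
have gi := pdef_unit (metric_pdef Ui); have gj := pdef_unit (metric_pdef Uj).
have Jcu : Jc \in unitmx by move: gi; rewrite mt unitmx_mul => /andP[].
apply: (can_inj (mulmxK gj)); rewrite (grad_lower_chart Uj).
apply: (can_inj (mulmxK Jcu)); rewrite -(cograd_transition zo) -(grad_lower_chart Ui) mt.
by rewrite !mulmxA.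
Qed.

Lemma flow_field_holomorphic : holomorphic_vector_field flow_field.
Proof.
split=> [i j z zo|i z]; last exact: flow_field_differentiable.
by rewrite /flow_field (transition_inv zo) (grad_transition zo) scalemxAl.
Qed.

End PotentialGeometry.

(** * Ordinary differential equations with Lipschitz right-hand side *)

Section Primitive.
Context {R : realType}.
Local Notation mu := (@lebesgue_measure R).

Lemma continuous_primitive (f : R -> R) (A : R) : continuous f ->
  exists2 G : R -> R, G 0 = 0 & forall t : R, `|t| < A -> is_derive t 1 G (f t).
Proof.
move=> cf; pose F (x : R) : R := (\int[mu]_(t in `[(- A), x]) f t)%R.
exists (fun x => F x - F 0); first by rewrite subrr.
move=> t; rewrite ltr_norml => /andP[tA1 tA2].
have fi : mu.-integrable `[(- A), (t + 1)%R] (EFin \o f).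
  apply: continuous_compact_integrable; first exact: segment_compact.
  exact: continuous_subspaceT.
have tt : t < t + 1 by rewrite ltrDl.
have [dF F'] := continuous_FTC1_closed tt fi tA1 (cf t).
have h : is_derive t 1 F (f t) by rewrite -F'; exact: derivable_is_derive.
apply/is_deriveP => e e0; have /is_deriveP/(_ e e0) := h.
apply: filterS => s; rewrite /F.
by rewrite opprB addrA subrK.
Qed.

(** The sequences u k -+ 2 K / 2^k are monotone and bound each other, hence
    have a common limit. *)
Lemma geometric_limit (u : nat -> R) (K : R) :
  (forall k, `|u k.+1 - u k| <= K / 2 ^+ k) ->
  exists l, forall k, `|l - u k| <= 2 * K / 2 ^+ k.
Proof.
move=> h; pose a k := u k - 2 * K / 2 ^+ k; pose b k := u k + 2 * K / 2 ^+ k.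
have half k : 2 * K / 2 ^+ k.+1 = K / 2 ^+ k.
  by rewrite exprS; field; rewrite expf_neq0.
have K0 k : 0 <= K / 2 ^+ k := le_trans (normr_ge0 _) (h k).
have dbl k : 2 * K / 2 ^+ k = K / 2 ^+ k + K / 2 ^+ k by ring.
have aS k : a k <= a k.+1.
  rewrite /a half dbl; have := h k; rewrite ler_norml => /andP[h1 _]; lra.
have bS k : b k.+1 <= b k.
  rewrite /b half dbl; have := h k; rewrite ler_norml => /andP[_ h1]; lra.
have am j k : (j <= k)%N -> a j <= a k.
  by move=> jk; apply: (homo_leq (r := <=%R) (f := a)) => //; exact: le_trans.
have bm j k : (j <= k)%N -> b k <= b j.
  elim: k => [|k IH]; first by rewrite leqn0 => /eqP ->.
  rewrite leq_eqVlt => /orP[/eqP -> //|]; rewrite ltnS => /IH; exact: le_trans.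
have ab j k : a j <= b k.
  apply: (le_trans (am j (maxn j k) (leq_maxl _ _))).
  apply: le_trans (bm k (maxn j k) (leq_maxr _ _)).
  by rewrite /a /b; have := K0 (maxn j k); rewrite dbl; lra.
pose S := [set x | exists k, x = a k].
have hS : has_sup S by split; [exists (a 0%N), 0%N|exists (b 0%N) => x [k ->]].
exists (sup S) => k.
have l1 : a k <= sup S by apply: sup_upper_bound => //; exists k.
have l2 : sup S <= b k by apply: sup_le_ub; [case: hS|move=> x [j ->]].
rewrite ler_norml; apply/andP; split; move: l1 l2; rewrite /a /b; lra.
Qed.

Lemma pow2_small (K e : R) : 0 <= K -> 0 < e -> exists k : nat, K / 2 ^+ k < e.
Proof.
move=> K0 e0; have [k kr] : exists k : nat, K / e < k%:R.
  by exists (Num.bound (K / e)); rewrite archi_boundP// divr_ge0// ltW.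
exists k; rewrite ltr_pdivrMr ?exprn_gt0// [e * _]mulrC -ltr_pdivrMr//.
apply: (lt_le_trans kr); rewrite -natrX ler_nat; exact/ltnW/ltn_expl.
Qed.

Lemma pow2_le0 (K x : R) : 0 <= K -> (forall k : nat, x <= K / 2 ^+ k) -> x <= 0.
Proof.
move=> K0 h; apply/ler_addgt0Pr => e e0; rewrite add0r.
have [k hk] := pow2_small K0 e0; exact: le_trans (h k) (ltW hk).
Qed.

End Primitive.

Section ODE.
Context {R : realType} {n : nat}.
Local Notation V := 'rV[R[i]]_n.
Implicit Types (v w z : V) (p q : 'I_n * bool) (a b c : R -> V) (t s : R).

Let m : R := #|{: 'I_n * bool}|%:R + 1.

Let m0 : 0 < m. Proof. by rewrite ltr_wpDl. Qed.

Lemma sum_le_dim (x : 'I_n * bool -> R) (K : R) : 0 <= K ->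
  (forall p, x p <= K) -> \sum_p x p <= m * K.
Proof.
move=> K0 h; apply: (@le_trans _ _ (\sum_(p : 'I_n * bool) K)).
  by apply: ler_sum => p _.
by rewrite sumr_const -mulr_natl ler_wpM2r// lerDl.
Qed.

(** The mean value inequality for two curves which meet at time t0. *)
Lemma vderive_dist a b (da db : R -> V) (t0 t D : R) : 0 <= D -> a t0 = b t0 ->
  (forall s, `|s - t0| <= `|t - t0| -> [/\ vderive a s (da s), vderive b s (db s) &
     cnorm (da s - db s) <= D]) ->
  cnorm (a t - b t) <= m * (D * `|t - t0|).
Proof.
move=> D0 ab0 h; apply: sum_le_dim; first by rewrite mulr_ge0.
move=> p.
have btw s : Num.min t0 t <= s <= Num.max t0 t -> `|s - t0| <= `|t - t0|.
  have [h1|h1] := leP t0 t; rewrite ?(min_l h1) ?(max_r h1).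
    by move=> /andP[? ?]; rewrite !ger0_norm ?subr_ge0// lerD2r.
  move=> /andP[? ?]; rewrite !ler0_norm ?subr_le0 ?(ltW h1)//.
  by rewrite lerN2 lerD2r.
have dg s : Num.min t0 t <= s <= Num.max t0 t ->
    is_derive s 1 (fun x => co p (a x) - co p (b x)) (co p (da s) - co p (db s)).
  by move=> /btw/h[ha hb _]; apply: is_deriveB; [exact: ha|exact: hb].
have := is_derive_bound dg (K := D).
rewrite ab0 subrr subr0 coB; apply=> s /btw/h[_ _ hD].
by rewrite -coB (le_trans (co_le_cnorm _ _)).
Qed.

Lemma vderive_of_components (G : 'I_n * bool -> R -> R) z t v :
  (forall p, is_derive t 1 (G p) (co p v)) ->
  vderive (fun s => z + \sum_p (G p s)%:C *: dir p) t v.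
Proof.
move=> h p; apply/is_deriveP => e e0; have /is_deriveP/(_ e e0) := h p.
have E s : co p (z + \sum_q (G q s)%:C *: dir q) = co p z + G p s.
  rewrite coD co_sum (bigD1 p) //= coZ co_dir eqxx mulr1 big1 ?addr0//.
  by move=> q qp; rewrite coZ co_dir eq_sym (negbTE qp) mulr0.
apply: filterS => s; rewrite /comp !E.
by have -> : co p z + G p s - (co p z + G p t) = G p s - G p t by ring.
Qed.

Section Picard.
Variables (F : V -> V) (z0 : V) (r L M : R).
Hypotheses (r0 : 0 < r) (L0 : 0 < L) (M0 : 0 < M).
Hypothesis F_bound : forall w, cnorm (w - z0) < r -> cnorm (F w) <= M.
Hypothesis F_lip : forall w w', cnorm (w - z0) < r -> cnorm (w' - z0) < r ->
  cnorm (F w - F w') <= L * cnorm (w - w').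

Lemma lipschitz_continuous w : cnorm (w - z0) < r -> {for w, continuous F}.
Proof.
move=> wr A /nbhs_cnorm[e e0 eA].
apply/nbhs_cnorm; exists (Num.min (r - cnorm (w - z0)) (e / L)).
  by rewrite lt_min subr_gt0 wr divr_gt0.
move=> w'; rewrite lt_min => /andP[h1 h2]; apply: eA.
apply: (le_lt_trans (F_lip _ wr)); last by rewrite mulrC -ltr_pdivlMr.
by rewrite (le_lt_trans (cnormB _ w _))// -ltrBrDr.
Qed.

(** On a time interval of length at most 1 / (2 m L), the bound D on the
    distance of two solutions improves to D / 2; iterating, it is zero. *)
Lemma ode_unique a b t0 : a t0 = b t0 ->
  (\forall t \near t0, [/\ cnorm (a t - z0) < r, cnorm (b t - z0) < r,
     vderive a t (F (a t)) & vderive b t (F (b t))]) ->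
  \forall t \near t0, a t = b t.
Proof.
move=> ab0 /nbhs_ballP[d /= d0 hd].
pose eta := Num.min (d / 2) (1 / (2 * m * L)).
have eta0 : 0 < eta by rewrite lt_min !divr_gt0// !mulr_gt0.
have etad : eta < d.
  by rewrite gt_min ltr_pdivrMr// ltr_pMr// ltr1n.
have etaL : m * (L * eta) <= 1 / 2.
  have h : eta <= 1 / (2 * m * L) by rewrite ge_min lexx orbT.
  rewrite mulrA; apply: (@le_trans _ _ (m * L * (1 / (2 * m * L)))).
    by rewrite ler_wpM2l// ltW// mulr_gt0.
  by rewrite le_eqVlt; apply/orP; left; apply/eqP; field; rewrite !gt_eqF.
have key k t : `|t - t0| <= eta -> cnorm (a t - b t) <= (2 * r) / 2 ^+ k.
  elim: k t => [|k IH] t ht.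
    have [|h1 h2 _ _] := hd t.
      by rewrite /ball /= distrC (le_lt_trans ht).
    rewrite expr0 divr1 mulrDl mul1r (le_trans (cnormB _ z0 _))// lerD// ltW//.
    by rewrite cnormC.
  have D0 : 0 <= L * (2 * r / 2 ^+ k) by rewrite mulr_ge0 ?divr_ge0 ?mulr_ge0 ?exprn_ge0// ltW.
  apply: (le_trans (vderive_dist (da := fun s => F (a s)) (db := fun s => F (b s)) D0 ab0 _)).
    move=> s hs; have hs' : `|s - t0| <= eta by exact: le_trans hs ht.
    have [|h1 h2 h3 h4] := hd s; first by rewrite /ball /= distrC (le_lt_trans hs').
    split => //; apply: (le_trans (F_lip h1 h2)).
    by rewrite ler_wpM2l ?(ltW L0)// IH.
  have K0 : 0 <= 2 * r / 2 ^+ k by rewrite divr_ge0 ?exprn_ge0// mulr_ge0// ltW.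
  apply: (@le_trans _ _ (m * (L * eta) * (2 * r / 2 ^+ k))).
    have -> : m * (L * eta) * (2 * r / 2 ^+ k) = m * (L * (2 * r / 2 ^+ k) * eta).
      by rewrite -!mulrA; congr (_ * (_ * _)); rewrite mulrC -!mulrA.
    by rewrite ler_wpM2l ?(ltW m0)// ler_wpM2l// mulr_ge0// ltW.
  apply: (@le_trans _ _ (1 / 2 * (2 * r / 2 ^+ k))).
    by rewrite ler_wpM2r.
  by rewrite exprS le_eqVlt; apply/orP; left; apply/eqP; field; rewrite expf_neq0.
apply/nbhs_ballP; exists eta => //= t; rewrite /ball /= distrC => ht.
have ht' := ltW ht; apply/eqP; rewrite -subr_eq0; apply/eqP/cnorm_eq0.
apply/eqP; rewrite eq_le cnorm_ge0 andbT; apply/(@pow2_le0 _ (2 * r)).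
  by rewrite mulr_ge0// ltW.
by move=> k; exact: key.
Qed.

Section Existence.
Variable z : V.
Hypothesis zr : cnorm (z - z0) < r / 2.

(** Up to the first bound the Picard iterates stay within r / 4 of their
    starting point, since |F| <= M; up to the second one the Picard operator
    halves distances. The factor m passes from coordinates to the norm. *)
Definition picard_time : R := Num.min (r / (4 * m * M)) (1 / (2 * m * L)).
Local Notation eps := picard_time.

Lemma picard_time_gt0 : 0 < eps.
Proof. by rewrite lt_min !divr_gt0// !mulr_gt0. Qed.

Let epsM : m * (M * eps) <= r / 4.
Proof.
have h : eps <= r / (4 * m * M) by rewrite ge_min lexx.
rewrite mulrA; apply: (@le_trans _ _ (m * M * (r / (4 * m * M)))).
  by rewrite ler_wpM2l// ltW// mulr_gt0.
by rewrite le_eqVlt; apply/orP; left; apply/eqP; field; rewrite !gt_eqF.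
Qed.

Let epsL : m * (L * eps) <= 1 / 2.
Proof.
have h : eps <= 1 / (2 * m * L) by rewrite ge_min lexx orbT.
rewrite mulrA; apply: (@le_trans _ _ (m * L * (1 / (2 * m * L)))).
  by rewrite ler_wpM2l// ltW// mulr_gt0.
by rewrite le_eqVlt; apply/orP; left; apply/eqP; field; rewrite !gt_eqF.
Qed.

(* Primitives are taken of functions which are continuous on the whole line,
   while the iterates are controlled for |t| <= eps only; hence the truncation
   of the time. *)
Let clamp t : R := Num.max (- eps) (Num.min eps t).

Let clamp_le t : `|clamp t| <= eps.
Proof.
have e0 := picard_time_gt0; rewrite /clamp ler_norml le_max lexx /=.
by rewrite ge_max ge_min lexx /= andbT; lra.
Qed.

Let clamp_id t : `|t| <= eps -> clamp t = t.
Proof. by rewrite ler_norml => /andP[h1 h2]; rewrite /clamp min_r// max_r. Qed.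

Let clamp_continuous : continuous clamp.
Proof.
move=> t; apply: (@continuous_max _ _ (cst (- eps)) (fun s => Num.min eps s)).
  exact: cst_continuous.
by apply: (@continuous_min _ _ (cst eps) id); [exact: cst_continuous|exact: cvg_id].
Qed.

Let good c := forall t, `|t| <= eps ->
  cnorm (c t - z) <= r / 4 /\ {for t, continuous c}.

Let good_ball c t : good c -> `|t| <= eps -> cnorm (c t - z0) < r.
Proof.
move=> gc /gc[h _]; apply: (le_lt_trans (cnormB _ z _)); have := zr; have := r0; lra.
Qed.

Let picard_step c : good c -> exists c', [/\ c' 0 = z, good c' &
  forall t, `|t| <= eps -> vderive c' t (F (c t))].
Proof.
move=> gc; have e0 := picard_time_gt0.
have cf p : continuous (fun t => co p (F (c (clamp t)))).
  move=> t; apply: (@continuous_comp _ _ _ clamp (fun s => co p (F (c s)))).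
    exact: clamp_continuous.
  apply: (@continuous_comp _ _ _ c (fun v => co p (F v))).
    by have [] := gc _ (clamp_le t).
  apply: (@continuous_comp _ _ _ F (co p)); last exact: co_continuous.
  apply: lipschitz_continuous; exact: good_ball.
have A0 : 0 < 2 * eps by rewrite mulr_gt0.
have /choice[G hG] : forall p, exists G : R -> R, G 0 = 0 /\
    forall t, `|t| < 2 * eps -> is_derive t 1 G (co p (F (c (clamp t)))).
  by move=> p; have [G ? ?] := continuous_primitive (2 * eps) (cf p); exists G.
pose c' t := z + \sum_p (G p t)%:C *: dir p.
have lt2 t : `|t| <= eps -> `|t| < 2 * eps by move=> h; apply: (le_lt_trans h); lra.
have dc t : `|t| <= eps -> vderive c' t (F (c t)).
  move=> ht; apply: vderive_of_components => p; have [_ h] := hG p.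
  by have := h t (lt2 t ht); rewrite clamp_id.
have c0 : c' 0 = z.
  rewrite /c' big1 ?addr0// => p _; have [-> _] := hG p.
  by rewrite scale0r.
exists c'; split; [exact: c0| |exact: dc].
move=> t ht; split; last exact: vderive_continuous (dc t ht).
have M0' : 0 <= M := ltW M0.
have := @vderive_dist c' (fun=> z) (fun s => F (c s)) (fun=> 0) 0 t M M0' c0.
rewrite subr0 => h.
apply: (@le_trans _ _ (m * (M * `|t|))).
  apply: h => s; rewrite subr0 => hs; have hs' := le_trans hs ht.
  split; first exact: dc.
    by move=> p; rewrite co0; exact: is_derive_cst.
  by rewrite subr0; apply: F_bound; exact: good_ball.
by apply: le_trans epsM; rewrite ler_wpM2l ?(ltW m0)// ler_wpM2l.
Qed.

(** Picard iteration. The time of existence does not depend on the initial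
    value, which ranges in the ball of radius r / 2. *)
Lemma ode_exists : exists c, c 0 = z /\
  forall t, `|t| < eps -> cnorm (c t - z0) < r /\ vderive c t (F (c t)).
Proof.
have e0 := picard_time_gt0.
have /choice[T hT] : forall c, exists c', good c -> [/\ c' 0 = z, good c' &
    forall t, `|t| <= eps -> vderive c' t (F (c t))].
  move=> c; have [gc|ngc] := pselect (good c).
    by have [c' h] := picard_step gc; exists c'.
  by exists c => gc; case: (ngc gc).
pose c_ k := iter k T (fun=> z).
have gc k : good (c_ k).
  elim: k => [|k IH]; last by rewrite /c_ iterS; have [] := hT _ IH.
  move=> t _; split; first by rewrite subrr cnorm0 divr_ge0 ?ltW.
  exact: cst_continuous.
have cS k t : `|t| <= eps -> vderive (c_ k.+1) t (F (c_ k t)).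
  by move=> ht; rewrite /c_ iterS; have [_ _] := hT _ (gc k); apply.
have c0 k : c_ k 0 = z.
  by case: k => [//|k]; rewrite /c_ iterS; have [] := hT _ (gc k).
(* the Picard operator halves uniform distances; a' and b' are the images of a
   and b *)
have contr a b (a' b' : R -> V) D t : good a -> good b -> 0 <= D -> a' 0 = b' 0 ->
    (forall s, `|s| <= eps -> vderive a' s (F (a s))) ->
    (forall s, `|s| <= eps -> vderive b' s (F (b s))) ->
    (forall s, `|s| <= eps -> cnorm (a s - b s) <= D) ->
    `|t| <= eps -> cnorm (a' t - b' t) <= D / 2.
  move=> ga gb D0 ab0 da db hD ht.
  have LD0 : 0 <= L * D by rewrite mulr_ge0// ltW.
  have := @vderive_dist a' b' (fun s => F (a s)) (fun s => F (b s)) 0 t _ LD0 ab0.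
  rewrite subr0 => h; apply: (@le_trans _ _ (m * (L * D * `|t|))).
    apply: h => s; rewrite subr0 => hs; have hs' := le_trans hs ht.
    split; [exact: da|exact: db|].
    apply: (le_trans (F_lip (good_ball ga hs') (good_ball gb hs'))).
    by rewrite ler_wpM2l ?(ltW L0)// hD.
  apply: (@le_trans _ _ (m * (L * eps) * D)).
    have -> : m * (L * eps) * D = m * (L * D * eps).
      by rewrite -!mulrA; congr (_ * (_ * _)); rewrite mulrC.
    by rewrite ler_wpM2l ?(ltW m0)// ler_wpM2l.
  by rewrite mulrC ler_wpM2l// (le_trans epsL)// mul1r.
have dist k t : `|t| <= eps -> cnorm (c_ k.+1 t - c_ k t) <= r / 2 ^+ k.
  elim: k t => [|k IH] t ht.
    rewrite expr0 divr1 (le_trans (cnormB _ z _))//.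
    have [h1 _] := gc 1%N t ht; have [h2 _] := gc 0%N t ht.
    rewrite [cnorm (z - _)]cnormC; apply: (le_trans (lerD h1 h2)); have := r0; lra.
  have -> : r / 2 ^+ k.+1 = r / 2 ^+ k / 2.
    by rewrite exprS; field; rewrite expf_neq0.
  apply: (contr (c_ k.+1) (c_ k)) => //; first by rewrite divr_ge0 ?exprn_ge0// ltW.
  - by rewrite !c0.
  - exact: cS.
  - exact: cS.
have /choice[l hl] : forall pt : ('I_n * bool) * R, exists l : R, forall k,
    `|l - co pt.1 (c_ k (clamp pt.2))| <= 2 * r / 2 ^+ k.
  move=> [p t]; apply: (geometric_limit (u := fun k => co p (c_ k (clamp t)))) => k.
  by rewrite -coB (le_trans (co_le_cnorm _ _))// dist.
pose c t : V := \sum_p (l (p, t))%:C *: dir p.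
have co_c p t : co p (c t) = l (p, t).
  rewrite /c co_sum (bigD1 p) //= coZ co_dir eqxx mulr1 big1 ?addr0// => q qp.
  by rewrite coZ co_dir eq_sym (negbTE qp) mulr0.
have r20 k : 0 <= 2 * r / 2 ^+ k by rewrite divr_ge0 ?exprn_ge0// mulr_ge0// ltW.
have cdist k t : `|t| <= eps -> cnorm (c t - c_ k t) <= m * (2 * r / 2 ^+ k).
  move=> ht; apply: sum_le_dim => // p; rewrite coB co_c.
  by have := hl (p, t) k; rewrite /= clamp_id.
have gcl : good c.
  move=> t ht; split.
    rewrite -subr_le0; apply/(@pow2_le0 _ (m * (2 * r))).
      by rewrite mulr_ge0 ?(ltW m0)// mulr_ge0// ltW.
    move=> k; rewrite lerBlDr (le_trans (cnormB _ (c_ k t) _))// lerD//.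
      by rewrite -mulrA cdist.
    by have [] := gc k t ht.
  apply/continuous_to_V => p; apply/cvgrPdist_lt => e ee0.
  have e30 : 0 < e / 3 by rewrite divr_gt0.
  have r2 : 0 <= 2 * r by rewrite mulr_ge0// ltW.
  have [k hk] := pow2_small r2 e30.
  have ck : {for t, continuous (fun s => co p (c_ k (clamp s)))}.
    apply: (@continuous_comp _ _ _ clamp (fun s => co p (c_ k s))).
      exact: clamp_continuous.
    apply: (@continuous_comp _ _ _ (c_ k) (co p)); last exact: co_continuous.
    by have [] := gc k _ (clamp_le t).
  have /cvgrPdist_lt/(_ _ e30) := ck; apply: filterS => s hs /=.
  rewrite !co_c; have h1 := hl (p, t) k; have h2 := hl (p, s) k.
  rewrite /= in h1 h2.
  have -> : l (p, t) - l (p, s) = (l (p, t) - co p (c_ k (clamp t))) +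
     (co p (c_ k (clamp t)) - co p (c_ k (clamp s))) -
     (l (p, s) - co p (c_ k (clamp s))) by ring.
  apply: (le_lt_trans (ler_normB _ _)).
  apply: (le_lt_trans (lerD (ler_normD _ _) h2)).
  apply: (le_lt_trans (lerD (lerD h1 (ltW hs)) (lexx _))); lra.
have [T0 gT dT] := hT _ gcl.
have Tc t : `|t| <= eps -> T c t = c t.
  move=> ht; apply/eqP; rewrite -subr_eq0; apply/eqP/cnorm_eq0.
  apply/eqP; rewrite eq_le cnorm_ge0 andbT; apply/(@pow2_le0 _ (m * (2 * r))).
    by rewrite mulr_ge0 ?(ltW m0)// mulr_ge0// ltW.
  move=> k; rewrite (le_trans (cnormB _ (c_ k.+1 t) _))//.
  have h1 : cnorm (T c t - c_ k.+1 t) <= m * (2 * r / 2 ^+ k) / 2.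
    exact: (contr c (c_ k) (T c) (c_ k.+1) _ t gcl (gc k)
      (mulr_ge0 (ltW m0) (r20 k)) (etrans T0 (esym (c0 _))) dT (cS k)
      (fun s => cdist k s) ht).
  have h2 : cnorm (c_ k.+1 t - c t) <= m * (2 * r / 2 ^+ k) / 2.
    rewrite cnormC; apply: (le_trans (cdist k.+1 t ht)).
    rewrite le_eqVlt; apply/orP; left; apply/eqP; rewrite exprS; field.
    by rewrite expf_neq0.
  by apply: (le_trans (lerD h1 h2)); rewrite -splitr mulrA.
exists (T c); split; first exact: T0.
move=> t ht; split; first exact: good_ball gT (ltW ht).
rewrite (Tc t (ltW ht)); exact: dT (ltW ht).
Qed.

End Existence.

End Picard.

End ODE.

(** * Maximal solutions of an abstract local flow *)

Section Uniqueness.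
Context {R : realType} (T : topologicalType).
Hypothesis T_hausdorff : hausdorff_space T.
Variable P : (R -> T) -> R -> Prop.
Hypothesis P_cont : forall g (t : R), P g t -> {for t, continuous g}.
Hypothesis P_unique : forall (a b : R -> T) (t0 : R), a t0 = b t0 ->
  (\forall t \near t0, P a t /\ P b t) -> \forall t \near t0, a t = b t.

(** The set of times at which two solutions coincide is closed because T is
    separated, and open by local uniqueness. *)
Lemma solutions_agree (J : set R) (a b : R -> T) (t0 : R) : open J ->
  is_interval J -> (forall t, J t -> P a t) -> (forall t, J t -> P b t) ->
  J t0 -> a t0 = b t0 -> forall t, J t -> a t = b t.
Proof.
move=> oJ iJ Pa Pb Jt0 ab0.
pose E := J `&` [set t | a t = b t].
suff EJ : E = J by move=> t; rewrite -EJ => -[].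
have cJ : connected J by apply/connected_intervalP.
apply: cJ; first by exists t0.
- exists (interior [set t | a t = b t]); first exact: open_interior.
  apply/seteqP; split => t [Jt abt]; split => //; last exact: nbhs_singleton.
  apply: P_unique => //.
  by apply: filterS (open_nbhs_nbhs (conj oJ Jt)) => s Js; split; [exact: Pa|exact: Pb].
- exists (closure E); first exact: closed_closure.
  apply/seteqP; split => t [Jt Et]; split => //; first by apply: subset_closure.
  apply: T_hausdorff => A B At Bt.
  have nA : nbhs t (a @^-1` A) by apply: (P_cont (Pa t Jt)).
  have nB : nbhs t (b @^-1` B) by apply: (P_cont (Pb t Jt)).
  have [s [[_ abs] [As Bs]]] := Et _ (filterI nA nB).
  by exists (a s); split => //; rewrite abs.
Qed.

Lemma near_oo (a b t : R) : a < t -> t < b -> \forall s \near t, a < s < b.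
Proof.
move=> at_ tb; have : nbhs t `]a, b[%classic.
  by apply: open_nbhs_nbhs; split; [exact: interval_open|rewrite /= in_itv /= at_ tb].
by apply: filterS => s /=; rewrite in_itv.
Qed.

Lemma solutions_agree_oo (l r : R) (a b : R -> T) (t0 : R) :
  (forall t, l < t < r -> P a t) -> (forall t, l < t < r -> P b t) ->
  l < t0 < r -> a t0 = b t0 -> forall t, l < t < r -> a t = b t.
Proof.
move=> Pa Pb h0 ab0 t ht.
apply: (@solutions_agree `]l, r[%classic a b t0).
- exact: interval_open.
- exact: interval_is_interval.
- by move=> s /=; rewrite in_itv; exact: Pa.
- by move=> s /=; rewrite in_itv; exact: Pb.
- by rewrite /= in_itv.
- exact: ab0.
- by rewrite /= in_itv.
Qed.

Hypothesis P_near : forall g g' (t : R), (\forall s \near t, g s = g' s) ->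
  P g t -> P g' t.
Hypothesis P_shift : forall g (t a : R), P g (t + a) -> P (fun s => g (s + a)) t.
Hypothesis P_exists : forall x : T, exists2 U, nbhs x U & exists2 e : R, 0 < e &
  forall y, U y -> exists g, g 0 = y /\ forall t : R, `|t| < e -> P g t.
Hypothesis P_limit : forall (g : R -> T) (a b : R), a < b ->
  (forall t, a < t < b -> P g t) ->
  exists x : T, forall A, nbhs x A -> forall s, s < b ->
    exists t, [/\ s < t, a < t < b & A (g t)].

(** A solution on a bounded open interval has a limit point at the right end.
    The solution issued from a point of the curve near this limit point lives
    for a uniform time, hence beyond the end. *)
Lemma extend_right (g : R -> T) (a b : R) : a < b ->
  (forall t, a < t < b -> P g t) ->
  exists2 e : R, 0 < e & exists2 g', (forall t, a < t < b -> g' t = g t) &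
    forall t, a < t < b + e -> P g' t.
Proof.
move=> ab Pg; have [x hx] := P_limit ab Pg.
have [U Ux [e e0 hU]] := P_exists x.
have be : b - e < b by rewrite ltrBlDr ltrDl.
have [t1 [bet /andP[at1 t1b] Ut1]] := hx U Ux _ be.
have [h [h0 Ph]] := hU _ Ut1.
pose h' s := h (s + - t1).
have Ph' t : t1 - e < t < t1 + e -> P h' t.
  move=> /andP[h1 h2]; apply: P_shift; apply: Ph; rewrite ltr_norml; lra.
pose l := Num.max a (t1 - e).
have lt1 : l < t1 by rewrite gt_max at1 /=; lra.
have agree t : l < t < b -> g t = h' t.
  apply: (@solutions_agree_oo l b g h' t1).
  - by move=> s /andP[]; rewrite gt_max => /andP[s1 _] s2; apply: Pg; rewrite s1.
  - move=> s /andP[]; rewrite gt_max => /andP[_ s1] s2; apply: Ph'.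
    by rewrite s1 (lt_trans s2)//; lra.
  - by rewrite lt1 t1b.
  - by rewrite /h' subrr h0.
exists (t1 + e - b); first by lra.
exists (fun t => if t < b then g t else h' t); first by move=> t /andP[_ ->].
move=> t /andP[a1]; have -> : b + (t1 + e - b) = t1 + e by lra.
move=> t2; have [tb|bt] := ltP t b.
  apply: (@P_near g) (Pg t _); last by rewrite a1.
  by apply: filterS (near_oo a1 tb) => s /andP[_ ->].
have lt : l < t := lt_le_trans (lt_trans lt1 t1b) bt.
apply: (@P_near h') (Ph' t _).
  apply: filterS (near_oo lt t2) => s /andP[s1 s2].
  by case: ltP => // sb; rewrite agree// s1.
rewrite t2 andbT; lra.
Qed.

End Uniqueness.

Section Completeness.
Context {R : realType} (T : topologicalType).
Hypothesis T_hausdorff : hausdorff_space T.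
Variable P : (R -> T) -> R -> Prop.
Hypothesis P_cont : forall g (t : R), P g t -> {for t, continuous g}.
Hypothesis P_unique : forall (a b : R -> T) (t0 : R), a t0 = b t0 ->
  (\forall t \near t0, P a t /\ P b t) -> \forall t \near t0, a t = b t.
Hypothesis P_near : forall g g' (t : R), (\forall s \near t, g s = g' s) ->
  P g t -> P g' t.
Hypothesis P_shift : forall g (t a : R), P g (t + a) -> P (fun s => g (s + a)) t.
Hypothesis P_exists : forall x : T, exists2 U, nbhs x U & exists2 e : R, 0 < e &
  forall y, U y -> exists g, g 0 = y /\ forall t : R, `|t| < e -> P g t.
Hypothesis P_limit_right : forall (g : R -> T) (a b : R), a < b ->
  (forall t, a < t < b -> P g t) ->
  exists x : T, forall A, nbhs x A -> forall s, s < b ->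
    exists t, [/\ s < t, a < t < b & A (g t)].
Hypothesis P_limit_left : forall (g : R -> T) (a b : R), a < b ->
  (forall t, a < t < b -> P g t) ->
  exists x : T, forall A, nbhs x A -> forall s, a < s ->
    exists t, [/\ t < s, a < t < b & A (g t)].

Let Q (g : R -> T) (t : R) := P (fun s => g (- s)) (- t).

(** Time reversal reduces this to [extend_right]. *)
Lemma extend_left (g : R -> T) (a b : R) : a < b ->
  (forall t, a < t < b -> P g t) ->
  exists2 e : R, 0 < e & exists2 g', (forall t, a < t < b -> g' t = g t) &
    forall t, a - e < t < b -> P g' t.
Proof.
move=> ab Pg.
have Q_cont h (t : R) : Q h t -> {for t, continuous h}.
  move=> /P_cont hc; have -> : h = (fun s => h (- s)) \o -%R.
    by apply/funext => s /=; rewrite opprK.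
  by apply: continuous_comp; [exact: opp_continuous|exact: hc].
have Q_unique (h k : R -> T) (t0 : R) : h t0 = k t0 ->
    (\forall t \near t0, Q h t /\ Q k t) -> \forall t \near t0, h t = k t.
  move=> hk0 nr.
  have : \forall t \near - t0, h (- t) = k (- t).
    apply: P_unique; first by rewrite opprK.
    have /near_opp : \forall s \near - (- t0), Q h s /\ Q k s by rewrite opprK.
    by apply: filterS => s; rewrite /Q opprK.
  by move=> /near_opp; apply: filterS => s; rewrite opprK.
have Q_near h k (t : R) : (\forall s \near t, h s = k s) -> Q h t -> Q k t.
  move=> hk; apply: P_near; apply: (@near_opp R (- t) (fun s => h s = k s)).
  by rewrite opprK.
have Q_shift h (t s : R) : Q h (t + s) -> Q (fun x => h (x + s)) t.
  rewrite /Q opprD => /P_shift; apply: P_near; apply: near_all => x.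
  by rewrite opprB addrC.
have Q_exists (x : T) : exists2 U, nbhs x U & exists2 e : R, 0 < e &
    forall y, U y -> exists h, h 0 = y /\ forall t : R, `|t| < e -> Q h t.
  have [U Ux [e e0 hU]] := P_exists x; exists U => //; exists e => // y /hU[h [h0 Ph]].
  exists (fun t => h (- t)); split; first by rewrite oppr0.
  move=> t te; rewrite /Q; under [X in P X]eq_fun do rewrite opprK.
  by apply: Ph; rewrite normrN.
have Q_limit (h : R -> T) (c d : R) : c < d -> (forall t, c < t < d -> Q h t) ->
    exists x : T, forall A, nbhs x A -> forall s, s < d ->
      exists t, [/\ s < t, c < t < d & A (h t)].
  move=> cd Qh.
  have cd' : - d < - c by rewrite ltrN2.
  have Ph t : - d < t < - c -> P (fun s => h (- s)) t.
    move=> /andP[h1 h2]; have := Qh (- t); rewrite /Q opprK; apply.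
    by rewrite ltrNr h2 ltrNl.
  have [x hx] := P_limit_left cd' Ph; exists x => A /hx hA s sd.
  have [|t [h1 /andP[h2 h3] h4]] := hA (- s); first by rewrite ltrN2.
  by exists (- t); rewrite ltrNr h1 ltrNr h3 ltrNl h2.
have ab' : - b < - a by rewrite ltrN2.
have Qg t : - b < t < - a -> Q (fun s => g (- s)) t.
  move=> /andP[h1 h2]; rewrite /Q; under [X in P X]eq_fun do rewrite opprK.
  by apply: Pg; rewrite ltrNr h2 ltrNl.
have [e e0 [g' g'E Qg']] := @extend_right R T T_hausdorff Q Q_cont Q_unique Q_near
  Q_shift Q_exists Q_limit _ _ _ ab' Qg.
exists e => //; exists (fun t => g' (- t)).
  by move=> t /andP[h1 h2]; rewrite g'E ?opprK// !ltrN2 h1 h2.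
move=> t /andP[h1 h2]; have := Qg' (- t); rewrite /Q opprK; apply.
by rewrite ltrN2 h2 /=; lra.
Qed.

Let ext (x : T) (S : R) := 0 < S /\ exists g, g 0 = x /\ forall t, `|t| < S -> P g t.

(** The solutions issued from x on the various intervals ]- S, S[ agree, and
    patch together. *)
Lemma glue (x : T) : exists g, g 0 = x /\
  forall t, (exists2 S, ext x S & `|t| < S) -> P g t.
Proof.
have /choice[G hG] : forall S : R, exists g : R -> T, ext x S -> g 0 = x /\ forall t, `|t| < S -> P g t.
  move=> S; have [[_ [g h]]|nS] := pselect (ext x S); first by exists g.
  by exists (fun=> x) => h; case: (nS h).
have /choice[tau htau] : forall t : R, exists S : R, (exists2 S, ext x S & `|t| < S) ->
    ext x S /\ `|t| < S.
  move=> t; have [[S h1 h2]|nS] := pselect (exists2 S, ext x S & `|t| < S).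
    by exists S.
  by exists 0 => h; case: (nS h).
have agree S S' t : ext x S -> ext x S' -> `|t| < S -> `|t| < S' -> G S t = G S' t.
  move=> eS eS' tS tS'; have [G0 GP] := hG S eS; have [G0' GP'] := hG S' eS'.
  pose m := Num.min S S'.
  apply: (@solutions_agree_oo R T T_hausdorff P P_cont P_unique (- m) m _ _ 0).
  - by move=> s; rewrite -ltr_norml lt_min => /andP[h1 _]; exact: GP.
  - by move=> s; rewrite -ltr_norml lt_min => /andP[_ h1]; exact: GP'.
  - by have [p1 _] := eS; have [p2 _] := eS'; rewrite oppr_lt0 lt_min p1 p2.
  - by rewrite G0 G0'.
  - by rewrite -ltr_norml lt_min tS.
exists (fun t => G (tau t) t); split.
  have [U Ux [e e0 hU]] := P_exists x.
  have e1 : ext x e by split => //; apply: hU; exact: nbhs_singleton.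
  have [|h1 h2] := htau 0; first by exists e; rewrite ?normr0.
  by have [] := hG _ h1.
move=> t [S eS tS]; have [_ GP] := hG _ eS.
apply: (P_near _ (GP t tS)).
move: (tS); rewrite ltr_norml => /andP[t1 t2].
apply: filterS (near_oo t1 t2) => s; rewrite -ltr_norml => sS.
by have [|h1 h2] := htau s; [exists S|exact: agree].
Qed.

(** The supremum of the S such that a solution exists on ]- S, S[ cannot be
    finite: a solution on ]- S, S[ would extend on both sides. *)
Lemma global_solution (x : T) : exists g, g 0 = x /\ forall t, P g t.
Proof.
have [g [g0 gP]] := glue x.
have nonempty : exists S, ext x S.
  have [U Ux [e e0 hU]] := P_exists x.
  by exists e; split => //; apply: hU; exact: nbhs_singleton.
suff unb : forall t : R, exists2 S : R, ext x S & t < S.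
  by exists g; split => // t; apply: gP; exact: unb.
move=> t; apply: contrapT => ht.
have ub S : ext x S -> S <= t.
  by move=> eS; rewrite leNgt; apply/negP => tS; apply: ht; exists S.
have hs : has_sup [set S | ext x S].
  by split; [exact: nonempty|exists t => S /= /ub].
set s := sup [set S | ext x S].
have s0 : 0 < s.
  have [S [S0 eS]] := nonempty; apply: (lt_le_trans S0).
  by apply: sup_upper_bound => //; split.
have gs u : - s < u < s -> P g u.
  rewrite -ltr_norml => us; apply: gP.
  by have [S eS uS] := sup_gt hs.1 us; exists S.
have ns : - s < s by rewrite gtrN.
have [e1 e10 [g1 g1E Pg1]] := @extend_right R T T_hausdorff P P_cont P_unique P_near
  P_shift P_exists P_limit_right _ _ _ ns gs.
have ns1 : - s < s + e1 by lra.
have [e2 e20 [g2 g2E Pg2]] := extend_left ns1 Pg1.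
pose e := Num.min e1 e2.
have e0 : 0 < e by rewrite lt_min e10.
suff : s + e <= s by rewrite gerDl leNgt e0.
apply: sup_upper_bound => //; split; first exact: addr_gt0.
exists g2; split.
  by rewrite g2E ?g1E ?g0// oppr_lt0 s0 //= addr_gt0.
move=> u; rewrite ltr_norml => /andP[h1 h2]; apply: Pg2.
have : e <= e1 by rewrite ge_min lexx.
have : e <= e2 by rewrite ge_min lexx orbT.
by move=> ? ?; apply/andP; split; lra.
Qed.

Lemma extend_solution (J : set R) (d : R -> T) : open J -> is_interval J ->
  (forall t, J t -> P d t) ->
  exists g, (forall t, P g t) /\ forall t, J t -> g t = d t.
Proof.
move=> oJ iJ Pd; have [[t0 Jt0]|nJ] := pselect (exists t, J t); last first.
  have [g [_ Pg]] := global_solution (d 0).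
  by exists g; split => // t Jt; case: nJ; exists t.
have [g [g0 Pg]] := global_solution (d t0).
have Pg' t : P (fun s => g (s + - t0)) t by apply: P_shift; exact: Pg.
exists (fun s => g (s + - t0)); split => // t Jt.
apply: (@solutions_agree R T T_hausdorff P P_cont P_unique J
  (fun s => g (s + - t0)) d t0 oJ iJ) => //.
by rewrite subrr.
Qed.

End Completeness.

(** * Integral estimates and compact boxes *)

Section IntegralBounds.
Context {R : realType}.
Local Notation mu := (@lebesgue_measure R).

(** The integral of a nonnegative function is a supremum over simple
    functions, so that it is monotone without any measurability. *)
Lemma nonneg_integral_mono (D : set R) (f1 f2 : R -> \bar R) :
  (forall x, D x -> (0 <= f1 x)%E) -> (forall x, D x -> (f1 x <= f2 x)%E) ->
  (\int[mu]_(x in D) f1 x <= \int[mu]_(x in D) f2 x)%E.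
Proof.
move=> f10 f12.
have f20 x : D x -> (0 <= f2 x)%E.
  by move=> Dx; apply: le_trans (f12 x Dx); exact: f10.
rewrite !ge0_integralE//; apply: le_ereal_sup => _ [h hh <-].
exists h => // x; apply: (le_trans (hh x)); rewrite /patch.
by case: ifP => // /set_mem; exact: f12.
Qed.

(** The fundamental theorem of calculus, combined with the bound of dG by s;
    in the application, s is the speed of a curve. *)
Lemma increment_le_integral (G dG s : R -> R) (a b : R) : a <= b ->
  (forall t, a <= t <= b -> is_derive t 1 G (dG t)) ->
  (forall t, a <= t <= b -> {for t, continuous dG}) ->
  (forall t, a <= t <= b -> `|dG t| <= s t) ->
  ((`|G b - G a|)%:E <= \int[mu]_(t in `[a, b]) (s t)%:E)%E.
Proof.
move=> ab hG hdG hs.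
have s0 t : `[a, b]%classic t -> (0 <= (s t)%:E)%E.
  by rewrite /= in_itv /= => /hs h; rewrite lee_fin; exact: le_trans h.
move: ab; rewrite le_eqVlt => /orP[/eqP E|ab].
  have -> : G b - G a = 0 by rewrite E subrr.
  by rewrite normr0; exact: integral_ge0.
have Gc t : a <= t <= b -> {for t, continuous G}.
  by move=> ht; exact: is_derive_continuous (hG t ht).
have aab : a <= a <= b by rewrite lexx ltW.
have bab : a <= b <= b by rewrite lexx ltW.
have wc : {within `[a, b], continuous dG}.
  apply: continuous_in_subspaceT => t; rewrite inE /= in_itv /=; exact: hdG.
have D : derivable_oo_LRcontinuous G a b.
  split.
  - move=> t; rewrite in_itv /= => /andP[h1 h2].
    by have [] := hG t; rewrite ?(ltW h1) ?(ltW h2).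
  - exact/cvg_at_right_filter/(Gc a aab).
  - exact/cvg_at_left_filter/(Gc b bab).
have E : {in `]a, b[, derive1 G =1 dG}.
  move=> t; rewrite in_itv /= => /andP[h1 h2].
  by apply: is_derive_derive1; apply: hG; rewrite (ltW h1) (ltW h2).
have F := continuous_FTC2 ab wc D E.
have -> : ((`|G b - G a|)%:E = `| \int[mu]_(t in `[a, b]) (dG t)%:E|)%E.
  by rewrite F -EFinB.
have iG : mu.-integrable `[a, b] (EFin \o dG).
  by apply: continuous_compact_integrable => //; exact: segment_compact.
have mdG := measurable_int mu iG.
apply: (le_trans (le_abse_integral _ _ mdG)) => //.
apply: nonneg_integral_mono => t; first by move=> _; exact: abse_ge0.
by rewrite /= in_itv /= => /hs; rewrite lee_fin.
Qed.

End IntegralBounds.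

Section Boxes.
Context {R : realType} {n : nat}.
Local Notation V := 'rV[R[i]]_n.
Implicit Types (z v : V).

Definition box z (r : R) : set V := [set y | forall p, `|co p (y - z)| <= r].

Lemma box_compact z (r : R) : compact (box z r).
Proof.
pose N := #|{: 'I_n * bool}|.
pose Phi (x : 'rV[R]_N) : V := \sum_p (x 0 (enum_rank p))%:C *: dir p.
have co_Phi p x : co p (Phi x) = x 0 (enum_rank p).
  rewrite /Phi co_sum (bigD1 p) //= coZ co_dir eqxx mulr1 big1 ?addr0// => q qp.
  by rewrite coZ co_dir eq_sym (negbTE qp) mulr0.
have cPhi : continuous Phi.
  move=> x; apply/continuous_to_V => p.
  have -> : co p \o Phi = (fun x : 'rV[R]_N => x 0 (enum_rank p)).
    by apply/funext => y; exact: co_Phi.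
  exact: coord_continuous.
pose A := [set x : 'rV[R]_N | forall j, `[co (enum_val j) z - r, co (enum_val j) z + r]%classic (x 0 j)].
have cA : compact A.
  by apply: (@rV_compact _ _ (fun j => `[co (enum_val j) z - r, co (enum_val j) z + r]%classic)) => j;
    exact: segment_compact.
have -> : box z r = Phi @` A.
  apply/seteqP; split => [y hy|_ [x Ax <-] p].
    exists (\row_j co (enum_val j) y).
      move=> j; rewrite mxE /= in_itv /=; have := hy (enum_val j).
      by rewrite coB ler_distl.
    by apply: coP => p; rewrite co_Phi mxE enum_rankK.
  rewrite coB co_Phi; have := Ax (enum_rank p).
  by rewrite /= in_itv /= enum_rankK ler_distl.
by apply: continuous_compact cA; exact: continuous_subspaceT.
Qed.

Lemma nbhs_box z (A : set V) : nbhs z A -> exists2 r : R, 0 < r & box z r `<=` A.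
Proof.
move=> /nbhs_cnorm[r r0 hr].
pose m : R := #|{: 'I_n * bool}|%:R + 1.
have m0 : 0 < m by rewrite ltr_wpDl.
exists (r / 2 / m); first by rewrite !divr_gt0.
move=> y hy; apply: hr; have rm0 : 0 <= r / 2 / m by rewrite !divr_ge0// ltW.
apply: (le_lt_trans (sum_le_dim rm0 hy)); rewrite -/m mulrC divfK ?gt_eqF//.
by rewrite ltr_pdivrMr// ltr_pMr// ltr1n.
Qed.

End Boxes.

(** * Hermitian metrics and velocities of curves *)

Section HermitianBounds.
Context {R : realType} {n : nat}.
Local Notation V := 'rV[R[i]]_n.
Local Notation C := R[i].
Implicit Types (z v : V).

Let m : R := #|{: 'I_n * bool}|%:R + 1.

Let m0 : 0 < m. Proof. by rewrite ltr_wpDl. Qed.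

Lemma re_mulJ (x : C) : complex.Re (x * x^*) = complex.Re x ^+ 2 + complex.Im x ^+ 2.
Proof. by case: x => a b /=; ring. Qed.

Lemma herm_factor (A L : 'M[C]_n) v : A = L *m (map_mx Num.conj L)^T ->
  complex.Re (herm A v) =
  \sum_k (complex.Re ((v *m L) 0 k) ^+ 2 + complex.Im ((v *m L) 0 k) ^+ 2).
Proof.
move=> ->; have -> : herm (L *m (map_mx Num.conj L)^T) v =
    \sum_k (v *m L) 0 k * ((v *m L) 0 k)^*.
  rewrite /herm mulmxA -mulmxA -trmx_mul -[map_mx _ v]/(map_mx Num.conj v) -cjM mxE.
  by apply: eq_bigr => k _; congr (_ * _); rewrite mxE [LHS]mxE.
by rewrite raddf_sum; apply: eq_bigr => k _; exact: re_mulJ.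
Qed.

(** Write A = L L^*: the form is the square of the norm of v L, and L is
    invertible. *)
Lemma herm_lower (A : 'M[C]_n) : pdef A ->
  exists2 k : R, 0 < k & forall v, k * cnorm v ^+ 2 <= complex.Re (herm A v).
Proof.
move=> pA; have [L AL dA] := pdef_factor pA.
have Lu : L \in unitmx by have := pdef_unit pA; rewrite AL unitmx_mul => /andP[].
pose K := mxbound (invmx L) * m.
have K0 : 0 < K by rewrite mulr_gt0// mxbound_gt0.
exists (K ^+ 2)^-1; first by rewrite invr_gt0 exprn_gt0.
move=> v; set H := complex.Re _.
have HE : H = \sum_k (complex.Re ((v *m L) 0 k) ^+ 2 + complex.Im ((v *m L) 0 k) ^+ 2).
  exact: herm_factor AL.
have H0 : 0 <= H by rewrite HE sumr_ge0// => k _; rewrite addr_ge0// sqr_ge0.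
have coH p : `|co p (v *m L)| <= Num.sqrt H.
  rewrite -sqrtr_sqr ler_sqrt// HE (bigD1 p.1) //= /co.
  have h : 0 <= \sum_(k < n | k != p.1) (complex.Re ((v *m L) 0 k) ^+ 2 + complex.Im ((v *m L) 0 k) ^+ 2).
    by rewrite sumr_ge0// => k _; rewrite addr_ge0// sqr_ge0.
  by case: p.2; [rewrite -addrA addrCA lerDl addr_ge0// sqr_ge0|rewrite -addrA lerDl addr_ge0// sqr_ge0].
have h1 : cnorm (v *m L) <= m * Num.sqrt H by apply: sum_le_dim => //; exact: sqrtr_ge0.
have h2 : cnorm v <= K * Num.sqrt H.
  have {1}-> : v = v *m L *m invmx L by rewrite mulmxK.
  apply: (le_trans (cnorm_mulmx _ _)); rewrite /K -mulrA ler_wpM2l//.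
  exact: ltW (mxbound_gt0 _).
rewrite mulrC ler_pdivrMr ?exprn_gt0// -[X in _ <= X * _]sqr_sqrtr// -exprMn mulrC.
by rewrite ler_sqr ?nnegrE ?cnorm_ge0// mulr_ge0 ?(ltW K0)// sqrtr_ge0.
Qed.

Lemma herm_upper (E : 'M[C]_n) v :
  complex.Re (herm E v) <=
  (\sum_a \sum_b (`|complex.Re (E a b)| + `|complex.Im (E a b)|)) * cnorm v ^+ 2.
Proof.
have N0 := cnorm_ge0 v.
apply: (le_trans (ler_norm _)); rewrite -lecR; apply: le_trans (normc_ge_Re _) _.
have -> : herm E v = \sum_b \sum_a v 0 a * E a b * (v 0 b)^*.
  rewrite /herm mxE; apply: eq_bigr => b _; rewrite mxE mulr_suml.
  by apply: eq_bigr => a _; rewrite !mxE.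
rewrite exchange_big /= mulr_suml rmorph_sum /=.
apply: (le_trans (ler_norm_sum _ _ _)); apply: ler_sum => a _.
rewrite mulr_suml rmorph_sum /=.
apply: (le_trans (ler_norm_sum _ _ _)); apply: ler_sum => b _.
rewrite !normrM normcJ.
have -> : `|v 0 a| * `|E a b| * `|v 0 b| = `|E a b| * (`|v 0 a| * `|v 0 b|).
  by rewrite [`|v 0 a| * _]mulrC mulrA.
rewrite [X in _ <= X]rmorphM expr2.
apply: ler_pM; [exact: normr_ge0|exact: mulr_ge0|exact: normc_le_re_im|].
rewrite [X in _ <= X]rmorphM.
by apply: ler_pM; [exact: normr_ge0|exact: normr_ge0|exact: entry_le_cnorm|exact: entry_le_cnorm].
Qed.

Lemma hermB (A B : 'M[C]_n) v : herm (A - B) v = herm A v - herm B v.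
Proof. by rewrite /herm mulmxBr mulmxBl !mxE. Qed.

Lemma hermZ (M : 'M[C]_n) (k : C) v : herm M (k *: v) = k * k^* * herm M v.
Proof.
rewrite /herm.
have -> : map_mx (fun t : C => t^*) (k *: v) = k^* *: map_mx (fun t : C => t^*) v.
  by apply/matrixP => a b; rewrite !mxE; exact: rmorphM.
by rewrite -!scalemxAl linearZ -scalemxAr /= scalerA mxE.
Qed.

Lemma hermN (M : 'M[C]_n) v : herm M (- v) = herm M v.
Proof.
have -> : - v = (-1) *: v by rewrite scaleN1r.
by rewrite hermZ rmorphN rmorph1 mulrNN !mul1r.
Qed.

(** Near z, the matrix G y differs from G z by a perturbation which costs at
    most half of the lower bound at z. *)
Lemma herm_locally_bounded_below (U : set V) (G : V -> 'M[C]_n) z : open U ->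
  (forall a b, csmooth_on U (fun y => G y a b)) -> U z -> pdef (G z) ->
  exists2 k : R, 0 < k & \forall y \near z, forall v,
    (k * cnorm v) ^+ 2 <= complex.Re (herm (G y) v).
Proof.
move=> oU hG Uz pz; have [k k0 hk] := herm_lower pz.
pose N : R := \sum_(a < n) \sum_(b < n) 2.
have N0 : 0 <= N by rewrite sumr_ge0// => a _; rewrite sumr_ge0.
pose e := k / 2 / (N + 1).
have N1 : 0 < N + 1 by rewrite ltr_wpDl.
have e0 : 0 < e by rewrite !divr_gt0.
have near_ab : \forall y \near z, forall a, forall b,
    `|complex.Re ((G y - G z) a b)| < e /\ `|complex.Im ((G y - G z) a b)| < e.
  apply: near_forall => a; apply: near_forall => b.
  have [h1 h2] := hG a b.
  have c1 := (continuousR_cnorm _ _).1 (Ck_cont (h1 0%N) Uz) e e0.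
  have c2 := (continuousR_cnorm _ _).1 (Ck_cont (h2 0%N) Uz) e e0.
  apply: filterS2 c1 c2 => y; rewrite !mxE.
  by case: (G y a b) => ? ?; case: (G z a b).
exists (Num.sqrt (k / 2)); first by rewrite sqrtr_gt0 divr_gt0.
apply: filterS near_ab => y hy v.
rewrite exprMn sqr_sqrtr ?divr_ge0 ?(ltW k0)//.
have h1 := hk v; have h2 := herm_upper (G z - G y) v.
have h3 : (\sum_a \sum_b (`|complex.Re ((G z - G y) a b)| + `|complex.Im ((G z - G y) a b)|))
    * cnorm v ^+ 2 <= k / 2 * cnorm v ^+ 2.
  rewrite ler_wpM2r ?sqr_ge0//.
  apply: (@le_trans _ _ (N * e)).
    rewrite /N mulr_suml; apply: ler_sum => a _; rewrite mulr_suml; apply: ler_sum => b _.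
    rewrite mulrDl mul1r; have [r1 r2] := hy a b.
    have E (x y' : C) : `|complex.Re (x - y')| = `|complex.Re (y' - x)| /\
        `|complex.Im (x - y')| = `|complex.Im (y' - x)|.
      by case: x y' => ? ? [? ?] /=; rewrite distrC; split => //; rewrite distrC.
    have Ey : (G z - G y) a b = G z a b - G y a b by rewrite !mxE.
    have Ey' : (G y - G z) a b = G y a b - G z a b by rewrite !mxE.
    rewrite Ey; have [-> ->] := E (G z a b) (G y a b).
    by rewrite -Ey' lerD// ltW.
  rewrite /e mulrCA ler_piMr ?divr_ge0 ?(ltW k0)//.
  by rewrite ler_pdivrMr// mul1r lerDl.
move: h2; rewrite hermB; have -> (x y' : C) : complex.Re (x - y') = complex.Re x - complex.Re y'.
  by case: x y' => ? ? [].
move=> h2; have := le_trans h2 h3.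
move: h1; move: (complex.Re (herm (G y) v)) (complex.Re (herm (G z) v)) (cnorm v ^+ 2).
move=> x y' s h1 h4; lra.
Qed.

End HermitianBounds.

Section Curves.
Context {R : realType} {n : nat} (X : complexManifold R n) (w : kahlerMetric X).
Local Notation V := 'rV[R[i]]_n.
Local Notation C := R[i].
Implicit Types (i j : chart_index X) (g : R -> X).

Lemma velocity_vderive i g (t : R) : coord_derivable i g t ->
  vderive (chart_map X i \o g) t (velocity i g t).
Proof.
move=> h [a b]; have [h1 h2] := h a; rewrite /co /velocity mxE.
by case: b => /=; apply: derivable_is_derive.
Qed.

Lemma vderive_velocity i g (t : R) v : vderive (chart_map X i \o g) t v ->
  coord_derivable i g t /\ velocity i g t = v.
Proof.
move=> h; have h' : coord_derivable i g t.
  move=> a; have [h1 _] := h (a, false); have [h2 _] := h (a, true).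
  by split; [exact: h1|exact: h2].
split => //; exact: vderive_unique (velocity_vderive h') h.
Qed.

Lemma near_chart i g (t : R) : {for t, continuous g} -> chart_dom X i (g t) ->
  \forall s \near t, chart_dom X i (g s).
Proof.
move=> gc gi; apply: gc; apply: open_nbhs_nbhs; split => //.
exact: chart_dom_open.
Qed.

Lemma vderive_transition i j g (t : R) v : {for t, continuous g} ->
  chart_dom X i (g t) -> chart_dom X j (g t) -> vderive (chart_map X i \o g) t v ->
  vderive (chart_map X j \o g) t (v *m 'J (transition i j) (chart_map X i (g t))).
Proof.
move=> gc gi gj dv.
have ov := overlap_map gi gj.
have df := transition_holomorphic ov.
apply: vderive_near (vderive_comp (c := chart_map X i \o g) df dv).
apply: filterS (near_chart gc gi) => s gs.
by rewrite /transition /= chart_mapK.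
Qed.

Lemma herm_transition i j z v : overlap i j z ->
  herm (metric w i z) v =
  herm (metric w j (transition i j z)) (v *m 'J (transition i j) z).
Proof.
move=> ov; rewrite /herm (metric_transform w ov).
by rewrite map_mxM trmx_mul !mulmxA.
Qed.

(** The definition of the speed uses a distinguished chart; by invariance of
    the metric any chart gives the same value. *)
Lemma speedE i g (t : R) v : {for t, continuous g} -> chart_dom X i (g t) ->
  vderive (chart_map X i \o g) t v ->
  speed w g t = Num.sqrt (2 * complex.Re (herm (metric w i (chart_map X i (g t))) v)).
Proof.
move=> gc gi dv; rewrite /speed; set j := chart_at X (g t).
have gj : chart_dom X j (g t) := chart_atP (g t).
have [_ ->] := vderive_velocity (vderive_transition gc gi gj dv).
rewrite [herm (metric w i _) v](herm_transition _ (overlap_map gi gj)).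
by rewrite /transition /= chart_mapK.
Qed.

End Curves.

(** * The Riemannian distance and the topology *)

Section CutoffCalculus.
Context {R : realType}.

(** The square makes the positive part differentiable at 0, so that the cutoff
    function below is C^1. *)
Lemma is_derive_sqr_pos (x : R) :
  is_derive x 1 (fun y : R => Num.max 0 y ^+ 2) (2 * Num.max 0 x).
Proof.
apply/is_deriveP => e e0; apply/nbhs_ballP; exists e => //= s; rewrite /ball /= distrC => sx.
apply: (@le_trans _ _ (`|s - x| ^+ 2)); last first.
  by rewrite expr2 ler_wpM2r// ltW.
rewrite real_normK ?num_real// ler_norml.
have sx2 := sqr_ge0 (s - x); have s2 := sqr_ge0 s; have x2 := sqr_ge0 x.
rewrite !expr2 in sx2 s2 x2 *.
have [s0|/ltW s0] := leP 0 s; have [x0|/ltW x0] := leP 0 x; apply/andP.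
- by split; nra.
- have sx0 : 0 <= s * - x by rewrite mulr_ge0// oppr_ge0.
  by split; nra.
- have sx0 : 0 <= x * - s by rewrite mulr_ge0// oppr_ge0.
  by split; nra.
- by split; nra.
Qed.

Lemma is_derive_bigsum (I : Type) (r : seq I) (F : I -> R -> R) (dF : I -> R) (t : R) :
  (forall p, is_derive t 1 (F p) (dF p)) ->
  is_derive t 1 (fun s => \sum_(p <- r) F p s) (\sum_(p <- r) dF p).
Proof.
move=> h; elim: r => [|p r IH].
  rewrite big_nil; have -> : (fun s => \sum_(p <- [::]) F p s) = cst 0.
    by apply/funext => s; rewrite big_nil.
  exact: is_derive_cst.
rewrite big_cons; have -> : (fun s => \sum_(p <- p :: r) F p s) =
    (fun s => F p s + \sum_(p <- r) F p s).
  by apply/funext => s; rewrite big_cons.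
exact: is_deriveD.
Qed.

Lemma continuous_bigsum (I : Type) (r : seq I) (F : I -> R -> R) (t : R) :
  (forall p, {for t, continuous (F p)}) ->
  {for t, continuous (fun s => \sum_(p <- r) F p s)}.
Proof.
move=> h; elim: r => [|p r IH].
  have -> : (fun s => \sum_(p <- [::]) F p s) = cst 0.
    by apply/funext => s; rewrite big_nil.
  exact: cst_continuous.
have -> : (fun s => \sum_(p <- p :: r) F p s) =
    (fun s => F p s + \sum_(p <- r) F p s).
  by apply/funext => s; rewrite big_cons.
by apply: continuousD; [exact: h|exact: IH].
Qed.

End CutoffCalculus.

Section DistanceTopology.
Context {R : realType} {n : nat} (X : complexManifold R n) (w : kahlerMetric X).
Local Notation V := 'rV[R[i]]_n.
Local Notation C := R[i].
Variables (x : X) (A : set X).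
Hypothesis xA : nbhs x A.

Let i := chart_at X x.
Let z0 := chart_map X i x.

Let xi : chart_dom X i x. Proof. exact: chart_atP. Qed.

Let good_box : exists r k : R, [/\ 0 < r, 0 < k, box z0 r `<=` chart_img i,
  (forall z, box z0 r z -> A (chart_inv X i z)) &
  forall z v, box z0 r z -> (k * cnorm v) ^+ 2 <= complex.Re (herm (metric w i z) v)].
Proof.
have Uz : chart_img i z0 by exists x.
have [k k0 hk] := herm_locally_bounded_below (chart_img_openP i)
  (@metric_smooth _ _ _ w i) Uz (metric_pdef w Uz).
have nA : nbhs z0 (fun z => A (chart_inv X i z)).
  apply: (chart_inv_continuous Uz); rewrite /z0 chart_mapK//.
have nU : nbhs z0 (chart_img i).
  by apply: open_nbhs_nbhs; split => //; exact: chart_img_openP.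
have [r r0 hr] := nbhs_box (filterI nU (filterI nA hk)).
exists r, k; split => // [z /hr[]//|z /hr[_ []]//|z v /hr[_ [_ h]]].
exact: h.
Qed.

Let dist_nbhs_box (r k : R) : 0 < r -> 0 < k -> box z0 r `<=` chart_img i ->
  (forall z, box z0 r z -> A (chart_inv X i z)) ->
  (forall z v, box z0 r z -> (k * cnorm v) ^+ 2 <= complex.Re (herm (metric w i z) v)) ->
  exists2 d : R, 0 < d & forall y, (riemannian_dist w y x < d%:E)%E -> A y.
Proof.
move=> r0 k0 boxU boxA boxk.
(* As K is compact, it is closed, and a path which is outside of the chart is
   outside of K for nearby times: f vanishes there. *)
pose K := chart_inv X i @` box z0 r.
have cK : closed K.
  apply: compact_closed; first exact: manifold_hausdorff.
  apply: continuous_compact; last exact: box_compact.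
  apply: continuous_in_subspaceT => z; rewrite inE => /boxU; exact: chart_inv_continuous.
pose q (z : V) : R := \sum_p co p (z - z0) ^+ 2.
have q0 z : 0 <= q z by rewrite sumr_ge0// => p _; rewrite sqr_ge0.
(* The derivative of max (0, r^2 - q)^2 in the direction v is at most
   4 r^2 r |v| in absolute value, and the speed is at least k |v|; this is the
   factor which makes the cutoff f a 1-Lipschitz function of the length. *)
pose ka := k / (4 * r ^+ 3).
have ka0 : 0 < ka by rewrite divr_gt0// mulr_gt0// exprn_gt0.
pose hh (s : R) : R := ka * Num.max 0 (r ^+ 2 - s) ^+ 2.
pose f y := if `[< chart_dom X i y >] then hh (q (chart_map X i y)) else 0.
have qbox z : q z < r ^+ 2 -> box z0 r z.
  move=> qz p; have : co p (z - z0) ^+ 2 <= r ^+ 2.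
    apply: le_trans (ltW qz); rewrite /q (bigD1 p) //= lerDl sumr_ge0// => p' _.
    by rewrite sqr_ge0.
  by rewrite -real_normK ?num_real// ler_sqr ?nnegrE// ltW.
have max0 z : ~ box z0 r z -> Num.max 0 (r ^+ 2 - q z) = 0.
  move=> nb; apply/max_idPl; rewrite subr_le0 leNgt; apply/negP => /qbox; exact: nb.
have seg (g : R -> X) (a b : R) : a <= b ->
    (forall t, `[a, b]%classic t -> C1_curve_at g t) ->
    ((`|f (g b) - f (g a)|)%:E <=
      \int[lebesgue_measure]_(t in `[a, b]) (speed w g t)%:E)%E.
  move=> ab hg.
  have hg' t : a <= t <= b -> C1_curve_at g t by move=> h; apply: hg; rewrite /= in_itv.
  pose c t := chart_map X i (g t).
  pose D t : R := - (ka * (4 * Num.max 0 (r ^+ 2 - q (c t)) *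
    \sum_p co p (c t - z0) * co p (velocity i g t))).
  pose dG t := if `[< chart_dom X i (g t) >] then D t else 0.
  have cin t : a <= t <= b -> chart_dom X i (g t) ->
      [/\ {for t, continuous g}, vderive c t (velocity i g t),
          {for t, continuous (velocity i g)} &
          \forall s \near t, chart_dom X i (g s)].
    move=> /hg'[gc h] gi; have [h1 h2] := h i gi; split => //.
      exact: velocity_vderive (nbhs_singleton h1).
    exact: near_chart.
  have cout t : a <= t <= b -> ~ chart_dom X i (g t) ->
      \forall s \near t, f (g s) = 0 /\ dG s = 0.
    move=> /hg'[gc _] ngi.
    have ngK : ~ K (g t).
      by move=> [z zb zg]; apply: ngi; rewrite -zg; apply: chart_inv_dom; exact: boxU.
    have nK : \forall s \near t, ~ K (g s).
      apply: (gc (~` K)); apply: open_nbhs_nbhs; split => //.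
      exact: closed_openC.
    apply: filterS nK => s sK; rewrite /f /dG; case: asboolP => [gi|//].
    have nb : ~ box z0 r (c s).
      by move=> cb; apply: sK; exists (c s) => //; rewrite /c chart_mapK.
    by rewrite /hh /D -/(c s) (max0 _ nb) expr0n /= !(mulr0, mul0r) oppr0.
  apply: (@increment_le_integral R (f \o g) dG (speed w g) a b ab).
  - move=> t ht; have [gi|ngi] := pselect (chart_dom X i (g t)); last first.
      have h := cout t ht ngi.
      have -> : dG t = 0 by have [] := nbhs_singleton h.
      apply: (@is_derive_near _ (cst 0)).
      by apply: filterS h => s [fs _]; rewrite /= fs.
    have [gc dc vc gn] := cin t ht gi.
    have -> : dG t = D t by rewrite /dG asboolT.
    apply: (@is_derive_near _ (fun s => hh (q (c s)))).
      by apply: filterS gn => s si; rewrite /= /f asboolT.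
    have dq : is_derive t 1 (fun s => q (c s)) (\sum_p 2 * (co p (c t - z0) * co p (velocity i g t))).
      apply: is_derive_bigsum => p.
      have d1 : is_derive t 1 (fun s => co p (c s - z0)) (co p (velocity i g t)).
        apply: (@is_derive_near _ (fun s => co p (c s) - co p z0)).
          by apply: near_all => s; rewrite coB.
        rewrite -[co p (velocity i g t)]subr0.
        by apply: is_deriveB; exact: dc.
      apply: (is_derive_eq (is_deriveM d1 d1)).
      by rewrite /GRing.scale /=; ring.
    have d2 : is_derive t 1 (fun s => r ^+ 2 - q (c s))
        (0 - \sum_p 2 * (co p (c t - z0) * co p (velocity i g t))).
      by apply: is_deriveB; exact: dq.
    have d3 := @is_derive1_comp R (fun y : R => Num.max 0 y ^+ 2) (fun s => r ^+ 2 - q (c s)) t _ _ (is_derive_sqr_pos _) d2.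
    apply: (is_derive_eq (is_deriveZ ka d3)).
    by rewrite /GRing.scale /= -mulr_sumr /D sub0r; ring.
  - move=> t ht; have [gi|ngi] := pselect (chart_dom X i (g t)); last first.
      have h := cout t ht ngi.
      apply: (@is_derive_continuous _ dG t 0).
      apply: (@is_derive_near _ (cst 0)).
      by apply: filterS h => s [_ fs]; rewrite /= fs.
    have [gc dc vc gn] := cin t ht gi.
    have cc : {for t, continuous c} := vderive_continuous dc.
    have Dc : {for t, continuous D}.
      have c1 p : {for t, continuous (fun s => co p (c s - z0))}.
        have -> : (fun s => co p (c s - z0)) = (fun s => co p (c s) - co p z0).
          by apply/funext => s; rewrite coB.
        apply: continuousB; last exact: cst_continuous.
        by apply: (@continuous_comp _ _ _ c (co p)); [exact: cc|exact: co_continuous].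
      have c2 p : {for t, continuous (fun s => co p (velocity i g s))}.
        by apply: (@continuous_comp _ _ _ (velocity i g) (co p)); [exact: vc|exact: co_continuous].
      have c3 : {for t, continuous (fun s => q (c s))}.
        by apply: continuous_bigsum => p; apply: continuousM; exact: c1.
      have c4 : {for t, continuous (fun s => Num.max 0 (r ^+ 2 - q (c s)))}.
        apply: (@continuous_max _ _ (cst 0) (fun s => r ^+ 2 - q (c s))).
          exact: cst_continuous.
        by apply: continuousB; [exact: cst_continuous|exact: c3].
      have c5 : {for t, continuous (fun s => \sum_p co p (c s - z0) * co p (velocity i g s))}.
        by apply: continuous_bigsum => p; apply: continuousM; [exact: c1|exact: c2].
      apply: continuousN; apply: continuousM; first exact: cst_continuous.
      apply: continuousM; last exact: c5.
      by apply: continuousM; [exact: cst_continuous|exact: c4].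
    have E : \forall s \near t, D s = dG s.
      by apply: filterS gn => s si; rewrite /dG asboolT.
    have Et := nbhs_singleton E.
    apply/cvgrPdist_lt => e e0; have /cvgrPdist_lt/(_ e e0) := Dc.
    by rewrite Et; apply: filterS2 E => s ->.
  move=> t ht; rewrite /dG; case: asboolP => [gi|_]; last first.
    by rewrite normr0 /speed sqrtr_ge0.
  have [gc dc vc gn] := cin t ht gi.
  have [nb|cb] := leP (r ^+ 2) (q (c t)).
    have -> : D t = 0.
      by rewrite /D; have -> : Num.max 0 (r ^+ 2 - q (c t)) = 0;
        [apply/max_idPl; rewrite subr_le0|rewrite !(mulr0, mul0r) oppr0].
    by rewrite normr0 /speed sqrtr_ge0.
  rewrite (speedE w gc gi dc).
  set v := velocity i g t in dc *.
  have bc : box z0 r (c t) := qbox _ cb.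
  apply: (@le_trans _ _ (k * cnorm v)); last first.
    rewrite -[X in X <= _]ger0_norm ?mulr_ge0 ?cnorm_ge0 ?(ltW k0)//.
    have h := boxk _ v bc; have h0 := le_trans (sqr_ge0 _) h.
    rewrite -sqrtr_sqr ler_sqrt; last by rewrite mulr_ge0.
    by apply: (le_trans h); rewrite -/(c t); move: h0; move: (complex.Re _) => y; lra.
  rewrite /D normrN normrM (ger0_norm (ltW ka0)) !normrM.
  have M1 : `|Num.max 0 (r ^+ 2 - q (c t))| <= r ^+ 2.
    rewrite ger0_norm ?le_max ?lexx// ge_max sqr_ge0 /=.
    by rewrite lerBlDr lerDl q0.
  have M2 : `|\sum_p co p (c t - z0) * co p v| <= r * cnorm v.
    apply: (le_trans (ler_norm_sum _ _ _)); rewrite /cnorm mulr_sumr.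
    by apply: ler_sum => p _; rewrite normrM ler_wpM2r// bc.
  apply: (@le_trans _ _ (ka * (4 * r ^+ 2 * (r * cnorm v)))).
    rewrite ler_wpM2l ?(ltW ka0)//; apply: ler_pM => //.
    by rewrite (ger0_norm (ler0n _ 4)) ler_wpM2l.
  rewrite le_eqVlt; apply/orP; left; apply/eqP; rewrite /ka; field.
  by rewrite gt_eqF.
have path y1 y2 L : piecewise_C1_path w y1 y2 L ->
    (0 <= L)%E /\ ((`|f y2 - f y1|)%:E <= L)%E.
  elim=> {y1 y2 L} [g a b ab hg|y1 y2 y3 L1 L2 _ [L10 h1] _ [L20 h2]].
    split; last exact: seg.
    by apply: integral_ge0 => t _; rewrite lee_fin sqrtr_ge0.
  split; first exact: adde_ge0.
  apply: le_trans (leeD h1 h2); rewrite -EFinD lee_fin.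
  by have := ler_normD (f y2 - f y1) (f y3 - f y2); rewrite addrC subrKA.
have fx : f x = ka * r ^+ 4.
  rewrite /f asboolT// /hh; have -> : q (chart_map X i x) = 0.
    by rewrite /q big1// => p _; rewrite subrr co0 expr0n.
  by rewrite subr0 max_r ?sqr_ge0// -exprM.
have fx0 : 0 < f x by rewrite fx mulr_gt0// exprn_gt0.
exists (f x) => // y /ereal_inf_lt[L Lp Ld].
have [_ h] := path _ _ _ Lp.
have : `|f x - f y| < f x by rewrite -lte_fin; exact: le_lt_trans h Ld.
rewrite ltr_norml => /andP[_]; rewrite ltrBlDr ltrDl {1}/f.
case: asboolP => [yi|_]; last by rewrite ltxx.
move=> h0; have yb : box z0 r (chart_map X i y).
  apply: contrapT => /max0 M; move: h0; rewrite /hh M expr0n /= mulr0.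
  by rewrite ltxx.
by have := boxA _ yb; rewrite chart_mapK.
Qed.

(** Take a cutoff function supported in A and positive at x, and 1-Lipschitz
    for the length of paths: it vanishes at the points outside A, so these are
    at distance at least its value at x. *)
Lemma dist_nbhs : exists2 d : R, 0 < d &
  forall y, (riemannian_dist w y x < d%:E)%E -> A y.
Proof. by have [r [k []]] := good_box; exact: dist_nbhs_box. Qed.

End DistanceTopology.

(** * Integral curves of a vector field on a manifold *)

Section IntegralCurves.
Context {R : realType} {n : nat} (X : complexManifold R n).
Local Notation V := 'rV[R[i]]_n.
Local Notation C := R[i].
Variable Y : components X.
Hypothesis Y_transition : forall i j z, overlap i j z ->
  Y j (transition i j z) = Y i z *m 'J (transition i j) z.
Hypothesis Y_smooth : forall i a, csmooth_on (chart_img i) (fun z => Y i z 0 a).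
Implicit Types (i j : chart_index X) (g : R -> X) (t s : R).

(** The condition of being an integral curve, at one time and with [vderive]
    instead of velocities; [flowsE] relates both forms. *)
Definition flows g t := {for t, continuous g} /\ forall i, chart_dom X i (g t) ->
  vderive (chart_map X i \o g) t (Y i (chart_map X i (g t))).

Lemma flowsE (J : set R) g :
  integral_curve_on Y J g <-> forall t, J t -> flows g t.
Proof.
split=> h t /h[gc hi]; split => // i /hi.
  by move=> [cd <-]; exact: velocity_vderive.
exact: vderive_velocity.
Qed.

(** By the transformation laws of velocities and of the field, one chart
    suffices. *)
Lemma flows_chart i g t : {for t, continuous g} -> chart_dom X i (g t) ->
  vderive (chart_map X i \o g) t (Y i (chart_map X i (g t))) -> flows g t.
Proof.
move=> gc gi dv; split => // j gj.
have := vderive_transition gc gi gj dv.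
rewrite -Y_transition; last exact: overlap_map.
by rewrite /transition /= chart_mapK.
Qed.

Lemma flows_near g g' t : (\forall s \near t, g s = g' s) -> flows g t -> flows g' t.
Proof.
move=> gg' [gc gi]; have E := nbhs_singleton gg'; split.
  move=> A; rewrite -E => /gc nA.
  by apply: filterS2 gg' nA => s /= <-.
move=> i; rewrite -E => /gi; apply: vderive_near.
by apply: filterS gg' => s /= ->.
Qed.

Lemma vderive_shift (c : R -> V) t (a : R) v : vderive c (t + a) v ->
  vderive (fun s => c (s + a)) t v.
Proof.
move=> h p.
have := @is_derive_comp_affine R (co p \o c) 1 a t (co p v).
rewrite !mul1r => /(_ (h p)).
by apply: is_derive_near; apply: near_all => s; rewrite mul1r.
Qed.

Lemma flows_shift g t (a : R) : flows g (t + a) -> flows (fun s => g (s + a)) t.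
Proof.
move=> [gc gi]; split.
  apply: (@continuous_comp _ _ _ (fun s => s + a) g); last exact: gc.
  by apply: cvgD; [exact: cvg_id|exact: cvg_cst].
move=> i /gi; exact: (@vderive_shift (chart_map X i \o g)).
Qed.

Let chart_lipschitz (x : X) := local_lipschitz (chart_img_openP (chart_at X x))
  (Y_smooth (chart_at X x)) (chart_imgP (chart_atP x)).

(** Solve the equation in a chart around x, in which the field is bounded and
    Lipschitz. *)
Lemma flows_exists (x : X) : exists2 U, nbhs x U & exists2 e : R, 0 < e &
  forall y, U y -> exists g, g 0 = y /\ forall t : R, `|t| < e -> flows g t.
Proof.
have [r [L [M [r0 L0 M0 hU hL]]]] := chart_lipschitz x.
set i := chart_at X x in hU hL; set z0 := chart_map X i x in hU hL.
have hM v : cnorm (v - z0) < r -> cnorm (Y i v) <= M by move=> /hU[].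
exists [set y | chart_dom X i y /\ cnorm (chart_map X i y - z0) < r / 2].
  apply: filterI.
    by apply: open_nbhs_nbhs; split; [exact: chart_dom_open|exact: chart_atP].
  have r2 : 0 < r / 2 by rewrite divr_gt0.
  exact: (chart_map_continuous (chart_atP x) (near_cnorm z0 r2)).
exists (picard_time (n := n) r L M); first exact: picard_time_gt0.
move=> y [yi yr].
have [c [c0 hc]] := ode_exists r0 L0 M0 hM hL yr.
exists (chart_inv X i \o c); split; first by rewrite /= c0 chart_mapK.
move=> t te; have [ct dct] := hc t te; have [Ut _] := hU _ ct.
have E : chart_map X i (chart_inv X i (c t)) = c t by exact: chart_invK.
apply: (@flows_chart i).
- apply: (@continuous_comp _ _ _ c (chart_inv X i)).
    exact: vderive_continuous dct.
  exact: chart_inv_continuous.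
- exact: chart_inv_dom.
- rewrite /comp E; apply: vderive_near dct.
  move: te; rewrite ltr_norml => /andP[t1 t2].
  apply: filterS (near_oo t1 t2) => s; rewrite -ltr_norml => /hc[cs _].
  by rewrite chart_invK//; have [] := hU _ cs.
Qed.

Lemma flows_unique (a b : R -> X) t0 : a t0 = b t0 ->
  (\forall t \near t0, flows a t /\ flows b t) -> \forall t \near t0, a t = b t.
Proof.
move=> ab0 hab.
have [[ac _] [bc _]] := nbhs_singleton hab.
set x := a t0 in ab0 *.
have [r [L [M [r0 L0 M0 _ hL]]]] := chart_lipschitz x.
set i := chart_at X x in hL; set z0 := chart_map X i x in hL.
have nU : nbhs x [set y | chart_dom X i y /\ cnorm (chart_map X i y - z0) < r].
  apply: filterI.
    by apply: open_nbhs_nbhs; split; [exact: chart_dom_open|exact: chart_atP].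
  exact: (chart_map_continuous (chart_atP x) (near_cnorm z0 r0)).
have nb : nbhs t0 (b @^-1` [set y | chart_dom X i y /\ cnorm (chart_map X i y - z0) < r]).
  by apply: bc; rewrite -ab0.
have na := ac _ nU.
have u : \forall t \near t0, chart_map X i (a t) = chart_map X i (b t).
  apply: (ode_unique (a := chart_map X i \o a) (b := chart_map X i \o b) r0 L0 hL).
    by rewrite /= -ab0.
  near=> t.
  have [[_ fa] [_ fb]] : flows a t /\ flows b t by near: t.
  have [ai ar] : chart_dom X i (a t) /\ cnorm (chart_map X i (a t) - z0) < r by near: t; exact: na.
  have [bi br] : chart_dom X i (b t) /\ cnorm (chart_map X i (b t) - z0) < r by near: t; exact: nb.
  by split => //; [exact: fa|exact: fb].
near=> t.
have [ai _] : chart_dom X i (a t) /\ cnorm (chart_map X i (a t) - z0) < r by near: t; exact: na.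
have [bi _] : chart_dom X i (b t) /\ cnorm (chart_map X i (b t) - z0) < r by near: t; exact: nb.
rewrite -(chart_mapK ai) -(chart_mapK bi); congr (chart_inv X i).
by near: t.
Unshelve. all: by end_near.
Qed.

Lemma field_continuous i z : chart_img i z -> {for z, continuous (Y i)}.
Proof.
move=> Uz; have [r [L [M [r0 L0 M0 _ hL]]]] := local_lipschitz (chart_img_openP i) (Y_smooth i) Uz.
apply: (lipschitz_continuous L0 hL).
by rewrite subrr cnorm0.
Qed.

(** In a chart, the velocity of an integral curve is the field along the
    curve, which is continuous. *)
Lemma flows_C1 g t : (\forall s \near t, flows g s) -> C1_curve_at g t.
Proof.
move=> h; have [gc _] := nbhs_singleton h; split => // i gi.
have hv : \forall s \near t, coord_derivable i g s /\
    velocity i g s = Y i (chart_map X i (g s)).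
  apply: filterS2 h (near_chart gc gi) => s [_ fs] /fs; exact: vderive_velocity.
split; first by apply: filterS hv => s [].
have cY : {for t, continuous (fun s => Y i (chart_map X i (g s)))}.
  apply: (@continuous_comp _ _ _ (chart_map X i \o g) (Y i)).
    by apply: (@continuous_comp _ _ _ g); [exact: gc|exact: chart_map_continuous].
  by apply: field_continuous; exact: chart_imgP.
move=> A; have [_ ->] := nbhs_singleton hv => /cY nA.
by apply: filterS2 hv nA => s [_ E]; rewrite /= E.
Qed.

End IntegralCurves.

Section ReversedCurves.
Context {R : realType} {n : nat} (X : complexManifold R n) (w : kahlerMetric X).
Local Notation V := 'rV[R[i]]_n.
Local Notation mu := (@lebesgue_measure R).
Implicit Types (i j : chart_index X) (g : R -> X) (t s : R).

Lemma vderive_opp (c : R -> V) t v : vderive c (- t) v ->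
  vderive (fun s => c (- s)) t (- v).
Proof.
move=> h p; rewrite coN.
have := @is_derive_comp_affine R (co p \o c) (- 1) 0 t (co p v).
rewrite !mulN1r addr0 => /(_ (h p)).
by apply: is_derive_near; apply: near_all => s; rewrite mulN1r addr0.
Qed.

Lemma velocity_opp i g t : coord_derivable i g (- t) ->
  coord_derivable i (fun s => g (- s)) t /\
  velocity i (fun s => g (- s)) t = - velocity i g (- t).
Proof.
move=> /velocity_vderive h; apply: vderive_velocity.
exact: (@vderive_opp (chart_map X i \o g)).
Qed.

(** Distances are infima over paths in one direction, and Cauchy sequences
    need both; so integral curves have to be run backwards as well. *)
Lemma C1_curve_opp g t : C1_curve_at g (- t) -> C1_curve_at (fun s => g (- s)) t.
Proof.
move=> [gc gi]; split.
  by apply: (@continuous_comp _ _ _ -%R g); [exact: opp_continuous|exact: gc].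
move=> i /gi[/near_opp h1 h2]; split.
  by apply: filterS h1 => s /velocity_opp[].
have E : \forall s \near t, - velocity i g (- s) = velocity i (fun s => g (- s)) s.
  by apply: filterS h1 => s /velocity_opp[_ ->].
have cv : {for t, continuous (fun s => - velocity i g (- s))}.
  apply: (@continuous_comp _ _ _ (fun s => velocity i g (- s)) -%R); last exact: opp_continuous.
  by apply: (@continuous_comp _ _ _ -%R (velocity i g)); [exact: opp_continuous|exact: h2].
move=> A; rewrite -(nbhs_singleton E) => /cv nA.
by apply: filterS2 E nA => s /= <-.
Qed.

Lemma speed_opp g t : C1_curve_at g (- t) -> speed w (fun s => g (- s)) t = speed w g (- t).
Proof.
move=> [_ /(_ _ (chart_atP _))[/nbhs_singleton/velocity_opp[_ E] _]].
by rewrite /speed E hermN.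
Qed.

Lemma constant_speed_dist g (a b K : R) : a <= b ->
  (forall t, a <= t <= b -> C1_curve_at g t /\ speed w g t = K) ->
  (riemannian_dist w (g a) (g b) <= (K * (b - a))%:E)%E.
Proof.
move=> ab h; apply: ereal_inf_lbound => /=.
have -> : ((K * (b - a))%:E = \int[mu]_(t in `[a, b]) (speed w g t)%:E)%E.
  rewrite (eq_integral (cst K%:E)); last first.
    by move=> t; rewrite inE /= in_itv /= => /h[_ ->].
  rewrite integral_cst//= lebesgue_measure_itv /= lte_fin.
  move: ab; rewrite le_eqVlt => /orP[/eqP ->|ab]; last by rewrite ab -EFinB -EFinM.
  by rewrite ltxx subrr mulr0 mule0.
by apply: path_segment => // t; rewrite /= in_itv => /h[].
Qed.

Lemma constant_speed_dist_sym g (a b K : R) : a <= b ->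
  (forall t, a <= t <= b -> C1_curve_at g t /\ speed w g t = K) ->
  (riemannian_dist w (g b) (g a) <= (K * (b - a))%:E)%E.
Proof.
move=> ab h.
have := @constant_speed_dist (fun s => g (- s)) (- b) (- a) K.
rewrite !opprK lerN2 [- a + b]addrC => /(_ ab); apply=> t /andP[h1 h2]; have [|c1 sK] := h (- t).
  by apply/andP; split; lra.
by split; [exact: C1_curve_opp|rewrite speed_opp].
Qed.

(** The distance of two points of a curve of constant speed K is at most K
    times the elapsed time, so the points at a Cauchy sequence of times form a
    Cauchy sequence. It converges for the distance by completeness, and for
    the topology by [dist_nbhs]. *)
Lemma constant_speed_limit (w_complete : complete_metric w) g (a b K : R) (tau : nat -> R) :
  (forall t, a < t < b -> C1_curve_at g t /\ speed w g t = K) ->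
  (forall k, a < tau k < b) ->
  (forall e : R, 0 < e -> exists N, forall p q : nat, (N <= p)%N -> (N <= q)%N ->
     `|tau p - tau q| < e) ->
  exists x : X, forall A, nbhs x A -> \forall k \near \oo, A (g (tau k)).
Proof.
move=> h ht hc.
have K0 : 0 <= K by have [_ <-] := h _ (ht 0%N); exact: sqrtr_ge0.
have [|x hx] := w_complete (g \o tau).
  move=> e e0; have K1 : 0 < K + 1 by rewrite ltr_wpDl.
  have [N hN] := hc (e / (K + 1)) (divr_gt0 e0 K1); exists N => p q Np Nq.
  apply: (@le_lt_trans _ _ (K * `|tau p - tau q|)%:E); last first.
    rewrite lte_fin; have := hN p q Np Nq; rewrite ltr_pdivlMr//.
    by have := normr_ge0 (tau p - tau q); nra.
  have [a1 b1] := andP (ht p); have [a2 b2] := andP (ht q).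
  have sub t : Num.min (tau p) (tau q) <= t <= Num.max (tau p) (tau q) -> a < t < b.
    move=> /andP[t1 t2]; apply/andP; split.
      by apply: lt_le_trans t1; rewrite lt_min a1.
    by apply: le_lt_trans t2 _; rewrite gt_max b1.
  have [pq|/ltW qp] := leP (tau p) (tau q).
    rewrite distrC ger0_norm ?subr_ge0//; apply: constant_speed_dist => // t tpq.
    by apply/h/sub; rewrite min_l// max_r.
  rewrite ger0_norm ?subr_ge0//; apply: constant_speed_dist_sym => // t tpq.
  by apply/h/sub; rewrite min_r// max_l.
exists x => A /(dist_nbhs w)[d d0 dA].
have nd : nbhs (0%E : \bar R) [set y | (y < d%:E)%E].
  by apply: open_nbhs_nbhs; split; [exact: open_ereal_lt_ereal|rewrite /= lte_fin].
have hk : \forall k \near \oo, (riemannian_dist w (g (tau k)) x < d%:E)%E := hx _ nd.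
by apply: filterS hk => k; exact: dA.
Qed.

End ReversedCurves.

(** * Completeness of the field *)

Section FlowOfGradient.
Variables (R : realType) (n : nat) (X : complexManifold R n) (w : kahlerMetric X).
Local Notation V := 'rV[R[i]]_n.
Local Notation C := R[i].
Hypothesis w_complete : complete_metric w.
Hypothesis w_einstein : kahler_einstein w (- (n.+1)%:R).
Variables (phi : X -> R) (phi_smooth : smooth_function phi).
Hypothesis phi_potential : forall i z, chart_img i z ->
  i_ddbar (local_rep phi i) z = (n.+1)%:R *: metric w i z.
Hypothesis phi_norm : forall i z, chart_img i z -> norm_del w phi i z = (n.+1)%:R.
Implicit Types (i j : chart_index X) (z : V) (g : R -> X).

Local Notation u i := (phi \o chart_inv X i).
Local Notation Y := (flow_field w phi).

Let Y_transition : forall i j z, overlap i j z ->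
  Y j (transition i j z) = Y i z *m 'J (transition i j) z.
Proof. exact: (flow_field_holomorphic w_einstein phi_smooth phi_potential phi_norm).1. Qed.

Let Y_smooth : forall i a, csmooth_on (chart_img i) (fun z => Y i z 0 a).
Proof. exact: flow_field_smooth. Qed.

Let grad_normE i z : chart_img i z ->
  \sum_a wd false a (fun z => (u i z)%:C) z * grad_comp (metric w i) (u i) a z =
  (n.+1%:R ^+ 2 : R)%:C.
Proof.
move=> Uz.
apply: etrans (grad_norm (chart_img_openP i) (@metric_hermitian _ _ _ w i)
  (@metric_posdef _ _ _ w i) (phi_smooth i) (@norm_del_wd _ _ _ w _ phi_norm i) Uz) _.
by rewrite [RHS]rmorphXn; congr (_ ^+ 2); rewrite [RHS]rmorph_nat.
Qed.

(** The derivative of phi in the direction of Re V is twice the real part of i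
    exp (phi / c) |d phi|^2, which is purely imaginary. *)
Lemma dphi_flow_field i z : chart_img i z ->
  \sum_q pd q (u i) z * co q (Y i z) = 0.
Proof.
move=> Uz; rewrite (real_differential _ (phi_smooth i) Uz).
under eq_bigr => a _ do rewrite flow_fieldE mulrCA [X in _ * X]mulrCA.
rewrite -mulr_sumr -mulr_sumr grad_normE// -rmorphM.
by rewrite /= !(mul0r, mulr0, mul1r) subr0 mulr0.
Qed.

Lemma phi_flow g t : flows Y g t -> is_derive t 1 (phi \o g) 0.
Proof.
move=> [gc /(_ _ (chart_atP _))]; set i := chart_at X (g t) => dv.
have gi : chart_dom X i (g t) := chart_atP _.
have Uz := chart_imgP gi.
have F := Ck1_frechet (chart_img_openP i) (phi_smooth i 1%N) Uz.
have := frechet_chain (c := chart_map X i \o g) F dv.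
rewrite dphi_flow_field//; apply: is_derive_near.
by apply: filterS (near_chart gc gi) => s gs; rewrite /= chart_mapK.
Qed.

Lemma phi_flow_constant g (a b : R) : (forall t, a < t < b -> flows Y g t) ->
  forall t s, a < t < b -> a < s < b -> phi (g t) = phi (g s).
Proof.
move=> h; suff W t s : a < t < b -> a < s < b -> t < s -> phi (g t) = phi (g s).
  move=> t s ht hs; have [ts|st|->] := ltgtP t s; [exact: W|exact/esym/W|by []].
move=> /andP[at_ _] /andP[_ sb] ts.
have [t' /andP[t1 t2]|x _] := @mean_value R (phi \o g) (fun=> 0) t s ts.
  by apply/phi_flow/h; rewrite (lt_le_trans at_ t1) (le_lt_trans t2 sb).
by rewrite mul0r => /eqP; rewrite subr_eq0 => /eqP /= ->.
Qed.

(** The squared norm of the field is exp (2 phi / c) |d phi|^2: it depends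
    only on the value of phi. *)
Lemma herm_flow_field i z : chart_img i z ->
  complex.Re (herm (metric w i z) (Y i z)) =
  (expR (u i z / n.+1%:R) * n.+1%:R) ^+ 2.
Proof.
move=> Uz; rewrite hermZ.
have -> : herm (metric w i z) (grad w phi i z) = (n.+1%:R ^+ 2 : R)%:C.
  rewrite /herm grad_lower_chart// mxE.
  rewrite -[RHS]conjc_real -(grad_normE Uz) [RHS]rmorph_sum; apply: eq_bigr => a _.
  rewrite -(cograd_conj (chart_img_openP i) (phi_smooth i) a Uz) gradE !mxE.
  by rewrite [RHS]rmorphM /= conjcK.
rewrite /=; set e := expR _; set m : R := n.+1%:R; ring.
Qed.

Lemma speed_flow g t : flows Y g t ->
  speed w g t = Num.sqrt (2 * (expR (phi (g t) / n.+1%:R) * n.+1%:R) ^+ 2).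
Proof.
move=> [gc /(_ _ (chart_atP _))]; set i := chart_at X (g t) => dv.
have gi : chart_dom X i (g t) := chart_atP _.
rewrite (speedE w gc gi dv) herm_flow_field; last exact: chart_imgP.
by rewrite /= chart_mapK.
Qed.

(** Along an integral curve phi is constant, hence so is the speed. *)
Lemma flow_limit g (a b : R) (tau : nat -> R) : a < b ->
  (forall t, a < t < b -> flows Y g t) -> (forall k, a < tau k < b) ->
  (forall e : R, 0 < e -> exists N, forall p q : nat, (N <= p)%N -> (N <= q)%N ->
     `|tau p - tau q| < e) ->
  exists x : X, forall A, nbhs x A -> \forall k \near \oo, A (g (tau k)).
Proof.
move=> ab h; set m := (a + b) / 2.
have hm : a < m < b by rewrite /m; apply/andP; split; lra.
apply: (constant_speed_limit w_complete
  (K := Num.sqrt (2 * (expR (phi (g m) / n.+1%:R) * n.+1%:R) ^+ 2))) => t ht.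
split; last by rewrite (speed_flow (h t ht)) (phi_flow_constant h ht hm).
have [at_ tb] := andP ht.
apply: (flows_C1 Y_smooth).
by apply: filterS (near_oo at_ tb) => s; exact: h.
Qed.

Let approach (d : R) (k : nat) := d / 2 ^+ k.+1.

Let approach_in (d : R) k : 0 < d -> 0 < approach d k < d.
Proof.
move=> d0; rewrite divr_gt0 ?exprn_gt0//= ltr_pdivrMr ?exprn_gt0// ltr_pMr//.
by rewrite exprn_egt1// ltr1n.
Qed.

Let approach_small (d e : R) : 0 < d -> 0 < e ->
  exists N, forall k, (N <= k)%N -> approach d k < e.
Proof.
move=> d0 e0; have [N hN] := pow2_small (ltW d0) e0; exists N => k Nk.
apply: le_lt_trans hN; rewrite ler_pM2l// lef_pV2 ?posrE ?exprn_gt0//.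
by rewrite ler_weXn2l ?ler1n// leqW.
Qed.

Let approach_cauchy (d e : R) : 0 < d -> 0 < e ->
  exists N, forall p q, (N <= p)%N -> (N <= q)%N -> `|approach d p - approach d q| < e.
Proof.
move=> d0 e0; have [N hN] := approach_small d0 e0; exists N => p q /hN h1 /hN h2.
have /andP[p1 p2] := approach_in p d0; have /andP[q1 q2] := approach_in q d0.
by rewrite ltr_norml; apply/andP; split; lra.
Qed.

Lemma flow_limit_right g (a b : R) : a < b -> (forall t, a < t < b -> flows Y g t) ->
  exists x : X, forall A, nbhs x A -> forall s, s < b ->
    exists t, [/\ s < t, a < t < b & A (g t)].
Proof.
move=> ab h; have d0 : 0 < b - a by rewrite subr_gt0.
have tin k : a < b - approach (b - a) k < b.
  by have /andP[h1 h2] := approach_in k d0; apply/andP; split; lra.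
have [e e0|x hx] := flow_limit ab h tin.
  have [N hN] := approach_cauchy d0 e0; exists N => p q Np Nq.
  have -> : b - approach (b - a) p - (b - approach (b - a) q) =
    approach (b - a) q - approach (b - a) p by ring.
  exact: hN.
exists x => A /hx[N _ hN] s sb.
have s0 : 0 < b - s by rewrite subr_gt0.
have [N' hN'] := approach_small d0 s0.
exists (b - approach (b - a) (maxn N N')); split => //.
  by have := hN' _ (leq_maxr N N'); lra.
by apply: hN; rewrite /= leq_maxl.
Qed.

Lemma flow_limit_left g (a b : R) : a < b -> (forall t, a < t < b -> flows Y g t) ->
  exists x : X, forall A, nbhs x A -> forall s, a < s ->
    exists t, [/\ t < s, a < t < b & A (g t)].
Proof.
move=> ab h; have d0 : 0 < b - a by rewrite subr_gt0.
have tin k : a < a + approach (b - a) k < b.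
  by have /andP[h1 h2] := approach_in k d0; apply/andP; split; lra.
have [e e0|x hx] := flow_limit ab h tin.
  have [N hN] := approach_cauchy d0 e0; exists N => p q Np Nq.
  have -> : a + approach (b - a) p - (a + approach (b - a) q) =
    approach (b - a) p - approach (b - a) q by ring.
  exact: hN.
exists x => A /hx[N _ hN] s as_.
have s0 : 0 < s - a by rewrite subr_gt0.
have [N' hN'] := approach_small d0 s0.
exists (a + approach (b - a) (maxn N N')); split => //.
  by have := hN' _ (leq_maxr N N'); lra.
by apply: hN; rewrite /= leq_maxl.
Qed.

Lemma flow_field_complete : complete_vector_field Y.
Proof.
have hX : hausdorff_space X by exact: manifold_hausdorff.
have P_cont g t : flows Y g t -> {for t, continuous g} by case.
have P_unique := flows_unique Y_smooth.
have P_exists := flows_exists Y_transition Y_smooth.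
split => [x|J d oJ iJ /flowsE hd].
  have [g [g0 gf]] := global_solution hX P_cont P_unique
    (@flows_near _ _ _ Y) (@flows_shift _ _ _ Y) P_exists flow_limit_right
    flow_limit_left x.
  by exists g; split => //; apply/flowsE => t _.
have [g [gf gd]] := extend_solution hX P_cont P_unique
  (@flows_near _ _ _ Y) (@flows_shift _ _ _ Y) P_exists flow_limit_right
  flow_limit_left oJ iJ hd.
by exists g; split => //; apply/flowsE => t _.
Qed.

End FlowOfGradient.

Local Close Scope classical_set_scope.
Unset Implicit Arguments.
Set Strict Implicit.
Set Printing Implicit Defensive.

Theorem theorem3p2 (R : realType) (n : nat) (X : complexManifold R n)
    (w : kahlerMetric X) (w_complete : complete_metric w)
    (w_einstein : kahler_einstein w (- (n.+1)%:R))
    (phi : X -> R) (phi_smooth : smooth_function phi)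
    (phi_potential : forall i z, chart_img i z ->
       i_ddbar (local_rep phi i) z = (n.+1)%:R *: metric w i z)
    (phi_norm : forall i z, chart_img i z -> norm_del w phi i z = (n.+1)%:R) :
  let V : components X := fun i z =>
    ('i%C * (expR (phi (chart_inv X i z) / (n.+1)%:R))%:C) *: grad w phi i z in
  holomorphic_vector_field V /\ complete_vector_field V.
Proof.
move=> V; split.
  exact: (flow_field_holomorphic w_einstein phi_smooth phi_potential phi_norm).
exact: (flow_field_complete w_complete w_einstein phi_smooth phi_potential phi_norm).
Qed.
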